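(* Let $F_4$ be a truly four-dimensional probability distribution on $\mathbb{Z}^4$ with mean zero and finite variance under which the four coordinates are independent, let $(a_n)_{n\ge 1}$ be a strictly increasing sequence of positive integers, and let $\{S_k\}$ be the $\mathbb{Z}^2$ in $\mathbb{Z}^4$ random walk in varying dimension determined by $F_4$ and $(a_n)$. Put $$\phi(n)=\frac{\log(a_{n+1}/a_n)}{\log a_{n+1}},\qquad n\ge 1 .$$ (i) If $\sum_{n} n^{-1}\phi(n)<\infty$, then $\{S_k\}$ is transient. (ii) If $\sum_{n} n^{-1}\phi(n)=\infty$ and the sequence $\{\phi(n)\}$ is nonincreasing, then $\{S_k\}$ is recurrent.
   Context: A distribution on $\mathbb{Z}^D$ is truly $D$-dimensional if it is not supported on any proper linear subspace of $\mathbb{R}^D$. For $d<D$, the $\mathbb{Z}^d$ in $\mathbb{Z}^D$ random walk in varying dimension determined by a distribution $F_D$ on $\mathbb{Z}^D$ and an increasing sequence $(a_n)_{n\ge1}$ is the process $\{S_k\}_{k\ge 0}$ in $\mathbb{Z}^D$ with $S_0=0$ and independent increments $S_k-S_{k-1}$ ($k\ge1$), where $S_k-S_{k-1}$ has distribution $F_D$ if $k\in\{a_n:n\ge1\}$, and has distribution $F_d$ otherwise; here $F_d$ is the projection of $F_D$ to the first $d$ coordinates (the remaining $D-d$ coordinates of the increment being $0$). The process is recurrent if almost surely $S_k=0$ for infinitely many $k$, and transient if almost surely $S_k=0$ for only finitely many $k$. *)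

(* Defs.v *)
From HB Require Import structures.
From mathcomp Require Import all_boot all_order all_algebra finmap.
From mathcomp Require Import all_classical all_reals all_analysis.

Set Implicit Arguments.
Unset Strict Implicit.
Unset Printing Implicit Defensive.

Import Order.TTheory GRing.Theory Num.Theory.
Import numFieldNormedType.Exports.

Local Open Scope classical_set_scope.
Local Open Scope ring_scope.

(* Z^D with the discrete sigma-algebra: a distribution on Z^D is then a
   [probability (lattice D) R]. *)
Definition lattice (D : nat) : Type := 'rV[int]_D.

HB.instance Definition _ D := GRing.Zmodule.copy (lattice D) 'rV[int]_D.
HB.instance Definition _ D := isPointed.Build (lattice D) 0.
HB.instance Definition _ D := @isMeasurable.Build default_measure_display
  (lattice D) discrete_measurable discrete_measurable0
  discrete_measurableC discrete_measurableU.

Lemma measurable_fun_lattice (D : nat) (d : measure_display)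
    (T : measurableType d) (f : lattice D -> T) : measurable_fun setT f.
Proof. by []. Qed.

Definition coordinate (R : realType) (D : nat) (i : 'I_D) : lattice D -> R :=
  fun v => ((v : 'rV[int]_D) 0 i)%:~R.

HB.instance Definition _ (R : realType) (D : nat) (i : 'I_D) :=
  @isMeasurableFun.Build _ _ (lattice D) R (coordinate R i)
    (@measurable_fun_lattice _ _ _ _).

Definition truncate (D d : nat) : lattice D -> lattice D :=
  fun v => \row_(i < D) (if (i < d)%N then (v : 'rV[int]_D) 0 i else 0).

HB.instance Definition _ (D d : nat) :=
  @isMeasurableFun.Build _ _ (lattice D) (lattice D) (@truncate D d)
    (@measurable_fun_lattice _ _ _ _).

(* The projection F_d of F_D to the first d coordinates, seen as a
   distribution on Z^D. *)
Definition projection (R : realType) (D d : nat)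
    (F : probability (lattice D) R) : probability (lattice D) R :=
  distribution F (@truncate D d).

Definition truly_dimensional (R : realType) (D : nat)
    (F : probability (lattice D) R) : Prop :=
  forall V : {vspace 'rV[R]_D}, V != fullv ->
    F [set v : lattice D | \row_(i < D) coordinate R i v \in V] <> 1%E.

Definition mutually_independent (R : realType) (d d' : measure_display)
    (Omega : measurableType d) (T : measurableType d')
    (P : probability Omega R) (I : choiceType) (X : I -> Omega -> T) : Prop :=
  forall (J : {fset I}) (A : I -> set T), (forall i, measurable (A i)) ->
    P (\bigcap_(i in [set` J]) X i @^-1` A i) =
    (\prod_(i <- J) P (X i @^-1` A i))%E.

(* Sequences (a_n)_{n >= 1} are functions on nat whose value at 0 is ignored. *)
Definition special_times (a : nat -> nat) : set nat :=
  [set a n | n in [set n | (1 <= n)%N]].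

Definition increment (R : realType) (disp : measure_display)
    (Omega : measurableType disp) (P : probability Omega R) (D : nat)
    (S : nat -> {RV P >-> lattice D}) (k : nat) : Omega -> lattice D :=
  fun w => S k w - S k.-1 w.

Record varying_dimension_walk (R : realType) (disp : measure_display)
    (Omega : measurableType disp) (P : probability Omega R) (D d : nat)
    (F : probability (lattice D) R) (a : nat -> nat)
    (S : nat -> {RV P >-> lattice D}) : Prop := {
  walk_start : forall w, S 0%N w = 0 ;
  walk_independent : mutually_independent P (fun k => increment S k.+1) ;
  walk_special_law : forall k, (1 <= k)%N -> special_times a k ->
    pushforward P (increment S k) = F ;
  walk_ordinary_law : forall k, (1 <= k)%N -> ~ special_times a k ->
    pushforward P (increment S k) = projection d F }.

Definition recurrent (R : realType) (disp : measure_display)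
    (Omega : measurableType disp) (P : probability Omega R) (D : nat)
    (S : nat -> {RV P >-> lattice D}) : Prop :=
  {ae P, forall w, infinite_set [set k | S k w = 0]}.

Definition transient (R : realType) (disp : measure_display)
    (Omega : measurableType disp) (P : probability Omega R) (D : nat)
    (S : nat -> {RV P >-> lattice D}) : Prop :=
  {ae P, forall w, finite_set [set k | S k w = 0]}.

Definition phi (R : realType) (a : nat -> nat) (n : nat) : R :=
  ln ((a n.+1)%:R / (a n)%:R) / ln (a n.+1)%:R.

(* Main.v *)
Require Import Defs.
From HB Require Import structures.
From mathcomp Require Import all_boot all_order all_algebra finmap.
From mathcomp Require Import all_classical all_reals all_analysis.
From mathcomp Require Import ring lra zify.

(** Let [N] be the number of special times in a stretch of [r] steps. Over that
    stretch the walk makes [r] effective steps in each of the first two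
    coordinates and [N] in each of the last two, and the coordinates are
    independent, so that one-dimensional local estimates make the probability
    of a given displacement of order [1 / (r N)]: from above for every
    displacement [pr_displaced_le], from below for those in a lattice, at
    multiples of a period [walk_lower_bounds].

    The local estimates do without characteristic functions. A law with two
    atoms is a mixture of a fair coin toss between them and of another law
    [coin_remainder], so a sum of [n] steps contains a binomial law with a
    number of tosses of order [n]. The size of binomial coefficients then
    bounds its atoms from above [coef_exp_le] and, with the inequality of
    Chebyshev for the rest of the sum, from below [coef_exp_ge]. Laws are cut
    off to the box [-M, M], where they become polynomials and convolution
    becomes multiplication; the bounds do not depend on [M], and the cut-off
    disappears as [M] grows [pr_hits_boxed].

    Transience. Between the times [a n] and [a (n + 1)] the last two
    coordinates do not move, so the walk visits the origin when the plane walk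
    does and the others are at rest at zero. The expected number of visits is
    at most of order [ln (a (n + 1) / a n) / n]. After a first visit the plane
    walk comes back about [ln (a (n + 1))] times before a multiple of [a (n + 1)]
    [first_return_renewal], and dividing shows that the interval contains a
    visit with probability of order [phi n / n] at most, up to an error that is
    summable for every sequence of times [pr_interval_return_le],
    [short_gap_cube]. The lemma of Borel and Cantelli concludes
    [walk_transient].

    Recurrence. Weigh a visit in the [n]-th interval by [1 / ln (a (n + 1))].
    The weighted number of visits has a mean [W] of order the sum of
    [phi n / n]. In its second moment, pairs of visits within one interval
    contribute order [W], again because the plane walk comes back a logarithmic
    number of times; pairs in two intervals [n < n'] contribute
    [phi n * phi n' / (n * (n' - n))], where monotonicity replaces [phi n'] by
    [phi (n' - n)], whence a sum of order [W ^ 2] [interaction_sum]. So a visit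
    occurs with probability bounded below, and this holds given all the past up
    to suitable times, with the same constant wherever the walk is
    [later_zero]. Then the probability of no visit after [m] is at most
    [1 - del] times its limit along the events of no visit between [m] and
    [n], that is [1 - del] times itself, and it vanishes [pr_never]. *)

Set Implicit Arguments.
Unset Strict Implicit.
Unset Printing Implicit Defensive.

Import Order.TTheory GRing.Theory Num.Theory.
Import numFieldNormedType.Exports.

Local Open Scope classical_set_scope.
Local Open Scope ring_scope.

(** * Binomial coefficients *)

Lemma central_bin_rec n :
  (n.+1 * 'C(n.+1.*2, n.+1) = 2 * n.*2.+1 * 'C(n.*2, n))%N.
Proof.
have := mul_bin_diag n.*2.+2 n.
have := mul_bin_down n.*2.+1 n.
rewrite /= doubleS (_ : (n.*2.+1 - n = n.+1)%N); last by lia.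
move: 'C(n.*2, n) 'C(n.*2.+1, n) 'C(n.*2.+2, n.+1) => A B C h1 h2.
by apply/eqP; rewrite -(eqn_pmul2l (ltn0Sn n)); apply/eqP; nia.
Qed.

Lemma bin_le_central n j : ('C(n.*2, j) <= 'C(n.*2, n))%N.
Proof.
have up d : ('C(n.*2, n + d) <= 'C(n.*2, n))%N.
  elim: d => [|d IH]; first by rewrite addn0.
  apply: leq_trans IH; rewrite addnS.
  have := mul_bin_left n.*2 (n + d).
  move: 'C(n.*2, (n + d).+1) 'C(n.*2, n + d) => A B hAB.
  by rewrite -(leq_pmul2l (ltn0Sn (n + d))) hAB leq_mul2r; apply/orP; right; lia.
have [jn|nj] := leqP n j; first by rewrite -(subnKC jn).
rewrite -bin_sub; last by lia.
by have := up (n - j)%N; rewrite (_ : (n + (n - j) = n.*2 - j)%N) //; lia.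
Qed.

(** Squaring makes the ratio of consecutive terms rational, and induction works
    because [(2 n + 1) (2 n + 3) <= 4 (n + 1) ^ 2]. *)
Lemma central_bin_upper n : ('C(n.*2, n) ^ 2 * n.*2.+1 <= 16 ^ n)%N.
Proof.
elim: n => // n IH; have := central_bin_rec n.
rewrite (expnS 16 n); move: 'C(n.+1.*2, n.+1) 'C(n.*2, n) (16 ^ n)%N IH => A B T IH h.
rewrite -(leq_pmul2l (ltn0Sn n)) -(leq_pmul2l (ltn0Sn n)).
have -> : (n.+1 * (n.+1 * (A ^ 2 * n.+1.*2.+1)) = (n.+1 * A) ^ 2 * n.+1.*2.+1)%N.
  by rewrite expnMn; ring.
rewrite h.
have -> : ((2 * n.*2.+1 * B) ^ 2 * n.+1.*2.+1 =
   (B ^ 2 * n.*2.+1) * (4 * n.*2.+1 * n.+1.*2.+1))%N by rewrite !expnMn; ring.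
rewrite (_ : n.+1 * (n.+1 * (16 * T)) = T * (16 * (n.+1 * n.+1)))%N; last by ring.
by apply: leq_mul => //; nia.
Qed.

Lemma central_bin_lower n : (0 < n)%N -> (16 ^ n <= 'C(n.*2, n) ^ 2 * (4 * n))%N.
Proof.
case: n => // n _; elim: n => // n IH; have := central_bin_rec n.+1.
rewrite (expnS 16 n.+1).
move: 'C(n.+2.*2, n.+2) 'C(n.+1.*2, n.+1) (16 ^ n.+1)%N IH => A B T IH h.
have h2 : (n.+2 ^ 2 * (n.+1 * (16 * T)) <= n.+2 ^ 2 * (n.+1 * (A ^ 2 * (4 * n.+2))))%N.
  have -> : (n.+2 ^ 2 * (n.+1 * (A ^ 2 * (4 * n.+2))) =
     (n.+2 * A) ^ 2 * (4 * n.+2 * n.+1))%N by rewrite expnMn; ring.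
  rewrite h !expnMn.
  apply: (@leq_trans (n.+2 ^ 2 * (16 * n.+1 * (B ^ 2 * (4 * n.+1)))))%N.
    by rewrite leq_mul2l (_ : n.+1 * (16 * T) = 16 * n.+1 * T)%N ?leq_mul2l ?IH ?orbT //; ring.
  have -> : (n.+2 ^ 2 * (16 * n.+1 * (B ^ 2 * (4 * n.+1))) =
     B ^ 2 * (4 * n.+2 * n.+1 * (16 * n.+1 * n.+2)))%N by ring.
  have -> : (2 ^ 2 * n.+1.*2.+1 ^ 2 * B ^ 2 * (4 * n.+2 * n.+1) =
     B ^ 2 * (4 * n.+2 * n.+1 * (4 * n.+1.*2.+1 ^ 2)))%N by ring.
  rewrite !leq_mul2l; apply/orP; right; apply/orP; right; nia.
by move: h2; rewrite !leq_pmul2l // expn_gt0.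
Qed.

(** An entry of an odd row is a sum of two entries of the even row above it. *)
Lemma bin_upper m j : ('C(m, j) ^ 2 * m.+1 <= 2 * 4 ^ m)%N.
Proof.
have ev n i : ('C(n.*2, i) ^ 2 * n.*2.+1 <= 4 ^ n.*2)%N.
  rewrite -mul2n (expnM 4 2 n) /= mul2n; apply: leq_trans (central_bin_upper n).
  by rewrite leq_mul2r leq_sqr bin_le_central orbT.
have -> : m = (odd m + m./2.*2)%N by rewrite odd_double_half.
case: (odd m); last by rewrite add0n; apply: leq_trans (ev _ _) _; lia.
set n := m./2; rewrite add1n.
have cle : ('C(n.*2.+1, j) <= 2 * 'C(n.*2, n))%N.
  case: j => [|j]; first by rewrite bin0; have := bin_le_central n 0; rewrite bin0; lia.
  by rewrite binS; have := bin_le_central n j; have := bin_le_central n j.+1; lia.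
have := ev n n; rewrite (expnS 4 n.*2).
move: 'C(_, j) 'C(_, n) cle (4 ^ _)%N => A B cle T h.
apply: (@leq_trans ((2 * B) ^ 2 * n.*2.+2))%N; first by rewrite leq_mul2r leq_sqr cle orbT.
have : (n.*2.+2 <= 2 * n.*2.+1)%N by lia.
rewrite expnMn; move: (n.*2.+1) h => k h h2.
apply: (@leq_trans (8 * (B ^ 2 * k))); last by lia.
by rewrite (_ : 8 * (B ^ 2 * k) = 2 ^ 2 * B ^ 2 * (2 * k))%N ?leq_mul2l ?h2 ?orbT //; ring.
Qed.

Section BinomialWindow.
Variable R : realType.
Implicit Types (K x : R) (m n d B : nat).

Lemma exprN_ge_expR x d : 0 <= x -> x <= 2^-1 ->
  expR (- (2 * x * d%:R)) <= (1 - x) ^+ d.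
Proof.
move=> x0 x1.
have h : expR (- (2 * x)) <= 1 - x.
  rewrite expRN -[leRHS]invrK lef_pV2 ?posrE ?expR_gt0 ?invr_gt0; try lra.
  apply: le_trans (expR_ge1Dx (2 * x)).
  rewrite -[leLHS]mul1r ler_pdivrMr; [nra|lra].
rewrite (_ : - (2 * x * d%:R) = d%:R * - (2 * x)); last by ring.
by rewrite expRM_natl lerXn2r // nnegrE ?expR_ge0 //; lra.
Qed.

(** From [n] to [n + d] consecutive entries decrease by a factor at least
    [1 - 2 d / (n + 1)], and there are [d] factors. *)
Lemma bin_even_lower n d : (4 * d <= n.+1)%N ->
  'C(n.*2, n)%:R * expR (- (4 * d%:R ^+ 2 / n.+1%:R)) <= 'C(n.*2, n + d)%:R :> R.
Proof.
move=> dn; set x : R := 2 * d%:R / n.+1%:R.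
have x0 : 0 <= x by rewrite divr_ge0 ?mulr_ge0.
have x1 : x <= 2^-1.
  rewrite ler_pdivrMr ?ltr0n //.
  have : (4 * d)%:R <= n.+1%:R :> R by rewrite ler_nat.
  by rewrite natrM; lra.
have step e : (e <= d)%N -> 'C(n.*2, n)%:R * (1 - x) ^+ e <= 'C(n.*2, n + e)%:R :> R.
  elim: e => [|e IH] ed; first by rewrite expr0 mulr1 addn0.
  have {}IH := IH (ltnW ed).
  rewrite exprSr mulrA; apply: le_trans (ler_wpM2r _ IH) _; first lra.
  have := mul_bin_left n.*2 (n + e); rewrite addnS (_ : (n.*2 - (n + e) = n - e)%N); last by lia.
  move: 'C(n.*2, (n + e).+1) 'C(n.*2, n + e) => A C h.
  rewrite -(ler_pM2l (_ : 0 < (n + e).+1%:R :> R)) ?ltr0n // -natrM h natrM natrB; last by lia.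
  rewrite mulrCA [leRHS]mulrC; apply: ler_wpM2l => //.
  have hx : x * n.+1%:R = 2 * d%:R by rewrite /x divfK ?pnatr_eq0.
  have : e.+1%:R <= d%:R :> R by rewrite ler_nat.
  have ee : 0 <= x * e%:R by rewrite mulr_ge0.
  move: hx; rewrite -!natr1 natrD; nra.
apply: le_trans (step d (leqnn _)); apply: ler_wpM2l => //.
apply: le_trans (exprN_ge_expR d x0 x1).
by rewrite /x le_eqVlt; apply/orP; left; apply/eqP; congr (expR _); ring.
Qed.

(** The Gaussian window of the binomial law: a wide multiple [sqrt (K m)] of
    the standard deviation still carries mass of the central order. *)
Lemma bin_window_lower K : 0 < K -> exists (c : R) m0, 0 < c /\
  forall m B, (m0 <= m)%N -> (m%:R - 2 * B%:R) ^+ 2 <= K * m.+1%:R ->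
    c * 2 ^+ m / Num.sqrt m.+1%:R <= 'C(m, B)%:R.
Proof.
(* From this row on, the window is short enough for [bin_even_lower]. *)
move=> K0; exists (expR (- (4 * K + 2)) / 4), (Num.truncn (16 * K + 8)).+2.*2.
split=> [|m B m0m hB]; first by rewrite divr_gt0 ?expR_gt0.
pose n := m./2; pose d := if (n <= B)%N then (B - n)%N else (n - B)%N.
have mE : m = (odd m + n.*2)%N by rewrite odd_double_half.
have bb : (odd m <= 1)%N by case: (odd m).
have n0 : (0 < n)%N by lia.
have nK : 16 * K + 8 <= n.+1%:R.
  have h : 16 * K + 8 < (Num.truncn (16 * K + 8)).+1%:R.
    by apply: Num.Theory.truncnS_gt.
  apply: le_trans (ltW h) _; rewrite ler_nat; lia.
have dE : d%:R ^+ 2 = (B%:R - n%:R) ^+ 2 :> R.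
  by rewrite /d; case: ifP => h; rewrite natrB; [|lia|ring|lia].
have mR : m%:R = (odd m)%:R + 2 * n%:R :> R.
  by rewrite {1}mE natrD -muln2 natrM; ring.
have b1 : (odd m)%:R <= 1 :> R by rewrite (ler_nat _ _ 1).
have b0 : 0 <= (odd m)%:R :> R by [].
have n1 : n.+1%:R = 1 + n%:R :> R by rewrite -natr1 addrC.
have m1 : m.+1%:R = 1 + m%:R :> R by rewrite -natr1 addrC.
have d2 : 4 * d%:R ^+ 2 <= (4 * K + 2) * n.+1%:R :> R.
  rewrite dE; move: hB; rewrite m1 n1 mR.
  set b := (odd m)%:R : R; set u := n%:R : R; set v := B%:R : R => hB.
  have u0 : 0 <= u by [].
  have : 4 * (v - u) ^+ 2 <= 2 * (b + 2 * u - 2 * v) ^+ 2 + 2 * b ^+ 2.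
    by have := sqr_ge0 (2 * (v - u) - 2 * b); nra.
  have : b ^+ 2 <= 1 by rewrite expr2; nra.
  have : K * (1 + (b + 2 * u)) <= K * (2 * (1 + u)) by rewrite ler_pM2l //; lra.
  nra.
have dn : (4 * d <= n.+1)%N.
  rewrite -(ler_nat R) natrM -(@ler_pXn2r _ 2) ?nnegrE ?mulr_ge0 //.
  rewrite exprMn; apply: le_trans (_ : (16 * K + 8) * n.+1%:R <= _); first by nra.
  by rewrite expr2 ler_wpM2r.
have CB : ('C(n.*2, n + d) <= 'C(m, B))%N.
  have -> : 'C(n.*2, n + d) = 'C(n.*2, B).
    rewrite /d; case: ifP => h; first by rewrite subnKC.
    rewrite -[RHS]bin_sub; last by lia.
    by congr ('C(_, _)); lia.
  rewrite [in leqRHS]mE; case: (odd m) => //.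
  by rewrite add1n; case: (B) => [|B']; rewrite ?bin0 // binS leq_addr.
apply: (@le_trans _ _ 'C(n.*2, n + d)%:R); last by rewrite ler_nat.
apply: le_trans (bin_even_lower dn).
have cl := central_bin_lower n0.
have cl2 : 2 ^+ m / Num.sqrt m.+1%:R <= 4 * 'C(n.*2, n)%:R :> R.
  have s0 : 0 < Num.sqrt m.+1%:R :> R by rewrite sqrtr_gt0 ltr0n.
  rewrite ler_pdivrMr //.
  have : 16%:R ^+ n <= 'C(n.*2, n)%:R ^+ 2 * (4 * m.+1%:R) :> R.
    rewrite -!natrX -!natrM ler_nat; apply: leq_trans cl _.
    by rewrite leq_mul2l; apply/orP; right; lia.
  rewrite -ler_sqrt ?mulr_ge0 ?sqr_ge0 // sqrtrM ?sqr_ge0 // sqrtr_sqr ger0_norm //.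
  rewrite (_ : 16%:R ^+ n = (4 ^+ n) ^+ 2 :> R); last by rewrite -exprM mulnC exprM; congr (_ ^+ n); ring.
  rewrite sqrtr_sqr ger0_norm ?exprn_ge0 // sqrtrM //.
  have -> : Num.sqrt 4 = 2 :> R.
    by rewrite (_ : 4 = 2 ^+ 2 :> R) ?sqrtr_sqr ?ger0_norm //; ring.
  have -> : 2 ^+ m = 2 ^+ odd m * 4 ^+ n :> R.
    by rewrite {1}mE exprD -mul2n exprM; congr (_ * _ ^+ _); ring.
  have : 2 ^+ odd m <= 2 :> R by case: (odd m); rewrite ?expr1 ?expr0 //; lra.
  have : 0 <= 4 ^+ n :> R by rewrite exprn_ge0.
  set T := _ ^+ n; set q := 2 ^+ _; set w := Num.sqrt _ => T0 q2 h4.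
  have : q * T <= 2 * T by rewrite ler_wpM2r.
  lra.
rewrite -mulrA; apply: le_trans (ler_wpM2l _ cl2) _; first by rewrite divr_ge0 ?expR_ge0.
rewrite mulrA divfK ?pnatr_eq0 // mulrC; apply: ler_wpM2l => //.
by rewrite ler_expR lerN2 ler_pdivrMr.
Qed.

End BinomialWindow.

(** * Powers of polynomials with nonnegative coefficients *)

Section NonnegCoefs.
Variable R : realType.
Implicit Types (p q : {poly R}) (b : R).

Definition nneg_coefs p := forall i, 0 <= p`_i.

Lemma nneg_coefsM p q : nneg_coefs p -> nneg_coefs q -> nneg_coefs (p * q).
Proof.
by move=> hp hq i; rewrite coefM; apply: sumr_ge0 => j _; apply: mulr_ge0.
Qed.

Lemma nneg_coefsD p q : nneg_coefs p -> nneg_coefs q -> nneg_coefs (p + q).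
Proof. by move=> hp hq i; rewrite coefD addr_ge0. Qed.

Lemma nneg_coefs_Xn n : nneg_coefs 'X^n.
Proof. by move=> i; rewrite coefXn. Qed.

Lemma nneg_coefsZ b p : 0 <= b -> nneg_coefs p -> nneg_coefs (b *: p).
Proof. by move=> b0 hp i; rewrite coefZ mulr_ge0. Qed.

Lemma nneg_coefsX p n : nneg_coefs p -> nneg_coefs (p ^+ n).
Proof.
move=> hp; elim: n => [|n IH]; first by move=> i; rewrite expr0 coef1.
by rewrite exprS; apply: nneg_coefsM.
Qed.

Lemma horner1_sum p n : (size p <= n)%N -> p.[1] = \sum_(i < n) p`_i.
Proof.
move=> h; rewrite (horner_coef_wide _ h).
by apply: eq_bigr => i _; rewrite expr1n mulr1.
Qed.

Lemma partial_sum_le_horner1 p n : nneg_coefs p -> \sum_(i < n) p`_i <= p.[1].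
Proof.
move=> hp; rewrite (@horner1_sum p (maxn n (size p))) ?leq_maxr //.
rewrite -!(big_mkord xpredT (fun i => p`_i)) (@big_cat_nat _ _ _ n 0%N (maxn _ _)) ?leq_maxl //=.
by rewrite lerDl sumr_ge0.
Qed.

Lemma horner1_ge0 p : nneg_coefs p -> 0 <= p.[1].
Proof. by move=> hp; apply: le_trans (partial_sum_le_horner1 0 hp); rewrite big_ord0. Qed.

Lemma coef_mul_le p q b N : nneg_coefs q -> (forall i, p`_i <= b) -> 0 <= b ->
  (p * q)`_N <= b * q.[1].
Proof.
move=> hq hp b0; rewrite coefMr.
apply: le_trans (_ : \sum_(j < N.+1) b * q`_j <= _).
  by apply: ler_sum => j _; apply: ler_wpM2r.
by rewrite -mulr_sumr; apply: ler_wpM2l => //; apply: partial_sum_le_horner1.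
Qed.

Lemma coef_1DX_exp n j : ((1 + 'X) ^+ n : {poly R})`_j = 'C(n, j)%:R.
Proof.
rewrite exprDn coef_sum.
have [jn|nj] := ltnP j n.+1.
  rewrite (bigD1 (Ordinal jn)) //= expr1n mul1r coefMn coefXn eqxx.
  rewrite big1 ?addr0 // => i ij; rewrite expr1n mul1r coefMn coefXn.
  by case: eqP => [ji|]; [case/eqP: ij; apply/val_inj|rewrite mul0rn].
rewrite bin_small // big1 // => i _; rewrite expr1n mul1r coefMn coefXn.
by case: eqP => [ji|]; [have := ltn_ord i; lia|rewrite mul0rn].
Qed.

Lemma coef_1DXh_exp n h j : (0 < h)%N ->
  ((1 + 'X^h) ^+ n : {poly R})`_j = if (h %| j)%N then 'C(n, j %/ h)%:R else 0.
Proof.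
move=> h0.
have -> : (1 + 'X^h) ^+ n = ((1 + 'X) ^+ n) \Po 'X^h :> {poly R}.
  by rewrite rmorphXn rmorphD rmorph1 /= comp_polyX.
by rewrite coef_comp_poly_Xn // coef_1DX_exp.
Qed.

(** Removing [b X^x (1 + X^h)] leaves a nonnegative remainder: the step law is
    a mixture of a fair coin toss between [x] and [x + h] and another law. *)
Lemma coin_remainder p b x h : (0 < h)%N -> nneg_coefs p ->
  b <= p`_x -> b <= p`_(x + h) -> nneg_coefs (p - b *: ('X^x * (1 + 'X^h))).
Proof.
move=> h0 hp b1 b2 i; rewrite coefB coefZ mulrDr mulr1 coefD -exprD !coefXn.
case: (eqVneq i x) => [->|ix].
  by rewrite (_ : (x == x + h)%N = false) ?addr0 ?mulr1 ?subr_ge0 //; lia.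
case: (eqVneq i (x + h)%N) => [->|_]; first by rewrite add0r mulr1 subr_ge0.
by rewrite addr0 mulr0 subr0.
Qed.

(** Division by [m + 1] turns the row [n] of binomial coefficients into the row
    [n + 1] without its first entry. *)
Lemma binomial_inverse_moment (u v : R) n : 0 < u -> 0 <= v -> u + v <= 1 ->
  \sum_(m < n.+1) 'C(n, m)%:R * u ^+ m * v ^+ (n - m) / m.+1%:R <= (n.+1%:R * u)^-1.
Proof.
move=> u0 v0 uv; rewrite -[leRHS]mul1r ler_pdivlMr ?mulr_gt0 ?ltr0n //.
rewrite mulr_suml; apply: le_trans (_ : (u + v) ^+ n.+1 <= _); last first.
  by rewrite exprn_ile1 // addr_ge0 // ltW.
rewrite [u + v]addrC exprDn [leRHS]big_ord_recl /= -[leLHS]add0r; apply: lerD.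
  by rewrite bin0 mulr1n mulr1 exprn_ge0.
rewrite le_eqVlt; apply/orP; left; apply/eqP; apply: eq_bigr => i _.
rewrite /bump /= add1n subSS -[RHS]mulr_natr exprSr.
have : (i.+1%:R * 'C(n.+1, i.+1)%:R = n.+1%:R * 'C(n, i)%:R :> R).
  by rewrite -!natrM -mul_bin_diag.
move=> h; have -> : 'C(n.+1, i.+1)%:R = n.+1%:R * 'C(n, i)%:R / i.+1%:R :> R.
  by rewrite -h mulrAC divff ?mul1r // pnatr_eq0.
ring.
Qed.

Lemma binomial_mass (u v : R) n :
  \sum_(m < n.+1) 'C(n, m)%:R * u ^+ m * v ^+ (n - m) = (u + v) ^+ n.
Proof.
rewrite [u + v]addrC exprDn; apply: eq_bigr => m _.
by rewrite -[RHS]mulr_natr; ring.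
Qed.

Lemma coin_expansion p b x h n N : p = b *: ('X^x * (1 + 'X^h)) + (p - b *: ('X^x * (1 + 'X^h))) ->
  (p ^+ n)`_N = \sum_(m < n.+1) 'C(n, m)%:R * b ^+ m *
    ('X^(x * m) * (1 + 'X^h) ^+ m * (p - b *: ('X^x * (1 + 'X^h))) ^+ (n - m))`_N.
Proof.
move=> {1}->; rewrite addrC exprDn coef_sum; apply: eq_bigr => m _.
rewrite coefMn exprZn exprMn -exprM -scalerAr coefZ -[LHS]mulr_natl !mulrA.
by congr (_ * _); congr (_`_N); rewrite -!mulrA mulrC -!mulrA.
Qed.

(** The concentration bound of a lattice walk: each step contains a coin toss,
    so that a large binomial part smooths the law of the sum; the number of
    tosses is itself binomial, and enters through the mean of [1 / (m + 1)]. *)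
Lemma coef_exp_le p b x h n N : nneg_coefs p -> p.[1] <= 1 -> 0 < b -> (0 < h)%N ->
  b <= p`_x -> b <= p`_(x + h) -> (p ^+ n)`_N <= (Num.sqrt (b * n.+1%:R))^-1.
Proof.
move=> hp p1 b0 h0 b1 b2; set g := p - b *: ('X^x * (1 + 'X^h)).
have hg : nneg_coefs g by apply: coin_remainder.
have pE : p = b *: ('X^x * (1 + 'X^h)) + g by rewrite /g addrC subrK.
have g1 : g.[1] = p.[1] - 2 * b.
  by rewrite /g !hornerE /= !expr1n; ring.
have g0 : 0 <= g.[1] by apply: horner1_ge0.
set s := Num.sqrt (b * n.+1%:R).
have s0 : 0 < s by rewrite sqrtr_gt0 mulr_gt0 // ltr0n.
have s2 : s ^+ 2 = b * n.+1%:R by rewrite sqr_sqrtr // mulr_ge0 // ltW.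
(* The arithmetic-geometric mean inequality replaces the square root of
   [2 / (m + 1)] by a term affine in [1 / (m + 1)], whose mean is known. *)
pose y m : R := s / m.+1%:R + (2 * s)^-1.
have y0 m : 0 <= y m by rewrite addr_ge0 ?divr_ge0 ?invr_ge0 ?mulr_ge0 // ltW.
have coefb m j : ('X^(x * m) * (1 + 'X^h) ^+ m : {poly R})`_j <= 2 ^+ m * y m.
  have B0 : 0 <= 2 ^+ m * y m by rewrite mulr_ge0 ?exprn_ge0.
  rewrite coefXnM coef_1DXh_exp //; case: ifP => // _; case: ifP => // _.
  rewrite -(@ler_pXn2r _ 2) ?nnegrE // exprMn.
  have m0 : 0 < m.+1%:R :> R by rewrite ltr0n.
  have y2 : 2 / m.+1%:R <= y m ^+ 2.
    have -> : 2 / m.+1%:R = 4 * (s / m.+1%:R * (2 * s)^-1) by field; rewrite !lt0r_neq0 // nat1r.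
    by rewrite /y; move: (s / m.+1%:R) ((2 * s)^-1) => u v; have := sqr_ge0 (u - v); rewrite !expr2; lra.
  apply: le_trans (ler_wpM2l _ y2); last by rewrite exprn_ge0 ?exprn_ge0.
  rewrite mulrA ler_pdivlMr //.
  have := bin_upper m ((j - x * m) %/ h); rewrite -(ler_nat R) !natrM !natrX.
  have -> : (2 ^+ m) ^+ 2 = 4 ^+ m :> R.
    by rewrite -exprM mulnC exprM; congr (_ ^+ _); ring.
  by rewrite [leRHS]mulrC.
rewrite (coin_expansion n N pE) -/g.
apply: le_trans (_ : \sum_(m < n.+1)
    'C(n, m)%:R * (2 * b) ^+ m * g.[1] ^+ (n - m) * y m <= _).
  apply: ler_sum => m _.
  have B0 : 0 <= 2 ^+ m * y m by rewrite mulr_ge0 ?exprn_ge0.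
  have := coef_mul_le N (nneg_coefsX (n - m) hg) (coefb m) B0.
  rewrite horner_exp => le_coef.
  have C0 : 0 <= 'C(n, m)%:R * b ^+ m by rewrite mulr_ge0 ?exprn_ge0 // ltW.
  apply: le_trans (ler_wpM2l C0 le_coef) _.
  by rewrite le_eqVlt; apply/orP; left; apply/eqP; rewrite exprMn; ring.
have sum1 := @binomial_inverse_moment (2 * b) g.[1] n.
have sum2 := binomial_mass (2 * b) g.[1] n.
have b2' : 0 < 2 * b by rewrite mulr_gt0.
have uv : 2 * b + g.[1] <= 1 by rewrite g1; lra.
have {}sum1 := sum1 b2' g0 uv.
under eq_bigr do rewrite /y mulrDr mulrCA.
rewrite big_split /= -mulr_sumr -mulr_suml sum2.
have mass1 : (2 * b + g.[1]) ^+ n <= 1 by rewrite exprn_ile1 // addr_ge0 // ltW.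
apply: le_trans (lerD (ler_wpM2l (ltW s0) sum1) (ler_wpM2r _ mass1)) _.
  by rewrite invr_ge0 mulr_ge0 // ltW.
rewrite le_eqVlt; apply/orP; left; apply/eqP.
rewrite (_ : n.+1%:R * (2 * b) = 2 * s ^+ 2); last by rewrite s2; ring.
by field; rewrite lt0r_neq0.
Qed.

End NonnegCoefs.

(** * Moments of generating polynomials *)

Section Moments.
Variable R : realType.
Implicit Types (p q : {poly R}) (u v : R).

(** For a polynomial whose coefficients are a law, these are the moments about
    [u]; a defective law is not normalised. *)
Definition moment1 p u : R := p^`().[1] - u * p.[1].

Definition moment2 p u : R :=
  p^`()^`().[1] + p^`().[1] - 2 * u * p^`().[1] + u ^+ 2 * p.[1].

Lemma moment1M p q u v :
  moment1 (p * q) (u + v) = moment1 p u * q.[1] + p.[1] * moment1 q v.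
Proof. rewrite /moment1 derivM !(hornerD, hornerM); ring. Qed.

Lemma moment2M p q u v :
  moment2 (p * q) (u + v) =
  moment2 p u * q.[1] + 2 * moment1 p u * moment1 q v + p.[1] * moment2 q v.
Proof. by rewrite /moment1 /moment2 !(derivM, derivD) !(hornerD, hornerM); ring. Qed.

Lemma moment2D p q u : moment2 (p + q) u = moment2 p u + moment2 q u.
Proof. by rewrite /moment2 !derivD !hornerD; ring. Qed.

Lemma moment1D p q u : moment1 (p + q) u = moment1 p u + moment1 q u.
Proof. by rewrite /moment1 !derivD !hornerD; ring. Qed.

Lemma moment1Z p u v : moment1 (v *: p) u = v * moment1 p u.
Proof. by rewrite /moment1 !derivZ !hornerZ; ring. Qed.

Lemma moment2Z p u v : moment2 (v *: p) u = v * moment2 p u.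
Proof. by rewrite /moment2 !derivZ !hornerZ; ring. Qed.

Lemma moment2_sum (I : Type) (s : seq I) (F : I -> {poly R}) u :
  moment2 (\sum_(i <- s) F i) u = \sum_(i <- s) moment2 (F i) u.
Proof.
elim: s => [|i s IH]; last by rewrite !big_cons moment2D IH.
by rewrite !big_nil /moment2 !deriv0 !horner0; ring.
Qed.

Lemma moment1_sum (I : Type) (s : seq I) (F : I -> {poly R}) u :
  moment1 (\sum_(i <- s) F i) u = \sum_(i <- s) moment1 (F i) u.
Proof.
elim: s => [|i s IH]; last by rewrite !big_cons moment1D IH.
by rewrite !big_nil /moment1 !deriv0 !horner0; ring.
Qed.

Lemma moment1Xn n u : moment1 'X^n u = n%:R - u.
Proof. by rewrite /moment1 derivXn !(hornerMn, hornerXn) !expr1n; ring. Qed.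

Lemma moment2Xn n u : moment2 'X^n u = (n%:R - u) ^+ 2.
Proof.
rewrite /moment2 derivXn derivMn derivXn !(hornerMn, hornerXn) !expr1n.
by case: n => [|n] /=; rewrite -?natr1; ring.
Qed.

Lemma moment2E p n u : (size p <= n)%N ->
  moment2 p u = \sum_(i < n) p`_i * (i%:R - u) ^+ 2.
Proof.
move=> pn; have -> : p = \sum_(i < n) p`_i *: 'X^i.
  rewrite -poly_def; apply/polyP => i; rewrite coef_poly.
  by case: ltnP => // ni; rewrite nth_default //; apply: leq_trans pn ni.
rewrite moment2_sum -poly_def; apply: eq_bigr => i _.
by rewrite moment2Z moment2Xn coef_poly ltn_ord.
Qed.

Lemma moment2_ge0 p u : nneg_coefs p -> 0 <= moment2 p u.
Proof.
move=> hp; rewrite (moment2E _ (leqnn _)); apply: sumr_ge0 => i _.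
by rewrite mulr_ge0 ?sqr_ge0.
Qed.

Lemma moment2_MXn p n u : moment2 ('X^n * p) u = moment2 p (u - n%:R).
Proof.
rewrite -[in LHS](subrKC n%:R u) moment2M moment2Xn moment1Xn !hornerE expr1n.
by ring.
Qed.

(** The mass may be defective, which only decreases the contribution of each
    step. *)
Lemma moment1_exp p u n : nneg_coefs p -> p.[1] <= 1 ->
  `|moment1 (p ^+ n) (n%:R * u)| <= n%:R * `|moment1 p u|.
Proof.
move=> hp p1; have p0 := horner1_ge0 hp.
elim: n => [|n IH].
  by rewrite /moment1 expr0 -polyC1 derivC horner0 hornerC !mul0r subr0 normr0.
rewrite exprS (_ : n.+1%:R * u = u + n%:R * u); last by rewrite -nat1r; ring.
rewrite moment1M -nat1r [leRHS]mulrDl mul1r.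
apply: le_trans (ler_normD _ _) _; apply: lerD.
  rewrite normrM -[leRHS]mulr1; apply: ler_wpM2l => //.
  by rewrite horner_exp ger0_norm ?exprn_ge0 // exprn_ile1.
rewrite normrM (ger0_norm p0); apply: le_trans IH; rewrite -[leRHS]mul1r.
exact: ler_wpM2r.
Qed.

(** Variances add; the means, which the cut-off keeps from vanishing, enter
    through their products. *)
Lemma moment2_exp p u n : nneg_coefs p -> p.[1] <= 1 ->
  moment2 (p ^+ n) (n%:R * u) <= n%:R * moment2 p u + n%:R ^+ 2 * moment1 p u ^+ 2.
Proof.
move=> hp p1; have p0 := horner1_ge0 hp.
elim: n => [|n IH].
  by rewrite /moment2 expr0 -polyC1 derivC deriv0 horner0 hornerC !mul0r; lra.
rewrite exprS (_ : n.+1%:R * u = u + n%:R * u); last by rewrite -nat1r; ring.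
rewrite moment2M -nat1r horner_exp.
have pn : p.[1] ^+ n <= 1 by rewrite exprn_ile1.
have pn0 : 0 <= p.[1] ^+ n by rewrite exprn_ge0.
have m0 := moment2_ge0 u hp.
have m0' := moment2_ge0 (n%:R * u) (nneg_coefsX n hp).
have := moment1_exp u n hp p1.
move: IH m0' m0 pn pn0; set X := moment2 p u; set Y := moment2 _ _.
set A := moment1 p u; set B := moment1 _ _; set t := _ ^+ n.
move=> IH Y0 X0 t1 t0 hB.
have h1 : X * t <= X by rewrite -[leRHS]mulr1 ler_wpM2l.
have h2 : p.[1] * Y <= Y by rewrite -[leRHS]mul1r ler_wpM2r.
have h3 : A * B <= n%:R * A ^+ 2.
  apply: le_trans (ler_norm _) _; rewrite normrM.
  apply: le_trans (ler_wpM2l (normr_ge0 A) hB) _.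
  by rewrite mulrCA -normrM -expr2 ger0_norm // sqr_ge0.
have := sqr_ge0 A; nra.
Qed.

End Moments.

(** * A lower local bound *)

Section CoinTosses.
Variable R : realType.
Implicit Types (p q g : {poly R}).

Definition residue_support r d p := forall j, p`_j != 0 -> j = r %[mod d].

Lemma residue_supportM r s d p q : residue_support r d p ->
  residue_support s d q -> residue_support (r + s) d (p * q).
Proof.
move=> hp hq j; rewrite coefM => h.
have [i /andP[pi qi]] : exists i : 'I_j.+1, (p`_i != 0) && (q`_(j - i) != 0).
  apply/existsP; apply: contraNT h => /existsPn h; apply/eqP/big1 => i _.
  by have := h i; rewrite negb_and !negbK => /orP[]/eqP->; rewrite ?mul0r ?mulr0.
have -> : j = (i + (j - i))%N by rewrite subnKC // -ltnS.
by rewrite -modnDm (hp _ pi) (hq _ qi) modnDm.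
Qed.

Lemma residue_supportX r d p n : residue_support r d p ->
  residue_support (n * r) d (p ^+ n).
Proof.
move=> hp; elim: n => [|n IH] j; first by rewrite expr0 coef1 mul0n; case: j => //= j; rewrite eqxx.
by rewrite exprS mulSn; apply: residue_supportM.
Qed.

Lemma coin_remainder_support p b x h : residue_support x h p ->
  residue_support x h (p - b *: ('X^x * (1 + 'X^h))).
Proof.
move=> hp j; have [pj|/hp-> //] := eqVneq p`_j 0.
have [->//|jx] := eqVneq j x.
have [->|jxh] := eqVneq j (x + h)%N; first by rewrite modnDr.
have : (p - b *: ('X^x * (1 + 'X^h)))`_j = 0.
  rewrite coefB coefZ mulrDr mulr1 coefD -exprD !coefXn pj.
  by rewrite (negPf jx) (negPf jxh) addr0 mulr0 subr0.
by move=> ->; rewrite eqxx.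
Qed.

(** Conditioning on everything but the coin tosses leaves a binomial law whose
    centre is within a few standard deviations of the target, so the sum hits
    the target with the probability that a binomial law gives to its window. *)
Lemma coin_local_lower (b K : R) : 0 < b -> 0 < K -> exists (c : R) k0, 0 < c /\
  forall g x h m k N A, (k0 <= k)%N -> (0 < h)%N -> (m <= k)%N ->
    residue_support x (2 * h) g -> N = k * x %[mod 2 * h] ->
    (g ^+ (k - m))`_A != 0 -> b * k.+1%:R < 4 * m.+1%:R ->
    ((x * m + h * m + A)%:R - N%:R) ^+ 2 <= K * k%:R ->
    (A <= N)%N /\
    2 ^+ m * (c / Num.sqrt k%:R) <= ('X^(x * m) * (1 + 'X^(2 * h)) ^+ m : {poly R})`_(N - A).
Proof.
move=> b0 K0; have K3 : 0 < 4 * K / b by rewrite divr_gt0 // mulr_gt0.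
have [c [m0 [c0 window]]] := bin_window_lower K3.
(* Beyond the first threshold the number of tosses is at least [b k / 8];
   beyond the others it dominates the deviation and exceeds [m0]. *)
set t : R := 8 / b + 64 * K / b ^+ 2 + 8 * m0%:R / b.
exists (c / 2), (Num.truncn t).+1; split; first by rewrite divr_gt0.
move=> g x h m k N A kk0 h0 mk hg hN gA mbig near.
have t0 : 0 <= t.
  by rewrite !addr_ge0 ?divr_ge0 ?mulr_ge0 ?exprn_ge0 // ltW.
have kt : t <= k%:R.
  apply: le_trans (ltW (Num.Theory.truncnS_gt t)) _.
  by rewrite ler_nat.
have : [/\ 8 / b <= t, 64 * K / b ^+ 2 <= t & 8 * m0%:R / b <= t].
  have e1 : 0 <= 8 / b by rewrite divr_ge0 // ltW.
  have e2 : 0 <= 64 * K / b ^+ 2 by rewrite divr_ge0 ?mulr_ge0 ?exprn_ge0 // ltW.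
  have e3 : 0 <= 8 * m0%:R / b by rewrite divr_ge0 ?mulr_ge0 // ltW.
  rewrite /t; move: (8 / b) (64 * K / b ^+ 2) (8 * m0%:R / b) e1 e2 e3.
  by move=> u v w u0 v0 w0; split; lra.
move=> [/le_trans/(_ kt) + /le_trans/(_ kt) + /le_trans/(_ kt)].
rewrite !ler_pdivrMr ?exprn_gt0 // ![k%:R * _]mulrC => k1 k2 k3.
have kpos : (0 < k)%N by apply: leq_trans kk0.
have k0 : 0 < k%:R :> R by rewrite ltr0n.
clear t t0 kk0 kt.
have m8 : b * k%:R <= 8 * m%:R.
  by move: mbig; rewrite -!natr1; lra.
have mm0 : (m0 <= m)%N by rewrite -(ler_nat R); lra.
have m2 : K * k%:R <= m%:R ^+ 2.
  have : (b * k%:R) ^+ 2 <= (8 * m%:R) ^+ 2.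
    by rewrite lerXn2r ?nnegrE ?mulr_ge0 // ltW.
  have : 64 * K * k%:R <= b ^+ 2 * k%:R * k%:R by rewrite ler_wpM2r // ltW.
  by rewrite !exprMn !expr2; lra.
have h1 : 1 <= h%:R :> R by rewrite ler1n.
have AN : (x * m + A <= N)%N.
  rewrite leqNgt; apply/negP => lt.
  have : m%:R ^+ 2 < ((x * m + h * m + A)%:R - N%:R) ^+ 2 :> R.
    rewrite ltrXn2r // ltrBrDr -natrD ltr_nat.
    by have := leq_pmull m h0; clear -lt; lia.
  by move=> /lt_le_trans/(_ near)/lt_le_trans/(_ m2); rewrite ltxx.
split; first by clear -AN; lia.
have hA := residue_supportX hg gA.
have : (2 * h %| N - (x * m + A))%N.
  rewrite -eqn_mod_dvd // eq_sym; apply/eqP; rewrite hN.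
  by rewrite -modnDmr hA modnDmr; congr (_ %% _)%N; clear -mk; nia.
move=> /dvdnP[B hB].
have NE : N = (x * m + A + B * (2 * h))%N by rewrite -hB subnKC.
have uE : (x * m + h * m + A)%:R - N%:R = h%:R * (m%:R - 2 * B%:R) :> R.
  by rewrite NE !natrD !natrM; ring.
have near2 : (m%:R - 2 * B%:R) ^+ 2 <= K * k%:R :> R.
  apply: le_trans near; rewrite uE exprMn -[leLHS]mul1r ler_wpM2r ?sqr_ge0 //.
  by rewrite exprn_ege1.
rewrite coefXnM ifF; last by apply/negbTE; clear -AN; lia.
rewrite coef_1DXh_exp ?muln_gt0 //.
rewrite (_ : (N - A - x * m = B * (2 * h))%N); last by clear -NE; lia.
rewrite dvdn_mull // mulnK ?muln_gt0 //.
have near3 : (m%:R - 2 * B%:R) ^+ 2 <= 4 * K / b * m.+1%:R :> R.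
  apply: le_trans near2 _.
  rewrite mulrAC ler_pdivlMr // -mulrA [4 * K]mulrC -mulrA ler_wpM2l ?(ltW K0) //.
  by move: mbig; rewrite -!natr1; lra.
apply: le_trans (window _ _ mm0 near3).
rewrite mulrCA -!mulrA ler_wpM2l ?(ltW c0) // mulrCA ler_wpM2l ?exprn_ge0 //.
have s0 : 0 < Num.sqrt k%:R :> R by rewrite sqrtr_gt0.
have s1 : 0 < Num.sqrt m.+1%:R :> R by rewrite sqrtr_gt0 ltr0n.
rewrite -invfM lef_pV2 ?posrE ?mulr_gt0 //.
rewrite -[leRHS]ger0_norm ?mulr_ge0 ?(ltW s0) // -sqrtr_sqr ler_wsqrtr //.
rewrite exprMn sqr_sqrtr ?(ltW k0) //.
have : m%:R <= k%:R :> R by rewrite ler_nat.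
have : 1 <= k%:R :> R by rewrite ler1n.
by rewrite -natr1 expr2; lra.
Qed.

End CoinTosses.

Section CentralLowerBound.
Variable R : realType.
Implicit Types (p q g : {poly R}).

(** Replacing each coin by its mean keeps the first moment of a step and
    decreases the second. *)
Lemma coin_mean_moments p b x h u : 0 <= b ->
  let q := (2 * b) *: 'X^(x + h) + (p - b *: ('X^x * (1 + 'X^(2 * h)))) in
  moment1 q u = moment1 p u /\ moment2 q u <= moment2 p u.
Proof.
move=> b0 q; rewrite /q -scaleN1r scalerA mulN1r mulrDr mulr1 -exprD scalerDr.
rewrite !(moment1D, moment1Z, moment2D, moment2Z, moment1Xn, moment2Xn) !(natrM, natrD).
split; first by ring.
rewrite -subr_ge0; set D := (_ - _).
have -> : D = b * (2 * h%:R ^+ 2) by rewrite /D; ring.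
by rewrite mulr_ge0 // mulr_ge0 // sqr_ge0.
Qed.

Lemma moment2_coin_expansion (b : R) r g k u n :
  (forall m, (m <= k)%N -> (size (g ^+ (k - m)) <= n)%N) ->
  moment2 (((2 * b) *: 'X^r + g) ^+ k) u =
  \sum_(m < k.+1) \sum_(A < n) 'C(k, m)%:R * (2 * b) ^+ m * (g ^+ (k - m))`_A *
    ((r * m + A)%:R - u) ^+ 2.
Proof.
move=> hn; rewrite addrC exprDn moment2_sum; apply: eq_bigr => m _.
rewrite -scaler_nat moment2Z exprZn -exprM -scalerAr moment2Z [_ * 'X^_]mulrC moment2_MXn.
rewrite (@moment2E _ _ n) ?hn -1?ltnS // mulrA mulr_sumr; apply: eq_bigr => A _.
by rewrite natrD; ring.
Qed.

(** With probability at least [3 / 8] there are many tosses and the rest of the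
    sum is near its mean, so that [coin_local_lower] applies. The residue of the
    target is an obstruction of the kind of parity. *)
Lemma coef_exp_ge (b V : R) : 0 < b -> 0 <= V -> exists (c : R) k0, 0 < c /\
  forall p x h u k N, (k0 <= k)%N -> (0 < h)%N ->
    nneg_coefs p -> p.[1] <= 1 -> 3 / 4 <= p.[1] ^+ k ->
    b <= p`_x -> b <= p`_(x + 2 * h) -> residue_support x (2 * h) p ->
    k%:R * moment1 p u ^+ 2 <= V -> moment2 p u <= V ->
    (N%:R - k%:R * u) ^+ 2 <= k%:R -> N = k * x %[mod 2 * h] ->
    c / Num.sqrt k%:R <= (p ^+ k)`_N.
Proof.
(* Chebyshev: the far part then has mass at most [(4 V + 2) / K = 1 / 4]. *)
move=> b0 V0; set K : R := 16 * V + 8.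
have K0 : 0 < K by rewrite /K; lra.
have [c [k0 [c0 local]]] := coin_local_lower b0 K0.
exists (c * (3 / 8)), k0.+1; split; first by rewrite mulr_gt0 // divr_gt0.
move=> p x h u k N kk0 h0 hp p1 pk b1 b2 hx hm1 hm2 hN hNx.
set g := p - b *: ('X^x * (1 + 'X^(2 * h))).
have h20 : (0 < 2 * h)%N by rewrite muln_gt0.
have hg : nneg_coefs g by apply: coin_remainder.
have gx : residue_support x (2 * h) g by apply: coin_remainder_support.
have pE : p = b *: ('X^x * (1 + 'X^(2 * h))) + g by rewrite /g addrC subrK.
have g1 : 2 * b + g.[1] = p.[1].
  by rewrite pE !(hornerD, hornerZ, hornerM, hornerXn, hornerC) !expr1n; ring.
have g0 : 0 <= g.[1] by apply: horner1_ge0.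
have kpos : 0 < k%:R :> R by rewrite ltr0n (leq_trans _ kk0).
pose n := (N.+1 + \max_(m < k.+1) size (g ^+ (k - m)))%N.
have hn m : (m <= k)%N -> (size (g ^+ (k - m)) <= n)%N.
  rewrite -ltnS => mk; rewrite /n; apply: leq_trans (leq_addl _ _).
  exact: (leq_bigmax (Ordinal mk)).
(* The mass of [m] tosses and of the value [A] for the sum of the other steps. *)
pose w m A : R := 'C(k, m)%:R * (2 * b) ^+ m * (g ^+ (k - m))`_A.
have w0 m A : 0 <= w m A.
  rewrite /w mulr_ge0 ?mulr_ge0 ?exprn_ge0 ?mulr_ge0 ?(ltW b0) //.
  exact: (nneg_coefsX (k - m) hg).
pose dev m A : R := ((x * m + h * m + A)%:R - N%:R) ^+ 2.
pose good m A := (b * k.+1%:R < 4 * m.+1%:R) && (dev m A <= K * k%:R).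
have sumA m : (m <= k)%N ->
    \sum_(A < n) w m A = 'C(k, m)%:R * (2 * b) ^+ m * g.[1] ^+ (k - m).
  by move=> mk; rewrite -mulr_sumr -horner1_sum ?hn // horner_exp.
have total : \sum_(m < k.+1) \sum_(A < n) w m A = p.[1] ^+ k.
  rewrite -g1 -binomial_mass; apply: eq_bigr => m _; apply: sumA.
  by rewrite -ltnS.
(* Markov, applied to the inverse of the number of tosses. *)
have few_coins : \sum_(m < k.+1) \sum_(A < n) w m A * (b * k.+1%:R / (4 * m.+1%:R)) <= 1 / 8.
  have uv : 2 * b + g.[1] <= 1 by rewrite g1.
  have b20 : 0 < 2 * b by rewrite mulr_gt0.
  have := binomial_inverse_moment k b20 g0 uv.
  set T := \sum_(_ < _) _ => hT.
  have -> : \sum_(m < k.+1) \sum_(A < n) w m A * (b * k.+1%:R / (4 * m.+1%:R)) =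
      b * k.+1%:R / 4 * T.
    rewrite mulr_sumr; apply: eq_bigr => m _.
    rewrite -mulr_suml sumA -1?ltnS // invfM; ring.
  have bk : 0 < b * k.+1%:R / 4 by rewrite divr_gt0 // mulr_gt0 // ltr0n.
  apply: le_trans (ler_wpM2l (ltW bk) hT) _.
  rewrite le_eqVlt; apply/orP; left; apply/eqP; field.
  by rewrite lt0r_neq0 //= nat1r pnatr_eq0.
(* Chebyshev, with every toss replaced by its mean. *)
have far : \sum_(m < k.+1) \sum_(A < n) w m A * (dev m A / (K * k%:R)) <= 1 / 4.
  set q := (2 * b) *: 'X^(x + h) + g.
  have [q1 q2] := coin_mean_moments p x h u (ltW b0).
  have hq : nneg_coefs q.
    by apply: nneg_coefsD => //; apply: nneg_coefsZ _ (nneg_coefs_Xn _ _); rewrite mulr_ge0 // ltW.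
  have q_1 : q.[1] <= 1.
    by rewrite /q hornerD hornerZ hornerXn expr1n mulr1 g1.
  have := moment2_exp u k hq q_1.
  rewrite (moment2_coin_expansion b (x + h) (k%:R * u) hn).
  set T := \sum_(_ < _) _ => hT.
  have {}hT : T <= 2 * V * k%:R.
    apply: le_trans hT _; rewrite q1.
    rewrite (_ : k%:R * _ + _ = (moment2 q u + k%:R * moment1 p u ^+ 2) * k%:R); last by ring.
    rewrite ler_pM2r //; apply: le_trans (lerD (le_trans q2 hm2) hm1) _; lra.
  have sq m A : dev m A <= 2 * (((x + h) * m + A)%:R - k%:R * u) ^+ 2 + 2 * k%:R.
    have -> : dev m A = ((((x + h) * m + A)%:R - k%:R * u) - (N%:R - k%:R * u)) ^+ 2.
      by rewrite /dev mulnDl; ring.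
    move: hN; move: (_ - _) (N%:R - _) => s t ts.
    by have := sqr_ge0 (s + t); nra.
  apply: le_trans (_ : \sum_(m < k.+1) \sum_(A < n)
      (w m A * (((x + h) * m + A)%:R - k%:R * u) ^+ 2 * (2 / (K * k%:R)) + w m A * (2 / K)) <= _).
    apply: ler_sum => m _; apply: ler_sum => A _.
    rewrite -[X in _ <= X + _]mulrA -mulrDr ler_wpM2l //.
    rewrite ler_pdivrMr ?mulr_gt0 // mulrDl -[X in _ <= X + _]mulrA divfK ?gt_eqF ?mulr_gt0 //.
    rewrite (_ : 2 / K * (K * k%:R) = 2 * k%:R); last by rewrite mulrA divfK // gt_eqF.
    by rewrite mulrC.
  under eq_bigr do rewrite big_split /= -!mulr_suml.
  rewrite big_split /= -!mulr_suml total -/T.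
  apply: le_trans (lerD (ler_wpM2r _ hT) (ler_wpM2r _ (_ : _ <= 1))) _.
  - by rewrite divr_ge0 // mulr_ge0 // ltW.
  - by rewrite divr_ge0 // ltW.
  - by rewrite exprn_ile1 // horner1_ge0.
  rewrite (_ : 2 * V * k%:R * (2 / (K * k%:R)) = 4 * V / K); last first.
    by field; rewrite !gt_eqF.
  have -> : 1 * (2 / K) = 2 / K by rewrite mul1r.
  rewrite -(mulrDl (4 * V) 2 K^-1) ler_pdivrMr // /K; lra.
have good_mass : 3 / 8 <= \sum_(m < k.+1) \sum_(A < n) w m A * (good m A)%:R.
  apply: le_trans (_ : \sum_(m < k.+1) \sum_(A < n) (w m A -
      w m A * (b * k.+1%:R / (4 * m.+1%:R)) - w m A * (dev m A / (K * k%:R))) <= _); last first.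
    apply: ler_sum => m _; apply: ler_sum => A _.
    set X := b * _ / _; set Y := dev m A / _.
    have -> : w m A - w m A * X - w m A * Y = w m A * (1 - X - Y) by ring.
    rewrite ler_wpM2l //.
    have m10 : 0 < 4 * m.+1%:R :> R by rewrite mulr_gt0 // ltr0n.
    have t1 : 0 <= X by rewrite divr_ge0 ?mulr_ge0 // ltW.
    have t2 : 0 <= Y by rewrite divr_ge0 ?sqr_ge0 ?mulr_ge0 // ltW.
    rewrite /good; case: (ltP (b * k.+1%:R)) => /= [_|hm].
      case: (leP (dev m A)) => /= [_|hd]; first by lra.
      have : 1 <= Y by rewrite /Y ler_pdivlMr ?mulr_gt0 // mul1r ltW.
      by lra.
    have : 1 <= X by rewrite /X ler_pdivlMr // mul1r.
    by lra.
  under eq_bigr do rewrite !sumrB.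
  rewrite !sumrB total; lra.
rewrite (coin_expansion k N pE) -/g mulrAC.
have c_s : 0 <= c / Num.sqrt k%:R by rewrite divr_ge0 ?sqrtr_ge0 // ltW.
apply: le_trans (ler_wpM2l c_s good_mass) _.
rewrite mulr_sumr; apply: ler_sum => m _.
have mk : (m <= k)%N by rewrite -ltnS.
have hgk := nneg_coefsX (k - m) hg.
have hXk : nneg_coefs ('X^(x * m) * (1 + 'X^(2 * h)) ^+ m : {poly R}).
  apply: nneg_coefsM; first exact: nneg_coefs_Xn.
  apply: nneg_coefsX; apply: nneg_coefsD; last exact: nneg_coefs_Xn.
  by move=> i; rewrite coef1.
rewrite coefMr !mulr_sumr.
rewrite (bigID (fun A : 'I_n => (A < N.+1)%N)) /= [X in _ + X]big1 ?addr0; last first.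
  move=> A; rewrite -leqNgt => NA; rewrite /w.
  have [gA|gA] := eqVneq ((g ^+ (k - m))`_A) 0; first by rewrite gA !(mulr0, mul0r).
  case: (boolP (good m A)) => [/andP[gd1 gd2]|_]; last by rewrite !mulr0.
  have [AN _] := local g x h m k N A (ltnW kk0) h0 mk gx hNx gA gd1 gd2.
  by move: NA; rewrite ltnNge AN.
have Nn : (N.+1 <= n)%N by rewrite leq_addr.
rewrite -(big_ord_widen n (fun A => c / Num.sqrt k%:R * (w m A * (good m A)%:R)) Nn).
apply: ler_sum => A _.
have rhs0 : 0 <= 'C(k, m)%:R * b ^+ m *
    (('X^(x * m) * (1 + 'X^(2 * h)) ^+ m)`_(N - A) * (g ^+ (k - m))`_A).
  by rewrite mulr_ge0 ?mulr_ge0 ?exprn_ge0 // ltW.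
case: (boolP (good m A)) => [/andP[gd1 gd2]|_]; last by rewrite !mulr0.
have [gA|gA] := eqVneq ((g ^+ (k - m))`_A) 0; first by rewrite /w gA !(mulr0, mul0r).
have [_ loc] := local g x h m k N A (ltnW kk0) h0 mk gx hNx gA gd1 gd2.
rewrite mulr1 /w exprMn.
have C0 : 0 <= 'C(k, m)%:R * b ^+ m by rewrite mulr_ge0 ?exprn_ge0 // ltW.
have := ler_wpM2l C0 (ler_wpM2r (hgk A) loc).
apply: le_trans; rewrite le_eqVlt; apply/orP; left; apply/eqP; ring.
Qed.

End CentralLowerBound.

(** * Centered laws on the integers *)

Section IntegerLaw.
Variable R : realType.
Implicit Types (f : int -> R) (M k n N L h : nat) (x y z s d : int).

Definition centered M (i : nat) : int := i%:Z - M%:Z.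

(** The generating polynomial of a law on the integers cut off to [[-M, M]],
    shifted by [M]. The exponents are doubled so that the midpoint between two
    of them is an exponent. *)
Definition trunc_poly f M : {poly R} :=
  \sum_(i < (2 * M).+1) f (centered M i) *: 'X^(2 * i).

(** What the local bounds use of a nondegenerate law of mean zero and variance
    at most [v], in terms of sums over boxes only. *)
Record centered_law f (v : R) : Prop := {
  law_ge0 : forall x, 0 <= f x ;
  law_var_ge0 : 0 <= v ;
  law_mass_le1 : forall M, \sum_(i < (2 * M).+1) f (centered M i) <= 1 ;
  law_mass_ge : forall M, (0 < M)%N ->
    1 - v / M%:R <= \sum_(i < (2 * M).+1) f (centered M i) ;
  law_mean : forall M, (0 < M)%N ->
    `|\sum_(i < (2 * M).+1) f (centered M i) * (centered M i)%:~R| <= v / M%:R ;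
  law_var : forall M,
    \sum_(i < (2 * M).+1) f (centered M i) * (centered M i)%:~R ^+ 2 <= v ;
  law_atoms : exists x y, x != y /\ 0 < f x /\ 0 < f y }.

Lemma coef_trunc_poly f M z : `|z| <= M%:Z -> (trunc_poly f M)`_(2 * absz (z + M%:Z)%R) = f z.
Proof.
move=> zM; rewrite coef_sumMXn.
have iM : (absz (z + M%:Z)%R < (2 * M).+1)%N by lia.
rewrite (big_pred1 (Ordinal iM)) /=; last first.
  by move=> i; rewrite /= eqn_pmul2l // -val_eqE.
by congr f; rewrite /centered; lia.
Qed.

Lemma trunc_poly_support f M j : (trunc_poly f M)`_j != 0 ->
  exists z, [/\ `|z| <= M%:Z, f z != 0 & j = (2 * absz (z + M%:Z)%R)%N].
Proof.
rewrite coef_sumMXn => h.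
have [i /andP[ij fi]] : exists i : 'I_(2 * M).+1,
    (2 * i == j)%N && (f (centered M i) != 0).
  apply/existsP; apply: contraNT h => /existsPn h; apply/eqP/big1 => i ij.
  by move: ij (h i) => /= ->; rewrite negbK => /eqP.
have := ltn_ord i => iM; exists (centered M i); split => //; rewrite /centered; lia.
Qed.

Lemma nneg_trunc_poly f M : (forall x, 0 <= f x) -> nneg_coefs (trunc_poly f M).
Proof. by move=> f0 j; rewrite coef_sumMXn; apply: sumr_ge0. Qed.

Lemma horner1_trunc_poly f M :
  (trunc_poly f M).[1] = \sum_(i < (2 * M).+1) f (centered M i).
Proof.
rewrite horner_sum; apply: eq_bigr => i _.
by rewrite hornerZ hornerXn expr1n mulr1.
Qed.

Lemma centeredR M i : (2 * i)%:R - (2 * M)%:R = 2 * (centered M i)%:~R :> R.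
Proof. by rewrite /centered intrB !natrM -!pmulrn; ring. Qed.

Lemma moment1_trunc_poly f M : moment1 (trunc_poly f M) (2 * M)%:R =
  2 * \sum_(i < (2 * M).+1) f (centered M i) * (centered M i)%:~R.
Proof.
rewrite moment1_sum mulr_sumr; apply: eq_bigr => i _.
by rewrite moment1Z moment1Xn centeredR mulrCA.
Qed.

Lemma moment2_trunc_poly f M : moment2 (trunc_poly f M) (2 * M)%:R =
  4 * \sum_(i < (2 * M).+1) f (centered M i) * (centered M i)%:~R ^+ 2.
Proof.
rewrite moment2_sum mulr_sumr; apply: eq_bigr => i _.
by rewrite moment2Z moment2Xn centeredR; ring.
Qed.

(** Two atoms make a coin toss, so [coef_exp_le] applies; its constant does not
    see the cut-off. *)
Lemma trunc_poly_exp_le f v : centered_law f v -> exists (C : R) M0, 0 < C /\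
  forall M n N, (M0 <= M)%N -> (trunc_poly f M ^+ n)`_N <= C / Num.sqrt n.+1%:R.
Proof.
move=> [f0 _ f1 _ _ _ [x [y [xy [fx fy]]]]].
wlog xy' : x y xy fx fy / x < y.
  by move=> wl; move: (xy); rewrite neq_lt => /orP[/wl|/wl]; apply; rewrite // eq_sym.
pose b := Num.min (f x) (f y).
have b0 : 0 < b by rewrite lt_min fx fy.
exists (Num.sqrt b)^-1, (absz x + absz y)%N; split; first by rewrite invr_gt0 sqrtr_gt0.
move=> M n N hM.
rewrite -invfM -sqrtrM ?(ltW b0) //.
apply: (@coef_exp_le _ _ b (2 * absz (x + M%:Z)%R) (2 * absz (y - x)%R)) => //.
- exact: nneg_trunc_poly.
- by rewrite horner1_trunc_poly.
- by clear -xy'; lia.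
- by rewrite coef_trunc_poly ?ge_min ?lexx //; clear -hM; lia.
rewrite (_ : (2 * absz (x + M%:Z)%R + 2 * absz (y - x)%R = 2 * absz (y + M%:Z)%R)%N); last first.
  by clear -hM xy'; lia.
by rewrite coef_trunc_poly ?ge_min ?lexx ?orbT //; clear -hM; lia.
Qed.

(** Words over the support: differences of sums of equally long words form a
    group, whose generator is the span of the walk. *)
Definition word_diff f d := exists s t : seq int, [/\ size s = size t,
  all (fun z => 0 < f z) s, all (fun z => 0 < f z) t &
  d = \sum_(z <- s) z - \sum_(z <- t) z].

Lemma word_diff0 f : word_diff f 0.
Proof. by exists [::], [::]; rewrite big_nil subr0. Qed.

Lemma word_diffD f d e : word_diff f d -> word_diff f e -> word_diff f (d + e).
Proof.
move=> [s [t [st hs ht ->]]] [s' [t' [st' hs' ht' ->]]].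
exists (s ++ s'), (t ++ t'); rewrite !size_cat !all_cat st st' hs hs' ht ht'.
by split=> //; rewrite !big_cat /=; ring.
Qed.

Lemma word_diffN f d : word_diff f d -> word_diff f (- d).
Proof. by move=> [s [t [st hs ht ->]]]; exists t, s; split=> //; rewrite opprB. Qed.

Lemma word_diffMn f d n : word_diff f d -> word_diff f (d *+ n).
Proof.
move=> hd; elim: n => [|n IH]; first exact: word_diff0.
by rewrite mulrS; apply: word_diffD.
Qed.

Lemma word_diffMz f d e : word_diff f d -> word_diff f (e * d).
Proof.
move=> hd; case: e => n; first by rewrite mulrC -[Posz n]natz mulr_natr; apply: word_diffMn.
by rewrite NegzE mulNr -natz mulr_natl; apply/word_diffN/word_diffMn.
Qed.

(** The least positive difference divides all others, by Euclidean division. *)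
Lemma span_exists f x y : x < y -> 0 < f x -> 0 < f y -> exists h, [/\ (0 < h)%N,
  word_diff f h%:Z & forall d, word_diff f d -> (h%:Z %| d)%Z].
Proof.
move=> xy fx fy.
pose P n := (0 < n)%N && `[< word_diff f n%:Z >].
have exP : exists n, P n.
  exists (absz (y - x)%R); rewrite /P; apply/andP; split; first by clear -xy; lia.
  apply/asboolP; exists [:: y], [:: x]; rewrite /= fx fy !big_seq1; split=> //.
  by clear -xy; lia.
have [h /andP[h0 /asboolP hw] hmin] := ex_minnP exP.
exists h; split=> // d hd; rewrite dvdzE.
have hz : h%:Z != 0 by clear -h0; lia.
have modw : word_diff f (d %% h%:Z)%Z.
  rewrite (_ : (d %% h%:Z)%Z = d - (d %/ h%:Z)%Z * h%:Z); last first.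
    by rewrite {2}(divz_eq d h%:Z) addrAC subrr add0r.
  by apply: word_diffD => //; apply/word_diffN/word_diffMz.
rewrite -dvdzE; apply/dvdz_mod0P.
have m0 := modz_ge0 d hz; have mlt := ltz_pmod d (_ : 0 < h%:Z).
have {}mlt := mlt h0.
case: (posnP (absz (d %% h%:Z)%Z)) => [|mpos]; first by clear; lia.
have := hmin (absz (d %% h%:Z)%Z); rewrite /P mpos gez0_abs // => H.
have /H : true && `[< word_diff f (d %% h%:Z)%Z >] by apply/asboolP.
by clear -m0 mlt; lia.
Qed.

Lemma coefM_ge (p q : {poly R}) i j : nneg_coefs p -> nneg_coefs q ->
  p`_i * q`_j <= (p * q)`_(i + j).
Proof.
move=> hp hq; have ij : (i < (i + j).+1)%N by rewrite ltnS leq_addr.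
rewrite coefM (bigD1 (Ordinal ij)) //= addKn lerDl.
by apply: sumr_ge0 => l _; apply: mulr_ge0.
Qed.

Lemma word_coef_ge f M (s : seq int) : (forall x, 0 <= f x) ->
  all (fun z => `|z| <= M%:Z) s ->
  \prod_(z <- s) f z <= (trunc_poly f M ^+ size s)`_(\sum_(z <- s) 2 * absz (z + M%:Z)%R).
Proof.
move=> f0; elim: s => [_|z s IH /= /andP[zM sM]].
  by rewrite !big_nil expr0 coef1.
rewrite !big_cons exprS; apply: le_trans (coefM_ge _ _ _ _).
- by rewrite coef_trunc_poly // ler_wpM2l // IH.
- exact: nneg_trunc_poly.
- by apply: nneg_coefsX; apply: nneg_trunc_poly.
Qed.

Lemma word_codeE M (s : seq int) : all (fun z => `|z| <= M%:Z) s ->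
  (\sum_(z <- s) 2 * absz (z + M%:Z)%R)%N%:Z = 2 * (\sum_(z <- s) z + (size s)%:Z * M%:Z).
Proof.
elim: s => [_|z s IH /= /andP[zM sM]]; first by rewrite !big_nil mul0r.
by rewrite !big_cons PoszD IH //; move: (\sum_(z <- s) z) zM; clear; lia.
Qed.

Lemma bernoulli_ge (t : R) n : 0 <= t -> t <= 1 -> 1 - n%:R * t <= (1 - t) ^+ n.
Proof.
move=> t0 t1; elim: n => [|n IH]; first by rewrite mul0r subr0 expr0.
rewrite exprS; have h := ler_wpM2l (_ : 0 <= 1 - t) IH.
apply: le_trans (h _); last by lra.
rewrite -nat1r; have : 0 <= n%:R * t ^+ 2 by rewrite mulr_ge0 ?sqr_ge0.
by rewrite expr2; lra.
Qed.

Lemma trunc_poly_residue f M h z : 0 < f z -> (0 < h)%N ->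
  (forall x, 0 <= f x) -> (forall d, word_diff f d -> (h%:Z %| d)%Z) ->
  residue_support (2 * (M + absz (z %% h%:Z)%Z)) (2 * h) (trunc_poly f M).
Proof.
move=> fz h0 f0 hd j /trunc_poly_support[w [wM fw ->]].
rewrite -!muln_modr; congr (2 * _)%N.
have hz : h%:Z != 0 by clear -h0; lia.
have : (h%:Z %| w - z)%Z.
  apply: hd; exists [:: w], [:: z]; rewrite /= fz lt0r fw f0 !big_seq1; split=> //.
have := modz_ge0 z hz; have := divz_eq z h%:Z.
move: (z %% h%:Z)%Z (z %/ h%:Z)%Z => r q zE r0 /dvdzP[e we].
apply/eqP; rewrite -eqz_nat -!modz_nat eqz_mod_dvd; apply/dvdzP; exists (q + e).
by move: wM zE we r0; clear; lia.
Qed.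

End IntegerLaw.

Section IntegerLawLower.
Variable R : realType.
Implicit Types (f : int -> R) (M k n N L h : nat) (x y z s d : int).

Lemma size_word_abs (s : seq int) : exists M0, forall M, (M0 <= M)%N ->
  all (fun z => `|z| <= M%:Z) s.
Proof.
elim: s => [|z s [M0 IH]]; first by exists 0%N.
exists (maxn M0 (absz z)) => M; rewrite geq_max => /andP[h1 h2].
by rewrite /= IH // andbT; clear -h2; lia.
Qed.

(** Central lower bound for a centered law of finite variance: [L] steps form
    a block containing a coin toss of width [h]; such a block exists because
    [h] is the difference of the sums of two words of the same length. The
    support condition says which targets are reached, and it is the only
    obstruction. *)
Lemma trunc_poly_exp_ge f v : centered_law f v ->
  exists L h, exists c : R, [/\ (0 < L)%N /\ (h %| L)%N, (0 < h)%N, 0 < c,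
   (forall M k N, (trunc_poly f M ^+ (L * k))`_N != 0 -> (2 * h %| N)%N) &
   (forall s, (h%:Z %| s)%Z -> exists k0, forall k, (k0 <= k)%N ->
     exists M0, forall M N, (M0 <= M)%N -> N%:Z = 2 * ((L * k * M)%:Z + s) ->
       c / Num.sqrt k%:R <= (trunc_poly f M ^+ (L * k))`_N)].
Proof.
move=> [f0 v0 f1 fmass fmean fvar [x [y [xy [fx fy]]]]].
have [h [h0 [s [t [st hs ht hst]]] hdvd]] : exists h, [/\ (0 < h)%N,
    word_diff f h%:Z & forall d, word_diff f d -> (h%:Z %| d)%Z].
  by move: xy; rewrite neq_lt => /orP[xy|xy]; [apply: span_exists xy fx fy|apply: span_exists xy fy fx].
pose l := size t.
have l0 : (0 < l)%N.
  rewrite lt0n; apply/negP => /nilP t0; move: st hst; rewrite t0 => /eqP/nilP->.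
  by rewrite !big_nil; move: h0; clear; lia.
have prod_gt0 (w : seq int) : all (fun z => 0 < f z) w -> 0 < \prod_(z <- w) f z.
  elim: w => [|z w IH]; first by rewrite big_nil.
  by rewrite big_cons => /= /andP[z0 w0]; rewrite mulr_gt0 // IH.
pose b := Num.min (\prod_(z <- s) f z) (\prod_(z <- t) f z).
have b0 : 0 < b by rewrite lt_min !prod_gt0.
pose V : R := 4 * l%:R * v + 4 * l%:R ^+ 2 * v ^+ 2 + 1.
have V1 : 1 <= V.
  by rewrite /V lerDr addr_ge0 // !mulr_ge0 ?exprn_ge0.
have [c [k1 [c0 local]]] := coef_exp_ge b0 (le_trans ler01 V1).
have [Ms hMs] := size_word_abs s; have [Mt hMt] := size_word_abs t.
have residue M : residue_support (2 * (M + absz (x %% h%:Z)%Z)) (2 * h) (trunc_poly f M).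
  exact: trunc_poly_residue.
have lattice M n N : (h %| n)%N -> (trunc_poly f M ^+ n)`_N != 0 -> (2 * h %| N)%N.
  move=> /dvdnP[e ->] /(residue_supportX (residue M)).
  by rewrite /dvdn => ->; apply/eqP/eqP; rewrite -/(dvdn _ _) -mulnA dvdn_mull // mulnA [(h * 2)%N]mulnC dvdn_mulr.
exists (l * h)%N, h, (c / Num.sqrt h%:R); split.
- by rewrite muln_gt0 l0 dvdn_mull.
- by [].
- by rewrite divr_gt0 // sqrtr_gt0 ltr0n.
- by move=> M k N; apply: lattice; rewrite mulnAC dvdn_mull.
move=> z hz; exists (maxn k1 (4 * absz z ^ 2)) => k; rewrite geq_max => /andP[kk1 kz].
pose n := (k * h)%N.
have kn : (k <= n)%N by rewrite /n leq_pmulr.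
pose bound : R := v + 4 * (l * n)%:R * v + 4 * n%:R * l%:R ^+ 2 * v ^+ 2.
have bound0 : 0 <= bound by rewrite !addr_ge0 ?mulr_ge0 ?exprn_ge0 ?mulr_ge0.
exists (maxn (maxn Ms Mt) (Num.truncn bound).+1) => M N.
rewrite !geq_max => /andP[/andP[MMs MMt] MM] NE.
have M0 : (0 < M)%N by apply: leq_trans MM.
have MR : bound <= M%:R.
  by apply: le_trans (ltW (Num.Theory.truncnS_gt bound)) _; rewrite ler_nat.
have [Mv Mlnv Mmean] : [/\ v <= M%:R, 4 * (l * n)%:R * v <= M%:R &
    4 * n%:R * l%:R ^+ 2 * v ^+ 2 <= M%:R].
  have e1 : 0 <= 4 * (l * n)%:R * v by rewrite !mulr_ge0.
  have e2 : 0 <= 4 * n%:R * l%:R ^+ 2 * v ^+ 2 by rewrite !mulr_ge0 ?exprn_ge0.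
  move: MR; rewrite /bound; move: (_ * v) (_ * v ^+ 2) e1 e2 => e1 e2 e10 e20 MR.
  by split; lra.
have M1 : 1 <= M%:R :> R by rewrite ler1n.
have Mpos : 0 < M%:R :> R by rewrite ltr0n.
pose p := trunc_poly f M ^+ l.
have ftr := nneg_trunc_poly M f0.
have hp : nneg_coefs p by apply: nneg_coefsX.
have T1 : (trunc_poly f M).[1] <= 1 by rewrite horner1_trunc_poly.
have T0 := horner1_ge0 ftr.
have p1 : p.[1] <= 1 by rewrite horner_exp exprn_ile1.
rewrite (_ : trunc_poly f M ^+ (l * h * k) = p ^+ n); last first.
  by rewrite -exprM /n mulnA mulnAC.
pose code w := (\sum_(z <- w) 2 * absz (z + M%:Z)%R)%N.
have codes : code s = (code t + 2 * h)%N.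
  apply/eqP; rewrite -eqz_nat PoszD /code !word_codeE ?hMs ?hMt // st.
  by move: hst; move: (\sum_(z <- s) z) (\sum_(z <- t) z); clear; lia.
have bt : b <= p`_(code t).
  by apply: le_trans (word_coef_ge f0 (hMt M MMt)); rewrite ge_min lexx orbT.
have bs : b <= p`_(code t + 2 * h).
  rewrite -codes /p /l -st.
  by apply: le_trans (word_coef_ge f0 (hMs M MMs)); rewrite ge_min lexx.
have ct_res := residue_supportX (n := l) (residue M).
have hct : residue_support (code t) (2 * h) p.
  move=> j /ct_res ->; apply/esym/ct_res.
  by rewrite gt_eqF // (lt_le_trans b0).
rewrite -mulrA -invfM -sqrtrM // -natrM mulnC -/n.
have mean2 : `|moment1 (trunc_poly f M) (2 * M)%:R| <= 2 * (v / M%:R).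
  by rewrite moment1_trunc_poly normrM ger0_norm // ler_wpM2l // fmean.
have mean2' : `|moment1 p (l%:R * (2 * M)%:R)| <= l%:R * (2 * (v / M%:R)).
  by apply: le_trans (moment1_exp _ _ ftr T1) _; rewrite ler_wpM2l.
have vM0 : 0 <= v / M%:R by rewrite divr_ge0.
have vMv : v / M%:R <= v by rewrite ler_pdivrMr // -[leLHS]mulr1 ler_wpM2l.
have sq_le (a e : R) : `|a| <= e -> a ^+ 2 <= e ^+ 2.
  by move=> ae; rewrite -[a ^+ 2]ger0_norm ?sqr_ge0 // normrX lerXn2r ?nnegrE // (le_trans _ ae).
apply: (local p (code t) h (l%:R * (2 * M)%:R)) => //.
- exact: leq_trans kk1 kn.
- rewrite horner_exp -exprM horner1_trunc_poly.
  have t1 : v / M%:R <= 1 by rewrite ler_pdivrMr // mul1r.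
  apply: le_trans (_ : (1 - v / M%:R) ^+ (l * n) <= _); last first.
    by rewrite lerXn2r ?nnegrE ?subr_ge0 ?fmass // -horner1_trunc_poly.
  apply: le_trans (bernoulli_ge (l * n) vM0 t1).
  have : (l * n)%:R * (v / M%:R) <= 1 / 4.
    by rewrite mulrA ler_pdivrMr //; lra.
  by lra.
- apply: le_trans (_ : n%:R * (l%:R * (2 * (v / M%:R))) ^+ 2 <= _).
    by rewrite ler_wpM2l // sq_le.
  apply: le_trans V1.
  rewrite (_ : n%:R * _ = (4 * n%:R * l%:R ^+ 2 * v ^+ 2) / M%:R ^+ 2); last first.
    by rewrite !expr2; field; rewrite gt_eqF.
  rewrite ler_pdivrMr ?exprn_gt0 // mul1r; apply: le_trans Mmean _.
  by rewrite expr2 -[leLHS]mul1r ler_wpM2r.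
- apply: le_trans (moment2_exp _ _ ftr T1) _.
  rewrite moment2_trunc_poly.
  have h1 := ler_wpM2l (_ : 0 <= 4 * l%:R) (fvar M).
  have {}h1 := h1 (mulr_ge0 (ler0n _ _) (ler0n _ _)).
  have h2 := ler_wpM2l (_ : 0 <= l%:R ^+ 2) (sq_le _ _ mean2).
  have {}h2 := h2 (exprn_ge0 _ (ler0n _ _)).
  have h3 : l%:R ^+ 2 * (2 * (v / M%:R)) ^+ 2 <= 4 * l%:R ^+ 2 * v ^+ 2.
    have -> : l%:R ^+ 2 * (2 * (v / M%:R)) ^+ 2 = 4 * l%:R ^+ 2 * (v / M%:R) ^+ 2 by ring.
    by rewrite ler_wpM2l ?mulr_ge0 ?exprn_ge0 // lerXn2r ?nnegrE.
  rewrite /V; move: h1 (le_trans h2 h3); rewrite -mulrA [l%:R * _]mulrCA [4 * (l%:R * _)]mulrA.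
  by rewrite mulrA; lra.
- have -> : N%:R - n%:R * (l%:R * (2 * M)%:R) = 2 * z%:~R :> R.
    have : N%:Z%:~R = (2 * ((l * h * k * M)%:Z + z))%:~R :> R by rewrite NE.
    rewrite -pmulrn => ->; rewrite intrM intrD -pmulrn /n !natrM; ring.
  have -> : (2 * z%:~R) ^+ 2 = (4 * absz z ^ 2)%:R :> R.
    rewrite natrM natrX exprMn; congr (_ * _); first by ring.
    by rewrite natr_absz intr_norm real_normK ?num_real.
  by rewrite ler_nat (leq_trans kz kn).
have N0 : (2 * h %| N)%N.
  have [e ze] := dvdzP hz.
  have : ((2 * h)%:Z %| N%:Z)%Z.
    by apply/dvdzP; exists ((l * k * M)%:Z + e); rewrite NE ze !PoszM; ring.
  by rewrite dvdzE.
have C0 : (2 * h %| n * code t)%N.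
  rewrite /code -big_distrr /= /n; move: (\sum_(_ <- _) _)%N => w.
  by apply/dvdnP; exists (k * w)%N; ring.
by move: N0 C0; rewrite /dvdn => /eqP-> /eqP->.
Qed.

End IntegerLawLower.

(** * Probabilities as real numbers *)

Section RealProbability.
Variables (R : realType) (disp : measure_display) (T : measurableType disp).
Variable P : probability T R.
Implicit Types (A B : set T).

Definition pr A : R := fine (P A).

Lemma prE A : measurable A -> P A = (pr A)%:E.
Proof. by move=> mA; rewrite /pr fineK // fin_num_measure. Qed.

Lemma pr_ge0 A : 0 <= pr A.
Proof. by rewrite /pr fine_ge0. Qed.

Lemma integrable_indic_sum (I : Type) (s : seq I) (c : I -> R) (A : I -> set T) :
  (forall i, measurable (A i)) ->
  P.-integrable setT (EFin \o (fun w => \sum_(i <- s) c i * \1_(A i) w)).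
Proof.
move=> mA; have -> : EFin \o (fun w => \sum_(i <- s) c i * \1_(A i) w) =
    (fun w => (\sum_(i <- s) (c i)%:E * (\1_(A i) w)%:E)%E).
  by apply/funext => w /=; rewrite -sumEFin.
apply: integrable_sum => // i _; apply: integrableZl => //.
exact: integrable_indic.
Qed.

Lemma Rintegral_indic_sum (I : Type) (s : seq I) (c : I -> R) (A : I -> set T) :
  (forall i, measurable (A i)) ->
  \int[P]_w (\sum_(i <- s) c i * \1_(A i) w) = \sum_(i <- s) c i * pr (A i).
Proof.
move=> mA; elim: s => [|i s IH].
  under eq_Rintegral do rewrite big_nil.
  by rewrite Rintegral_cst // mul0r big_nil.
under eq_Rintegral do rewrite big_cons.
rewrite RintegralD //; last exact: integrable_indic_sum.
  rewrite IH big_cons; congr (_ + _); rewrite RintegralZl //; last exact: integrable_indic.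
  by rewrite /Rintegral integral_indic // setIT.
by have := @integrable_indic_sum _ [:: i] c A mA; under [X in _.-integrable _ X -> _]eq_fun do rewrite /= big_seq1.
Qed.

(** Unions, disjoint decompositions and second moments all come down to
    integrating a pointwise inequality of this form. *)
Lemma pr_indic_le (I J : Type) (s : seq I) (t : seq J) (c : I -> R) (e : J -> R)
    (A : I -> set T) (B : J -> set T) :
  (forall i, measurable (A i)) -> (forall j, measurable (B j)) ->
  (forall w, \sum_(i <- s) c i * \1_(A i) w <= \sum_(j <- t) e j * \1_(B j) w) ->
  \sum_(i <- s) c i * pr (A i) <= \sum_(j <- t) e j * pr (B j).
Proof.
move=> mA mB le; rewrite -!Rintegral_indic_sum //.
by apply: le_Rintegral => //; exact: integrable_indic_sum.
Qed.

Lemma pr_setT : pr setT = 1.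
Proof. by rewrite /pr probability_setT. Qed.

Lemma le_pr A B : measurable A -> measurable B -> A `<=` B -> pr A <= pr B.
Proof.
move=> mA mB AB; rewrite -lee_fin -!prE //; apply: le_measure => //; exact/mem_set.
Qed.

Lemma pr_le1 A : measurable A -> pr A <= 1.
Proof. by move=> mA; rewrite -pr_setT le_pr. Qed.

Lemma pr_sum (I : Type) (s : seq I) A (B : I -> set T) :
  measurable A -> (forall i, measurable (B i)) ->
  (forall w, \1_A w = \sum_(i <- s) \1_(B i) w :> R) -> pr A = \sum_(i <- s) pr (B i).
Proof.
move=> mA mB AB; have := @Rintegral_indic_sum _ s (fun=> 1) B mB.
under eq_Rintegral do (under eq_bigr do rewrite mul1r; rewrite -AB).
under [X in _ = X -> _]eq_bigr do rewrite mul1r.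
by move=> <-; rewrite /Rintegral integral_indic // setIT.
Qed.

Lemma pr_union_le (I : eqType) (s : seq I) A (B : I -> set T) :
  measurable A -> (forall i, measurable (B i)) ->
  (forall w, A w -> exists2 i, i \in s & B i w) -> pr A <= \sum_(i <- s) pr (B i).
Proof.
move=> mA mB AB; have := @pr_indic_le _ _ [:: tt] s (fun=> 1) (fun=> 1) (fun=> A) B.
rewrite big_seq1 mul1r; under eq_bigr do rewrite mul1r; apply => // w.
rewrite big_seq1 mul1r; under eq_bigr do rewrite mul1r.
rewrite {1}indicE; case: (boolP (w \in A)) => [/set_mem/AB[i si Bi]|_].
  rewrite (perm_big _ (perm_to_rem si)) big_cons /= indicE mem_set // lerDl.
  by rewrite sumr_ge0.
by rewrite sumr_ge0 // => i _; rewrite indicE.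
Qed.

Section Fibers.
Variables (K : countType) (H : T -> K).
Hypothesis mH : forall l, measurable (H @^-1` [set l]).

Let fiber (Q : K -> Prop) n : set T := [set w | Q (H w) /\ choice.pickle (H w) = n].

Let fiber_cases Q n : fiber Q n = set0 \/ exists2 l, Q l & fiber Q n = [set w | H w = l].
Proof.
have [[l [q ln]]|h] := pselect (exists l, Q l /\ choice.pickle l = n).
  right; exists l => //; apply/seteqP; split=> w /= => [[_]|wl]; last by split; rewrite wl.
  by rewrite -ln => /(pcan_inj choice.pickleK).
by left; rewrite -subset0 => w [q wn]; apply: h; exists (H w).
Qed.

Let measurable_fiber Q n : measurable (fiber Q n).
Proof. by have [->|[l _ ->]] := fiber_cases Q n; [exact: measurable0|exact: mH]. Qed.

Let fiberE Q : [set w | Q (H w)] = \bigcup_n fiber Q n.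
Proof. by apply/seteqP; split=> [w q|w [n _ []]//]; exists (choice.pickle (H w)). Qed.

Lemma measurable_fibers (Q : K -> Prop) : measurable [set w | Q (H w)].
Proof. by rewrite fiberE; apply: bigcup_measurable => n _; exact: measurable_fiber. Qed.

Let fiber_sum Q B : measurable B ->
  P ([set w | Q (H w)] `&` B) = (\sum_(0 <= n <oo) P (fiber Q n `&` B))%E.
Proof.
move=> mB; rewrite fiberE setI_bigcupl measure_bigcup //.
- by apply: eq_eseriesl => n; exact: mem_set.
- by move=> n _; apply: measurableI.
by apply/trivIsetP => i j _ _ /eqP ij; rewrite -subset0 => w [[[_ wi] _] [[_ wj] _]]; apply: ij; rewrite -wi -wj.
Qed.

(** Summation over the countably many fibers turns a bound given each value of
    [H] into a bound given any event that [H] determines. *)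
Lemma pr_fibers_le (Q : K -> Prop) B b : measurable B -> 0 <= b ->
  (forall l, Q l -> pr ([set w | H w = l] `&` B) <= pr [set w | H w = l] * b) ->
  pr ([set w | Q (H w)] `&` B) <= pr [set w | Q (H w)] * b.
Proof.
move=> mB b0 hb; have mQ := measurable_fibers Q.
rewrite -lee_fin EFinM -!prE //; last exact: measurableI.
rewrite fiber_sum // -[X in P X]setIT fiber_sum // muleC -nneseriesZl //.
apply: lee_nneseries => // n _; rewrite setIT.
have [->|[l q ->]] := fiber_cases Q n; first by rewrite set0I measure0 mule0.
rewrite (prE (measurableI _ _ (mH l) mB)) (prE (mH l)) muleC -EFinM lee_fin.
exact: hb.
Qed.

Lemma pr_fibers_ge (Q : K -> Prop) B b : measurable B -> 0 <= b ->
  (forall l, Q l -> pr [set w | H w = l] * b <= pr ([set w | H w = l] `&` B)) ->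
  pr [set w | Q (H w)] * b <= pr ([set w | Q (H w)] `&` B).
Proof.
move=> mB b0 hb; have mQ := measurable_fibers Q.
rewrite -lee_fin EFinM -!prE //; last exact: measurableI.
rewrite fiber_sum // -[X in P X]setIT fiber_sum // muleC -nneseriesZl //.
apply: lee_nneseries => // [n _|n _]; first by rewrite mule_ge0.
rewrite setIT.
have [->|[l q ->]] := fiber_cases Q n; first by rewrite set0I measure0 mule0.
rewrite (prE (measurableI _ _ (mH l) mB)) (prE (mH l)) muleC -EFinM lee_fin.
exact: hb.
Qed.

End Fibers.
End RealProbability.

(** * Coordinates of a lattice law *)

Section CoordinateLaw.
Variables (R : realType) (D : nat) (F : probability (lattice D) R) (i : 'I_D).

Definition coord (v : lattice D) : int := (v : 'rV[int]_D) 0 i.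

Definition coord_law (x : int) : R := pr F [set v | coord v = x].

Lemma measurable_lattice (A : set (lattice D)) : measurable A.
Proof. by []. Qed.

Let X : lattice D -> R := coordinate R i.

Let XE v : X v = (coord v)%:~R. Proof. by []. Qed.

Hypothesis X_int : F.-integrable setT (EFin \o X).
Hypothesis X_mean : ('E_F[X] = 0)%E.
Hypothesis X_var : ('V_F[X] < +oo)%E.

Let X2_int : F.-integrable setT (EFin \o (fun v => X v ^+ 2)).
Proof.
apply/integrableP; split; first by move=> mT Y mY; exact: measurable_lattice.
have := X_var; rewrite /variance covariance.unlock X_mean expectation.unlock /=.
rewrite (eq_integral (fun w => `|(X w ^+ 2)%:E|%E)) //.
move=> v _ /=; rewrite ger0_norm ?sqr_ge0 // expr2; congr (_%:E).
by rewrite -[LHS]/((X v - 0) * (X v - 0)) subr0.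
Qed.

Let v : R := \int[F]_w (X w ^+ 2).

Let box_sum M (c : int -> R) w :
  \sum_(j < (2 * M).+1) c (centered M j) * \1_[set v | coord v = centered M j] w =
  if `|coord w| <= M%:Z then c (coord w) else 0.
Proof.
case: ifP => wM.
  have jM : (absz (coord w + M%:Z)%R < (2 * M).+1)%N by move: wM; clear; lia.
  have cj : centered M (Ordinal jM) = coord w by rewrite /centered /=; move: wM; clear; lia.
  rewrite (bigD1 (Ordinal jM)) //= -/(centered M (Ordinal jM)) cj.
  rewrite indicE mem_set // mulr1 big1 ?addr0 // => j jne.
  rewrite indicE memNset ?mulr0 //= => wj; case/eqP: jne; apply/val_inj => /=.
  by move: wj; rewrite /centered; clear; lia.
rewrite big1 // => j _; rewrite indicE memNset ?mulr0 //= => wj.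
by move: wM; rewrite wj /centered; have := ltn_ord j; clear; lia.
Qed.

Let box_int M (c : int -> R) : F.-integrable setT
  (EFin \o (fun w => if `|coord w| <= M%:Z then c (coord w) else 0)).
Proof.
have := @integrable_indic_sum _ _ _ F _ (index_enum 'I_(2 * M).+1) (fun j => c (centered M j))
  (fun j => [set v | coord v = centered M j]) (fun=> measurable_lattice _).
by congr (_.-integrable _ _); apply/funext => w /=; rewrite box_sum.
Qed.

Let box_Rint M (c : int -> R) :
  \int[F]_w (if `|coord w| <= M%:Z then c (coord w) else 0) =
  \sum_(j < (2 * M).+1) c (centered M j) * coord_law (centered M j).
Proof.
rewrite -(@Rintegral_indic_sum _ _ _ F _ (index_enum 'I_(2 * M).+1) (fun j => c (centered M j))
  (fun j => [set v | coord v = centered M j]) (fun=> measurable_lattice _)).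
by apply: eq_Rintegral => w _; rewrite box_sum.
Qed.

Let v0 : 0 <= v.
Proof. by apply: Rintegral_ge0 => w _; rewrite sqr_ge0. Qed.

Let tail_ge M w : (0 < M)%N -> ~~ (`|coord w| <= M%:Z) ->
  M%:R <= `|X w| /\ `|X w| <= X w ^+ 2 / M%:R.
Proof.
move=> M0; rewrite -ltNge => wM.
have MX : M%:R <= `|X w|.
  by rewrite XE -intr_norm (_ : M%:R = M%:Z%:~R) // ler_int ltW.
split=> //; rewrite ler_pdivlMr ?ltr0n // -[X w ^+ 2]real_normK ?num_real // expr2.
by rewrite ler_wpM2l.
Qed.

Let cst_int (r : R) : F.-integrable setT (EFin \o (fun=> r)).
Proof. exact: finite_measure_integrable_cst. Qed.

Let one_Rint : \int[F]_w (1 : R) = 1.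
Proof. by rewrite Rintegral_cst // mul1r -[fine _]/(pr F setT) pr_setT. Qed.

Let X2M_int M : F.-integrable setT (EFin \o (fun w => X w ^+ 2 / M%:R)).
Proof.
have -> : EFin \o (fun w => X w ^+ 2 / M%:R) =
   (fun w => (M%:R^-1%:E * (X w ^+ 2)%:E)%E).
  by apply/funext => w /=; rewrite mulrC EFinM.
exact: (integrableZl _ _ X2_int).
Qed.

Let X2M_Rint M : \int[F]_w (X w ^+ 2 / M%:R) = v / M%:R.
Proof.
rewrite mulrC -RintegralZl //; apply: eq_Rintegral => w _; exact: mulrC.
Qed.

Let mass_le1 M : \sum_(j < (2 * M).+1) coord_law (centered M j) <= 1.
Proof.
have := @box_Rint M (fun=> 1); under [X in _ = X -> _]eq_bigr do rewrite mul1r.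
move=> <-; rewrite -[leRHS]one_Rint.
apply: le_Rintegral => //; first exact: (@box_int M (fun=> 1)).
by move=> w _; case: ifP.
Qed.

Let mass_ge M : (0 < M)%N ->
  1 - v / M%:R <= \sum_(j < (2 * M).+1) coord_law (centered M j).
Proof.
move=> M0; have := @box_Rint M (fun=> 1).
under [X in _ = X -> _]eq_bigr do rewrite mul1r.
move=> <-; rewrite lerBlDr -X2M_Rint -RintegralD //; last exact: (@box_int M (fun=> 1)).
rewrite -[leLHS]one_Rint.
apply: le_Rintegral => //; first by apply: (integrableD _ (box_int M (fun=> 1)) (X2M_int M)).
move=> w _; case: ifP => [_|/negbT wM]; first by rewrite lerDl divr_ge0 ?sqr_ge0.
have [h1 h2] := tail_ge M0 wM; rewrite add0r; apply: le_trans h2; apply: le_trans h1.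
by rewrite ler1n.
Qed.

Let mean_le M : (0 < M)%N ->
  `|\sum_(j < (2 * M).+1) coord_law (centered M j) * (centered M j)%:~R| <= v / M%:R.
Proof.
move=> M0; have := @box_Rint M (fun x => x%:~R).
under [X in _ = X -> _]eq_bigr do rewrite mulrC.
move=> <-; set B := (X in \int[F]_w X w).
have B_int : F.-integrable setT (EFin \o B) := @box_int M (fun x => x%:~R).
have EX : \int[F]_w X w = 0.
  by move: X_mean; rewrite expectation.unlock /Rintegral => ->.
have key w : `|X w - B w| <= X w ^+ 2 / M%:R.
  rewrite /B; case: ifP => [_|/negbT wM]; first by rewrite XE subrr normr0 divr_ge0 ?sqr_ge0.
  by rewrite subr0; have [] := tail_ge M0 wM.
rewrite ler_norml; apply/andP; split.
  rewrite -subr_ge0 opprK -X2M_Rint -RintegralD // -[leLHS]EX.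
  apply: le_Rintegral => //; first exact: (integrableD _ B_int (X2M_int M)).
  move=> w _; have := key w; rewrite -/(B w) ler_norml => /andP[]; move: (B w) (X w) (_ / _) => p q r; lra.
rewrite -[leRHS]addr0 -[X in _ <= _ + X]EX -X2M_Rint -RintegralD //.
apply: le_Rintegral => //; first exact: (integrableD _ (X2M_int M) X_int).
move=> w _; have := key w; rewrite -/(B w) ler_norml => /andP[]; move: (B w) (X w) (_ / _) => p q r; lra.
Qed.

Let var_le M :
  \sum_(j < (2 * M).+1) coord_law (centered M j) * (centered M j)%:~R ^+ 2 <= v.
Proof.
have := @box_Rint M (fun x => x%:~R ^+ 2).
under [X in _ = X -> _]eq_bigr do rewrite mulrC.
move=> <-; apply: le_Rintegral => //; first exact: (@box_int M (fun x => x%:~R ^+ 2)).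
by move=> w _; case: ifP => _; rewrite ?sqr_ge0.
Qed.

Hypothesis X_nonzero : F [set v | coord v = 0] <> 1%E.

Let atoms : exists x y : int, x != y /\ 0 < coord_law x /\ 0 < coord_law y.
Proof.
have mc (x : int) : measurable (coord @^-1` [set x]) by [].
have atom (Q : int -> Prop) : 0 < pr F [set w | Q (coord w)] ->
    exists2 x, Q x & 0 < coord_law x.
  move=> Qpos; apply: contrapT => h.
  suff : pr F [set w | Q (coord w)] <= 0 by rewrite leNgt Qpos.
  have := @pr_fibers_le _ _ _ F _ coord mc Q setT 0 measurableT (lexx 0).
  rewrite setIT mulr0; apply => l ql; rewrite setIT mulr0 leNgt.
  by apply/negP => lpos; apply: h; exists l.
have compl (x : int) : pr F [set w | coord w <> x] = 1 - coord_law x.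
  have := @pr_sum _ _ _ F bool [:: true; false] setT
    (fun b => if b then [set w | coord w <> x] else [set w | coord w = x]) measurableT.
  rewrite pr_setT !big_cons big_nil addr0 => ->; first by rewrite addrK.
    by case.
  move=> w; rewrite !big_cons big_nil addr0 !indicE mem_setT.
  have [wx|wx] := pselect (coord w = x).
    by rewrite memNset ?mem_set // add0r.
  by rewrite mem_set // memNset // addr0.
have [x x0 px] : exists2 x, x <> 0 & 0 < coord_law x.
  apply: atom; rewrite compl subr_gt0 lt_neqAle pr_le1 // andbT.
  apply/eqP => h; apply: X_nonzero.
  by rewrite (prE F (measurable_lattice [set v | coord v = 0])) -[pr F _]/(coord_law 0) h.
have [[y [yx py]]|alone] := pselect (exists y, y <> x /\ 0 < coord_law y).
  by exists x, y; split=> //; apply/eqP => xy; apply: yx.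
have other (y : int) : y <> x -> coord_law y = 0.
  move=> yx; apply/eqP; rewrite eq_le pr_ge0 andbT leNgt; apply/negP => py.
  by apply: alone; exists y.
have xR : 0 < `|x%:~R : R| by rewrite normr_gt0 intr_eq0; apply/eqP.
pose t := v / (coord_law x * `|x%:~R|).
pose M := (maxn (absz x) (Num.truncn t).+1)%N.
have xM : `|x| <= M%:Z by rewrite /M; clear; lia.
have M0 : (0 < M)%N by rewrite /M leq_max orbT.
have tM : t < M%:R.
  by apply: lt_le_trans (Num.Theory.truncnS_gt t) _; rewrite ler_nat leq_max leqnn orbT.
have jM : (absz (x + M%:Z)%R < (2 * M).+1)%N by move: xM; clear; lia.
have cj : centered M (Ordinal jM) = x by rewrite /centered /=; move: xM; clear; lia.
have := mean_le M0; rewrite (bigD1 (Ordinal jM)) //= -/(centered M (Ordinal jM)) cj.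
rewrite big1 ?addr0 => [|j jne]; last first.
  rewrite other ?mul0r // => wj; case/eqP: jne; apply/val_inj => /=.
  by move: wj; rewrite /centered; clear; lia.
rewrite normrM (ger0_norm (ltW px)) ler_pdivlMr ?ltr0n // mulrC -ler_pdivlMr ?mulr_gt0 //.
by rewrite leNgt tM.
Qed.

(** Off the box [-M, M] one has [1 <= |X| <= X ^ 2 / M], so the cut-off costs at
    most the variance over [M] in mass and in mean. There are two atoms because
    the law is not concentrated at [0], and a law concentrated at another point
    has a nonzero mean. *)
Lemma coord_law_centered : exists u, centered_law coord_law u.
Proof.
exists v; split; [by move=> x; exact: pr_ge0|exact: v0|exact: mass_le1|exact: mass_ge|
  exact: mean_le|exact: var_le|exact: atoms].
Qed.

End CoordinateLaw.

Section StepLaw.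
Variables (R : realType) (D : nat) (F : probability (lattice D) R).

Lemma prod_EFin (I : Type) (s : seq I) (f : I -> R) :
  (\prod_(i <- s) (f i)%:E)%E = (\prod_(i <- s) f i)%:E.
Proof. by elim: s => [|i s IH]; rewrite ?big_nil // !big_cons IH. Qed.

Lemma prod_fset_ord (f : 'I_D -> \bar R) :
  (\prod_(i <- [fset i | i in 'I_D]%fset) f i = \prod_(i < D) f i)%E.
Proof.
apply: perm_big; apply: uniq_perm; rewrite ?fset_uniq ?index_enum_uniq // => i.
by rewrite mem_index_enum; apply/imfsetP; exists i.
Qed.

Hypothesis F_indep : mutually_independent F (fun i : 'I_D => coordinate R i).

(** Sets of integers are preimages of countable, hence Borel, sets of reals, to
    which the independence of the real coordinates applies. *)
Lemma pr_coords (A : 'I_D -> set int) :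
  pr F [set v | forall i, A i (coord i v)] = \prod_(i < D) pr F [set v | A i (coord i v)].
Proof.
have mA i : measurable ([set x%:~R | x in A i] : set R).
  apply: countable_measurable => [t|]; first exact: measurable_set1.
  by apply: sub_countable (card_image_le _ _) _; exact: countableP.
have := F_indep [fset i | i in 'I_D]%fset mA.
have preE i : coordinate R i @^-1` [set x%:~R | x in A i] = [set v | A i (coord i v)].
  apply/seteqP; split=> v /= => [[x Ax xv]|Av]; last by exists (coord i v).
  by rewrite -(intr_inj xv : x = coord i v).
rewrite prod_fset_ord; under eq_bigr => i _ do rewrite preE prE //.
rewrite prod_EFin => h.
rewrite /pr (_ : [set v | _] = \bigcap_(i in [set` [fset i | i in 'I_D]%fset])
  coordinate R i @^-1` [set x%:~R | x in A i]) ?h //.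
apply/seteqP; split=> v /= Av i.
  by move=> _; have := Av i; rewrite -[A i _]/([set v | A i (coord i v)] v) -preE.
have : i \in [fset i | i in 'I_D]%fset by apply/imfsetP; exists i.
by move/Av; rewrite -[_ v]/((coordinate R i @^-1` [set x%:~R | x in A i]) v) preE.
Qed.

Lemma pr_projection_coords (d : nat) (A : 'I_D -> set int) :
  pr (projection d F) [set v | forall i, A i (coord i v)] =
  \prod_(i < D) if (i < d)%N then pr F [set v | A i (coord i v)] else (`[< A i 0 >])%:R.
Proof.
rewrite /pr -[projection d F _]/(F (@truncate D d @^-1` _)).
pose B (i : 'I_D) := if (i < d)%N then A i else [set x | A i 0].
rewrite (_ : @truncate D d @^-1` _ = [set v | forall i, B i (coord i v)]); last first.
  apply/seteqP; split=> v /= Av i; have := Av i; rewrite /B /coord /truncate /= mxE;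
  by case: ifP.
rewrite -/(pr F _) pr_coords; apply: eq_bigr => i _; rewrite /B; case: ifP => // _.
case: asboolP => h; first by rewrite (_ : [set _ | _] = setT) ?pr_setT //; apply/seteqP; split.
by rewrite (_ : [set _ | _] = set0) /pr ?measure0 // -subset0.
Qed.

End StepLaw.

(** The hyperplane of the points whose [i]-th coordinate vanishes is a proper
    subspace. *)
Lemma truly_dimensional_coord (R : realType) (D : nat) (F : probability (lattice D) R)
  (i : 'I_D) : truly_dimensional F -> F [set v | coord i v = 0] <> 1%E.
Proof.
move=> F_dim F1.
pose f : 'rV[R]_D -> R^o := fun v => v 0 i.
have lf : linear f by move=> c u v; rewrite /f !mxE.
pose fL : {linear 'rV[R]_D -> R^o} := HB.pack f (GRing.isLinear.Build _ _ _ _ f lf).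
pose fl := linfun fL.
have flE v : fl v = v 0 i by rewrite lfunE.
apply: (F_dim (lker fl)).
  apply/eqP => full; have := memvf (delta_mx 0 i : 'rV[R]_D).
  by rewrite -full memv_ker flE mxE !eqxx oner_eq0.
rewrite -F1; congr (F _); apply/seteqP; split=> v /=; rewrite memv_ker flE mxE.
  by rewrite /coordinate intr_eq0 => /eqP.
by rewrite /coordinate -[_ 0 i]/(coord i v) => ->.
Qed.

(** * The past of the walk *)

Section Walk.
Variables (R : realType) (F : probability (lattice 4) R) (a : nat -> nat).
Variables (disp : measure_display) (Omega : measurableType disp).
Variables (P : probability Omega R) (S : nat -> {RV P >-> lattice 4}).
Hypothesis F_indep : mutually_independent F (fun i : 'I_4 => coordinate R i).
Hypothesis S_walk : varying_dimension_walk 2 F a S.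
Implicit Types (i : 'I_4) (j k m r n : nat) (w : Omega).

Definition incr j w : 'rV[int]_4 := increment S j.+1 w.

Definition active k i : bool := (i < 2)%N || `[< special_times a k >].

Definition step_law j i (x : int) : R :=
  if active j.+1 i then coord_law F i x else (x == 0)%:R.

Lemma pr_incr_coords j (A : 'I_4 -> set int) :
  pr P [set w | forall i, A i (coord i (incr j w))] =
  \prod_i if active j.+1 i then pr F [set v | A i (coord i v)] else `[< A i 0 >]%:R.
Proof.
rewrite /pr -[P _]/(pushforward P (increment S j.+1) [set v | forall i, A i (coord i v)]).
have [sp|nsp] := pselect (special_times a j.+1).
  rewrite (walk_special_law S_walk _ sp) // -/(pr F _) pr_coords //.
  by apply: eq_bigr => i _; rewrite /active (asboolT sp) orbT.
rewrite (walk_ordinary_law S_walk _ nsp) // -/(pr _ _) pr_projection_coords //.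
by apply: eq_bigr => i _; rewrite /active (asboolF nsp) orbF.
Qed.

Lemma pr_incr j (x : 'rV[int]_4) :
  pr P [set w | incr j w = x] = \prod_i step_law j i (x 0 i).
Proof.
have := pr_incr_coords j (fun i => [set x 0 i]).
rewrite (_ : [set w | _] = [set w | incr j w = x]).
  move=> ->; apply: eq_bigr => i _; rewrite /step_law; case: ifP => // _.
  have -> : `[< [set x 0 i] 0 >] = (x 0 i == 0); last by [].
  by apply/idP/idP => [/asboolP /= <-|/eqP h] //; apply/asboolP; rewrite /= h.
by apply/seteqP; split=> w /= => [h|-> //]; apply/rowP => i; exact: h.
Qed.

Let St k w : 'rV[int]_4 := S k w.

Let measurable_St k (u : 'rV[int]_4) : measurable [set w | St k w = u].
Proof.
have := measurable_funPT (S k) measurableT [set (u : lattice 4)] (measurable_lattice _).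
by rewrite setTI.
Qed.

Lemma measurable_incr j (Q : set 'rV[int]_4) : measurable [set w | Q (incr j w)].
Proof.
have h (l : 'rV[int]_4 * 'rV[int]_4) :
    measurable ((fun w => (St j.+1 w, St j w)) @^-1` [set l]).
  rewrite (_ : _ @^-1` _ = [set w | St j.+1 w = l.1] `&` [set w | St j w = l.2]).
    by apply: measurableI; exact: measurable_St.
  by apply/seteqP; split=> w /=; case: l => u v /= [-> ->].
exact: (measurable_fibers h (fun l => Q (l.1 - l.2))).
Qed.

(** Takes countably many values, so that conditioning on the past is a matter of
    sums over its fibers. *)
Definition history m w : seq 'rV[int]_4 := [seq incr j w | j <- iota 0 m].

Lemma historyP m w w' :
  history m w = history m w' <-> forall j, (j < m)%N -> incr j w = incr j w'.
Proof.
split=> [/eq_in_map h j jm|h]; first by apply: h; rewrite mem_iota.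
by apply/eq_in_map => j; rewrite mem_iota => /andP[_]; exact: h.
Qed.

Definition adapted m (E : set Omega) : Prop :=
  forall w w', history m w = history m w' -> E w -> E w'.

Lemma measurable_history m (l : seq 'rV[int]_4) : measurable (history m @^-1` [set l]).
Proof.
have [sl|sl] := eqVneq (size l) m; last first.
  rewrite (_ : _ @^-1` _ = set0) // -subset0 => w /= e.
  by move: sl; rewrite -e size_map size_iota eqxx.
rewrite (_ : _ @^-1` _ = \bigcap_j [set w | (j < m)%N -> incr j w = nth 0 l j]).
  apply: bigcapT_measurable => j; case: (ltnP j m) => jm.
    rewrite (_ : [set _ | _] = [set w | incr j w = nth 0 l j]); first exact: (measurable_incr j [set nth 0 l j]).
    by apply/seteqP; split=> w /= => [h|h _ //]; exact: h.
  by rewrite (_ : [set _ | _] = setT) //; apply/seteqP; split.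
apply/seteqP; split=> w /= => [<- j _ /= jm|h].
  by rewrite (nth_map 0%N) ?size_iota // nth_iota.
apply: (@eq_from_nth _ 0); rewrite size_map size_iota // => j jm.
by rewrite (nth_map 0%N) ?size_iota // nth_iota // add0n; exact: (h j).
Qed.

Lemma adaptedE m E : adapted m E ->
  E = [set w | (fun l => exists2 w', history m w' = l & E w') (history m w)].
Proof.
move=> aE; apply/seteqP; split=> w /= => [Ew|[w' e]]; first by exists w.
exact: aE.
Qed.

Lemma measurable_adapted m E : adapted m E -> measurable E.
Proof.
move=> /adaptedE ->.
exact: (measurable_fibers (measurable_history m) (fun l => exists2 w', history m w' = l & E w')).
Qed.

Lemma prod_fset_iota (f : nat -> \bar R) m :
  (\prod_(j <- [fset j | j in iota 0 m]%fset) f j = \prod_(j < m) f j)%E.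
Proof.
rewrite -(big_mkord xpredT f) /index_iota subn0.
apply: perm_big; apply: uniq_perm; rewrite ?fset_uniq ?iota_uniq // => j.
by apply/imfsetP/idP => [[x /= h ->]|h] //; exists j.
Qed.

Lemma pr_history_incr m (l : seq 'rV[int]_4) x :
  pr P ([set w | history m w = l] `&` [set w | incr m w = x]) =
  pr P [set w | history m w = l] * pr P [set w | incr m w = x].
Proof.
have [sl|sl] := eqVneq (size l) m; last first.
  have -> : [set w | history m w = l] = set0.
    by rewrite -subset0 => w /= e; move: sl; rewrite -e size_map size_iota eqxx.
  by rewrite set0I /pr measure0 mul0r.
pose A j : set (lattice 4) := [set v | (v : 'rV[int]_4) = nth x l j].
have key k : (k <= m.+1)%N ->
    P (\bigcap_(j in [set` [fset j | j in iota 0 k]%fset]) (increment S j.+1 @^-1` A j)) =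
    (\prod_(j < k) (pr P [set w | incr j w = nth x l j])%:E)%E.
  move=> km; rewrite (walk_independent S_walk); last by move=> j; exact: measurable_lattice.
  rewrite prod_fset_iota; apply: eq_bigr => j _; rewrite -prE //; exact: (measurable_incr j [set nth x l j]).
have capE k : \bigcap_(j in [set` [fset j | j in iota 0 k]%fset]) (increment S j.+1 @^-1` A j) =
    [set w | forall j, (j < k)%N -> incr j w = nth x l j].
  apply/seteqP; split=> w /= h j.
    by move=> jk; apply: h; apply/imfsetP; exists j => //=; rewrite mem_iota.
  by move=> /imfsetP[j' /=]; rewrite mem_iota => /andP[_ jk] ->; exact: h.
have histE : [set w | history m w = l] = [set w | forall j, (j < m)%N -> incr j w = nth x l j].
  apply/seteqP; split=> w /= => [<- j jm|h].
    by rewrite (nth_map 0%N) ?size_iota // nth_iota.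
  apply: (@eq_from_nth _ x); rewrite size_map size_iota // => j jm.
  by rewrite (nth_map 0%N) ?size_iota // nth_iota // add0n; exact: h.
have histSE : [set w | history m w = l] `&` [set w | incr m w = x] =
    [set w | forall j, (j < m.+1)%N -> incr j w = nth x l j].
  rewrite histE; apply/seteqP; split=> w /= => [[h hx] j|h].
    rewrite ltnS leq_eqVlt => /orP[/eqP ->|/h //].
    by rewrite nth_default ?sl.
  split=> [j jm|]; first by apply: h; rewrite ltnS ltnW.
  by rewrite h // nth_default ?sl.
have keym := key m (leqnSn m); have keySm := key m.+1 (leqnn _).
rewrite histSE histE /pr -!capE keym keySm !prod_EFin /= big_ord_recr /=.
by rewrite nth_default ?sl.
Qed.

(** The past is a countable union of histories, and for one history this is the
    independence of finitely many increments. *)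
Lemma pr_adapted_incr m E x : adapted m E ->
  pr P (E `&` [set w | incr m w = x]) = pr P E * pr P [set w | incr m w = x].
Proof.
move=> /adaptedE ->; set Q := fun l => exists2 w', history m w' = l & E w'.
have mB := measurable_incr m [set x]; have b0 := pr_ge0 P [set w | incr m w = x].
apply/eqP; rewrite eq_le; apply/andP; split.
  apply: (pr_fibers_le (measurable_history m) (Q := Q) mB b0) => l _.
  by rewrite pr_history_incr.
apply: (pr_fibers_ge (measurable_history m) (Q := Q) mB b0) => l _.
by rewrite pr_history_incr.
Qed.

Lemma adaptedI m E E' : adapted m E -> adapted m E' -> adapted m (E `&` E').
Proof. by move=> aE aE' w w' h [Ew E'w]; split; [exact: aE h Ew|exact: aE' h E'w]. Qed.

Lemma adapted_le m n E : (m <= n)%N -> adapted m E -> adapted n E.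
Proof.
move=> mn aE w w' /historyP h; apply: aE; apply/historyP => j jm.
by apply: h; exact: leq_trans jm mn.
Qed.

Lemma walk_sum k w : St k w = \sum_(j < k) incr j w.
Proof.
elim: k => [|k IH]; first by rewrite big_ord0; exact: (walk_start S_walk).
by rewrite big_ord_recr /= -IH addrC /incr /increment /= subrK.
Qed.

Lemma walk_coord_diff m r w i :
  coord i (S (m + r)%N w) - coord i (S m w) = \sum_(j < r) coord i (incr (m + j) w).
Proof.
have cS k : coord i (S k w) = \sum_(j < k) coord i (incr j w).
  by rewrite -[S k w]/(St k w) walk_sum /coord summxE.
by rewrite !cS big_split_ord /= addrAC subrr add0r.
Qed.

Lemma adapted_walk m k (Q : lattice 4 -> Prop) : (k <= m)%N -> adapted m [set w | Q (S k w)].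
Proof.
move=> km w w' /historyP h /=.
suff -> : S k w = S k w' by [].
rewrite -[LHS]/(St k w) -[RHS]/(St k w') !walk_sum; apply: eq_bigr => j _.
by apply: h; exact: leq_trans (ltn_ord j) km.
Qed.

End Walk.

(** * Local bounds for the walk *)

Section TruncatedLaw.
Variables (R : realType) (F : probability (lattice 4) R) (a : nat -> nat).
Variables (disp : measure_display) (Omega : measurableType disp).
Variables (P : probability Omega R) (S : nat -> {RV P >-> lattice 4}).
Hypothesis F_indep : mutually_independent F (fun i : 'I_4 => coordinate R i).
Hypothesis S_walk : varying_dimension_walk 2 F a S.
Variable e : nat -> 'I_4 -> bool.
Implicit Types (i : 'I_4) (j k m r n : nat) (w : Omega) (E : set Omega).

Local Notation incr := (incr S).
Local Notation adapted := (adapted S).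
Local Notation step_law := (step_law F a).

(** Coordinates of steps can be ignored: with one set of lemmas this covers the
    walk, its plane part, and the plane at one time with the rest at another. *)
Definition counted j i (x : int) : int := if e j i then x else 0.

Definition boxed M m r w : Prop :=
  forall j, (j < r)%N -> forall i, `|coord i (incr (m + j) w)| <= M%:Z.

Definition code M m r i w : nat :=
  (\sum_(j < r) 2 * absz (M%:Z + counted (m + j) i (coord i (incr (m + j) w)))%R)%N.

Definition step_poly M j i : {poly R} := \sum_(t < (2 * M).+1)
  step_law j i (centered M t) *: 'X^(2 * absz (M%:Z + counted j i (centered M t))%R).

Lemma step_poly_coef M (p : {poly R}) j i n :
  (p * step_poly M j i)`_n = \sum_(t < (2 * M).+1)
    (let s := (2 * absz (M%:Z + counted j i (centered M t))%R)%N in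
     if (s <= n)%N then p`_(n - s) else 0) * step_law j i (centered M t).
Proof.
rewrite /step_poly mulr_sumr coef_sum; apply: eq_bigr => t _ /=.
by rewrite -scalerAr coefZ coefMXn ltnNge mulrC; case: leqP.
Qed.

Lemma adapted_truncated M m r E (N : 'I_4 -> nat) : adapted m E ->
  adapted (m + r) [set w | [/\ E w, boxed M m r w & forall i, code M m r i w = N i]].
Proof.
move=> aE w w' /historyP h [/= Ew bw cw].
have hj j : (j < r)%N -> incr (m + j) w' = incr (m + j) w.
  by move=> jr; rewrite h // ltn_add2l.
split.
- by apply: aE Ew; apply/historyP => j jm; apply: h; rewrite ltn_addr.
- by move=> j jr i; rewrite hj //; exact: bw.
by move=> i; rewrite -cw; apply: eq_bigr => j _; rewrite hj.
Qed.

(** The joint law of the counted coordinate sums, cut off to a box, is a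
    product of coefficients of the generating polynomials: by induction, each
    step multiplies, and a product of sums over the coordinates is a sum over
    vectors. *)
Lemma pr_truncated M m r E (N : 'I_4 -> nat) : adapted m E ->
  pr P [set w | [/\ E w, boxed M m r w & forall i, code M m r i w = N i]] =
  pr P E * \prod_i (\prod_(j < r) step_poly M (m + j) i)`_(N i).
Proof.
move=> aE; elim: r N => [|r IH] N.
  have [N0|/existsNP[i Ni]] := pselect (forall i, N i = 0%N).
    rewrite big1 ?mulr1 => [|i _]; last by rewrite big_ord0 coef1 N0.
    congr (pr P _); apply/seteqP; split=> w /= => [[]//|Ew]; split=> // i.
    by rewrite /code big_ord0 N0.
  rewrite (bigD1 i) //= big_ord0 coef1 (negbTE (introN eqP Ni)) mul0r mulr0.
  rewrite (_ : [set w | _] = set0) ?/pr ?measure0 // -subset0 => w /= [_ _ /(_ i)].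
  by rewrite /code big_ord0 => /esym.
pose vec (t : {ffun 'I_4 -> 'I_(2 * M).+1}) : 'rV[int]_4 := \row_i centered M (t i).
pose inc (t : {ffun 'I_4 -> 'I_(2 * M).+1}) i :=
  (2 * absz (M%:Z + counted (m + r) i (centered M (t i)))%R)%N.
pose A r N := [set w | [/\ E w, boxed M m r w & forall i, code M m r i w = N i]].
pose B t := if [forall i, (inc t i <= N i)%N]
  then A r (fun i => (N i - inc t i)%N) `&` [set w | incr (m + r) w = vec t] else set0.
have codeS i w : code M m r.+1 i w = (code M m r i w +
   2 * absz (M%:Z + counted (m + r) i (coord i (incr (m + r) w)))%R)%N.
  by rewrite /code big_ord_recr.
have vec_inj : injective vec.
  move=> t t' /rowP tt; apply/ffunP => i; have := tt i; rewrite !mxE /centered.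
  by move=> h; apply/val_inj => /=; move: h; clear; lia.
have coord_vec t i w : incr (m + r) w = vec t -> coord i (incr (m + r) w) = centered M (t i).
  by move=> ->; rewrite /coord mxE.
have BA t w : B t w -> A r.+1 N w.
  rewrite /B; case: ifP => // /forallP tN [[Ew bw cw] /= wt]; split=> //.
    move=> j; rewrite ltnS leq_eqVlt => /orP[/eqP -> i|]; last exact: bw.
    rewrite (coord_vec t i w wt) /centered; have := ltn_ord (t i); clear; lia.
  by move=> i; rewrite codeS cw (coord_vec t i w wt) subnK.
have BI t w : B t w -> incr (m + r) w = vec t.
  by rewrite /B; case: ifP => // _ [].
have AB w : A r.+1 N w -> exists t, B t w.
  move=> [Ew bw cw].
  have tM i : (absz (coord i (incr (m + r) w) + M%:Z)%R < (2 * M).+1)%N.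
    by have := bw r (ltnSn r) i; clear; lia.
  pose t := [ffun i => Ordinal (tM i)].
  have wt : incr (m + r) w = vec t.
    apply/rowP => i; rewrite [RHS]mxE ffunE /centered /= -/(coord i (incr (m + r) w)).
    by have := bw r (ltnSn r) i; clear; lia.
  have cE i : (code M m r i w + inc t i = N i)%N.
    by rewrite -cw codeS /inc (coord_vec t i w wt).
  exists t; rewrite /B ifT; last by apply/forallP => i; rewrite -cE leq_addl.
  split=> //; split=> //; first by move=> j jr; apply: bw; rewrite ltnS ltnW.
  by move=> i; rewrite -cE addnK.
have mA r' N' : measurable (A r' N').
  exact: (measurable_adapted (@adapted_truncated M m r' E N' aE)).
have mB t : measurable (B t).
  rewrite /B; case: ifP => // _; apply: measurableI; first exact: mA.
  exact: (measurable_incr S (m + r) [set vec t]).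
rewrite -/(A r.+1 N) (@pr_sum _ _ _ P _ (index_enum _) _ B) //; last first.
  move=> w; have [Aw|nAw] := pselect (A r.+1 N w); last first.
    rewrite indicE memNset // big1 // => t _; rewrite indicE memNset //.
    by move=> /BA.
  have [t Bt] := AB w Aw.
  rewrite (bigD1 t) //= big1 ?addr0; last first.
    move=> t' t't; rewrite indicE memNset // => Bt'.
    by case/eqP: t't; apply: vec_inj; rewrite -(BI _ _ Bt) -(BI _ _ Bt').
  by rewrite !indicE !mem_set.
pose term i (t : 'I_(2 * M).+1) : R :=
    (let s := (2 * absz (M%:Z + counted (m + r) i (centered M t))%R)%N in
     if (s <= N i)%N then (\prod_(j < r) step_poly M (m + j) i)`_(N i - s) else 0)
     * step_law (m + r) i (centered M t).
transitivity (pr P E * \prod_i \sum_(t < (2 * M).+1) term i t); last first.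
  congr (_ * _); apply: eq_bigr => i _.
  by rewrite [in RHS]big_ord_recr /= step_poly_coef.
rewrite bigA_distr_bigA /= mulr_sumr; apply: eq_bigr => t _.
rewrite /B; case: ifPn => [/forallP tN|/forallPn /= [i tN]].
  rewrite (pr_adapted_incr S_walk); last exact: adapted_truncated.
  rewrite IH (pr_incr F_indep S_walk) -mulrA -big_split; congr (_ * _); apply: eq_bigr => i _.
  by rewrite /term /= tN /vec mxE.
by rewrite /pr measure0 (bigD1 i) //= {1}/term /= (negbTE tN) !mul0r mulr0.
Qed.

End TruncatedLaw.

Section BoxedSums.
Variables (R : realType) (F : probability (lattice 4) R) (a : nat -> nat).
Variables (disp : measure_display) (Omega : measurableType disp).
Variables (P : probability Omega R) (S : nat -> {RV P >-> lattice 4}).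
Hypothesis F_indep : mutually_independent F (fun i : 'I_4 => coordinate R i).
Hypothesis S_walk : varying_dimension_walk 2 F a S.
Variable vv : 'I_4 -> R.
Hypothesis F_law : forall i, centered_law (coord_law F i) (vv i).
Implicit Types (i : 'I_4) (j k m r n : nat) (w : Omega) (E : set Omega).
Implicit Types (e : nat -> 'I_4 -> bool) (v : 'I_4 -> int).

Local Notation incr := (incr S).
Local Notation adapted := (adapted S).
Local Notation step_poly := (step_poly F a).
Local Notation tpoly M i := (trunc_poly (coord_law F i) M).

Definition counted_steps e m r i : nat :=
  (\sum_(j < r) (e (m + j) i && active a (m + j).+1 i))%N.

Definition counted_sum e m r i w : int :=
  \sum_(j < r) counted e (m + j) i (coord i (incr (m + j) w)).

Lemma counted_steps_le e m r i : (counted_steps e m r i <= r)%N.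
Proof.
rewrite -[leqRHS]card_ord -sum1_card; apply: leq_sum => j _; exact: leq_b1.
Qed.

Lemma tpoly1_bounds M i : 0 <= (tpoly M i).[1] <= 1.
Proof.
rewrite horner1_trunc_poly (law_mass_le1 (F_law i)) andbT.
by apply: sumr_ge0 => t _; exact: (law_ge0 (F_law i)).
Qed.

Lemma step_poly_counted e M j i : e j i -> active a j.+1 i ->
  step_poly e M j i = tpoly M i.
Proof.
move=> ej aj; apply: eq_bigr => t _; rewrite /step_law aj /counted ej.
by congr (_ *: 'X^ _); rewrite /centered; clear; lia.
Qed.

(** An ignored or motionless coordinate only shifts the code, up to the mass lost
    to the cut-off. *)
Lemma step_poly_uncounted e M j i : ~~ (e j i && active a j.+1 i) ->
  exists2 c, (tpoly M i).[1] <= c <= 1 & step_poly e M j i = c *: 'X^(2 * M).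
Proof.
have /andP[T0 T1] := tpoly1_bounds M i.
rewrite /step_poly /step_law.
case: (boolP (active a j.+1 i)) => aj; rewrite ?andbT => ej.
  exists (tpoly M i).[1]; first by rewrite lexx.
  rewrite horner1_trunc_poly scaler_suml; apply: eq_bigr => t _.
  by rewrite /counted (negbTE ej) addr0.
exists 1; first by rewrite lexx T1.
have MM : (M < (2 * M).+1)%N by clear; lia.
rewrite (bigD1 (Ordinal MM)) //= big1 ?addr0 => [|t tM].
  by rewrite /centered subrr eqxx !scale1r /counted; case: ifP => _; rewrite addr0.
rewrite (_ : (centered M t == 0) = false) ?scale0r //; apply/eqP => ct.
by case/eqP: tM; apply/val_inj => /=; move: ct; rewrite /centered; clear; lia.
Qed.

Lemma prod_step_poly e M m r i : exists2 c, (tpoly M i).[1] ^+ r <= c <= 1 &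
  \prod_(j < r) step_poly e M (m + j) i =
  c *: (tpoly M i ^+ counted_steps e m r i * 'X^(2 * M * (r - counted_steps e m r i))).
Proof.
have /andP[T0 T1] := tpoly1_bounds M i.
elim: r => [|r [c /andP[c0 c1] IH]].
  exists 1; first by rewrite expr0 lexx.
  by rewrite big_ord0 /counted_steps big_ord0 subn0 muln0 !expr0 mulr1 scale1r.
rewrite big_ord_recr /= IH /counted_steps big_ord_recr /= -/(counted_steps e m r i).
have qr := counted_steps_le e m r i.
have c00 : 0 <= c by apply: le_trans c0; rewrite exprn_ge0.
case: (boolP (e (m + r)%N i && active a (m + r).+1 i)) => h.
  exists c.
    by rewrite c1 andbT (le_trans _ c0) // exprS -[leRHS]mul1r ler_wpM2r // exprn_ge0.
  case/andP: h => h1 h2; rewrite step_poly_counted // addn1 exprS subSS.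
  by rewrite -scalerAl mulrAC [_ * tpoly M i]mulrC.
have [c' /andP[c'0 c'1] ->] := step_poly_uncounted M h.
exists (c * c').
  rewrite exprSr ler_pM ?exprn_ge0 //=.
  by rewrite -[leRHS]mulr1 ler_pM // (le_trans T0).
rewrite addn0 -scalerAr -scalerAl scalerA mulrC -mulrA -exprD.
by congr (_ *: (_ * 'X^ _)); rewrite subSn // mulnS addnC.
Qed.

Lemma code_boxed e M m r i w : boxed S M m r w ->
  (code S e M m r i w)%:Z = 2 * (r%:Z * M%:Z + counted_sum e m r i w).
Proof.
elim: r => [|r IH] bw.
  by rewrite /code /counted_sum !big_ord0 mul0r.
rewrite /code /counted_sum !big_ord_recr /= -/(code S e M m r i w) -/(counted_sum e m r i w).
rewrite PoszD IH; last by move=> j jr; apply: bw; rewrite ltnS ltnW.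
have := bw r (ltnSn r) i; move: (coord i _) => x.
rewrite /counted; case: ifP => _; move: (counted_sum e m r i w); clear; nia.
Qed.

Lemma pr_boxed_hit e M m r E v : adapted m E ->
  (forall i, 0 <= r%:Z * M%:Z + v i) ->
  pr P [set w | [/\ E w, boxed S M m r w & forall i, counted_sum e m r i w = v i]] =
  pr P E * \prod_i (\prod_(j < r) step_poly e M (m + j) i)`_(absz (2 * (r%:Z * M%:Z + v i))).
Proof.
move=> aE rv; rewrite -(pr_truncated F_indep S_walk e M r (fun i => absz (2 * (r%:Z * M%:Z + v i))) aE).
congr (pr P _); apply/seteqP; split=> w /= [Ew bw h]; split=> // i.
  by apply/eqP; rewrite -eqz_nat code_boxed // h; have := rv i; clear; move: (_ + _); lia.
have := code_boxed e i bw; rewrite h; have := rv i; clear.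
by move: (counted_sum e m r i w) (r%:Z * M%:Z) (v i) => x y z; lia.
Qed.

(** With no coordinate counted, [pr_boxed_hit] gives the probability of staying
    in the box. *)
Lemma pr_boxed_ge M m r : \prod_i (tpoly M i).[1] ^+ r <= pr P [set w | boxed S M m r w].
Proof.
have aT : adapted m setT by [].
have := @pr_boxed_hit (fun _ _ => false) M m r setT (fun=> 0) aT.
rewrite pr_setT mul1r (_ : [set w | _] = [set w | boxed S M m r w]); last first.
  apply/seteqP; split=> w /= => [[]|h] //; split=> // i.
  by rewrite /counted_sum big1 // => j _; rewrite /counted.
move=> ->; last by move=> i; rewrite addr0.
apply: ler_prod => i _; have [c /andP[c0 c1] ->] := prod_step_poly (fun _ _ => false) M m r i.
have /andP[T0 T1] := tpoly1_bounds M i.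
rewrite exprn_ge0 // andTb addr0 (_ : counted_steps _ _ _ _ = 0%N); last by rewrite /counted_steps big1.
rewrite expr0 mul1r coefZ coefXn subn0.
by rewrite (_ : (_ == _) = true) ?mulr1 //; apply/eqP; clear; nia.
Qed.

Lemma prod_ge_1Bsum (y : 'I_4 -> R) : (forall i, 0 <= y i <= 1) ->
  1 - \sum_i (1 - y i) <= \prod_i y i.
Proof.
move=> hy; elim: (index_enum _) => [|i s IH]; first by rewrite !big_nil subr0.
rewrite !big_cons; have /andP[y0 y1] := hy i.
have p1 : \prod_(j <- s) y j <= 1 by apply: prodr_ile1 => j _; exact: hy.
move: IH p1; move: (\prod_(j <- s) _) (\sum_(j <- s) _) => p t IH p1; nra.
Qed.

Definition total_var : R := \sum_i vv i.

Lemma total_var_ge0 : 0 <= total_var.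
Proof. by apply: sumr_ge0 => i _; exact: (law_var_ge0 (F_law i)). Qed.

Lemma tpoly1_exp_ge M r i : (0 < M)%N -> vv i <= M%:R ->
  1 - r%:R * (vv i / M%:R) <= (tpoly M i).[1] ^+ r.
Proof.
move=> M0 vM; have h := law_mass_ge (F_law i) M0.
have v0 := law_var_ge0 (F_law i).
have M0' : 0 < M%:R :> R by rewrite ltr0n.
have t0 : 0 <= vv i / M%:R by rewrite divr_ge0.
have t1 : vv i / M%:R <= 1 by rewrite ler_pdivrMr // mul1r.
apply: le_trans (bernoulli_ge r t0 t1) _.
by rewrite lerXn2r ?nnegrE ?subr_ge0 // horner1_trunc_poly //; apply: le_trans h; rewrite subr_ge0.
Qed.

Lemma pr_boxed_tail M m r : (0 < M)%N -> total_var <= M%:R ->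
  1 - r%:R * total_var / M%:R <= pr P [set w | boxed S M m r w].
Proof.
move=> M0 tM; apply: le_trans (pr_boxed_ge M m r).
apply: le_trans (prod_ge_1Bsum _) => [|i]; last first.
  by have /andP[T0 T1] := tpoly1_bounds M i; rewrite exprn_ge0 //= exprn_ile1.
rewrite lerD2l lerN2 /total_var -mulrA mulr_suml mulr_sumr; apply: ler_sum => i _.
rewrite lerBlDr -lerBlDl; apply: tpoly1_exp_ge => //; apply: le_trans tM.
rewrite /total_var (bigD1 i) //= lerDl sumr_ge0 // => j _.
exact: (law_var_ge0 (F_law j)).
Qed.

End BoxedSums.

Lemma le_archi (R : realType) (x y K : R) M0 : 0 <= K ->
  (forall M, (M0 <= M)%N -> (0 < M)%N -> x <= y + K / M%:R) -> x <= y.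
Proof.
move=> K0 h; rewrite leNgt; apply/negP => yx.
have xy : 0 < x - y by rewrite subr_gt0.
pose M := (maxn M0 (Num.truncn (K / (x - y))).+1)%N.
have M1 : (0 < M)%N by rewrite /M leq_max orbT.
have := h M (leq_maxl _ _) M1; apply/negP; rewrite -ltNge -ltrBrDl.
rewrite ltr_pdivrMr ?ltr0n // mulrC -ltr_pdivrMr //.
apply: lt_le_trans (Num.Theory.truncnS_gt _) _.
by rewrite ler_nat leq_max leqnn orbT.
Qed.

Section UpperLocalBound.
Variables (R : realType) (F : probability (lattice 4) R) (a : nat -> nat).
Variables (disp : measure_display) (Omega : measurableType disp).
Variables (P : probability Omega R) (S : nat -> {RV P >-> lattice 4}).
Hypothesis F_indep : mutually_independent F (fun i : 'I_4 => coordinate R i).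
Hypothesis S_walk : varying_dimension_walk 2 F a S.
Variable vv : 'I_4 -> R.
Hypothesis F_law : forall i, centered_law (coord_law F i) (vv i).
Implicit Types (i : 'I_4) (j k m r n : nat) (w : Omega) (E : set Omega).
Implicit Types (e : nat -> 'I_4 -> bool) (v : 'I_4 -> int).

Local Notation adapted := (adapted S).
Local Notation steps := (counted_steps a).
Local Notation tv := (total_var vv).

Definition hits e m r v : set Omega := [set w | forall i, counted_sum S e m r i w = v i].

Lemma adapted_hits e m r E v : adapted m E -> adapted (m + r) (E `&` hits e m r v).
Proof.
move=> aE w w' /historyP h [Ew hw]; split.
  by apply: aE Ew; apply/historyP => j jm; apply: h; rewrite ltn_addr.
move=> i; rewrite -hw; apply: eq_bigr => j _.
by rewrite h // ltn_add2l.
Qed.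

Lemma adapted_boxed M m r : adapted (m + r) [set w | boxed S M m r w].
Proof.
move=> w w' /historyP h bw j jr i.
by rewrite -h ?ltn_add2l //; exact: bw.
Qed.

(** The walk leaves the box with probability of order [1 / M], so that bounds
    uniform in [M] hold without the box. *)
Lemma pr_hits_boxed M e m r E v : adapted m E -> (0 < M)%N -> tv <= M%:R ->
  pr P (E `&` hits e m r v) <=
  pr P [set w | [/\ E w, boxed S M m r w & forall i, counted_sum S e m r i w = v i]]
   + r%:R * tv / M%:R.
Proof.
move=> aE M0 tM; set B := [set w | boxed S M m r w].
have aB : adapted (m + r) B := @adapted_boxed M m r.
have mB : measurable B := measurable_adapted aB.
have mE : measurable (E `&` hits e m r v) := measurable_adapted (adapted_hits aE).
have -> : [set w | [/\ E w, boxed S M m r w & forall i, counted_sum S e m r i w = v i]] =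
    (E `&` hits e m r v) `&` B.
  by apply/seteqP; split=> w /= => [[h1 h2 h3]|[[h1 h3] h2]].
have tail := pr_boxed_tail F_indep S_walk F_law m r M0 tM.
have : pr P (~` B) <= 1 - pr P B.
  have := @pr_sum _ _ _ P bool [:: true; false] setT (fun b => if b then B else ~` B).
  rewrite pr_setT !big_cons big_nil addr0 => -> //; first by rewrite addrAC subrr add0r.
    by case=> //; exact: measurableC.
  move=> w; rewrite !big_cons big_nil addr0 !indicE.
  rewrite mem_setT in_setC; by case: (w \in B); rewrite /= ?addr0 ?add0r.
have := @pr_union_le _ _ _ P bool [:: true; false] (E `&` hits e m r v)
  (fun b => if b then (E `&` hits e m r v) `&` B else ~` B) mE.
rewrite !big_cons big_nil addr0 => h1 h2; apply: le_trans (h1 _ _) _.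
- by case; [exact: measurableI|exact: measurableC].
- move=> w hw; have [Bw|nBw] := pselect (B w); first by exists true; rewrite ?inE.
  by exists false; rewrite ?inE.
by rewrite lerD2l; move: h2 tail; lra.
Qed.

(** Each coordinate contributes the one-dimensional bound for its own number of
    effective steps. *)
Lemma pr_hits_le : exists C, 0 < C /\ forall e m r E v, adapted m E ->
  pr P (E `&` hits e m r v) <= pr P E * \prod_i (C / Num.sqrt (steps e m r i).+1%:R).
Proof.
have [C0 hC] := choice (fun i => trunc_poly_exp_le (F_law i)).
have [M0 {}hC] := choice hC.
pose C := \sum_i C0 i.
have CC i : C0 i <= C.
  by rewrite /C (bigD1 i) //= lerDl sumr_ge0 // => j _; apply: ltW; have [] := hC j.
exists C; split; first by apply: lt_le_trans (CC ord0); have [] := hC ord0.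
move=> e m r E v aE; set y := pr P E * _.
have q0 i : 0 <= C / Num.sqrt (steps e m r i).+1%:R.
  by rewrite divr_ge0 ?sqrtr_ge0 // (le_trans _ (CC i)) // ltW //; have [] := hC i.
have y0 : 0 <= y by rewrite mulr_ge0 ?pr_ge0 // prodr_ge0.
have K0 : 0 <= r%:R * tv by rewrite mulr_ge0 // (total_var_ge0 F_law).
apply: (@le_archi _ _ _ _ (\sum_i M0 i + (Num.truncn tv).+1)%N K0) => M MM M1.
have tM : tv <= M%:R.
  apply: le_trans (ltW (Num.Theory.truncnS_gt _)) _; rewrite ler_nat.
  by apply: leq_trans MM; rewrite leq_addl.
apply: le_trans (pr_hits_boxed _ _ _ aE M1 tM) _; rewrite lerD2r.
have [rv|/existsNP[i /negP ri]] := pselect (forall i, 0 <= r%:Z * M%:Z + v i); last first.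
  rewrite (_ : [set w | _] = set0) ?/pr ?measure0 // -subset0 => w /= [_ bw hw].
  by have := code_boxed e i bw; rewrite hw; move: ri; clear; move: (_ + _); lia.
rewrite (pr_boxed_hit F_indep S_walk) // ler_wpM2l ?pr_ge0 //.
apply: ler_prod => i _; have [c /andP[c0 c1] ->] := prod_step_poly a F_law e M m r i.
have /andP[T0 T1] := tpoly1_bounds F_law M i.
have c00 : 0 <= c by apply: le_trans c0; rewrite exprn_ge0.
have ht := nneg_trunc_poly M (law_ge0 (F_law i)).
have htq := nneg_coefsX (steps e m r i) ht.
rewrite coefZ coefMXn; case: ifP => _; first by rewrite mulr0 lexx q0.
rewrite mulr_ge0 //=; apply: le_trans (ler_wpM2r (htq _) c1) _.
rewrite mul1r; have [_ hCi] := hC i.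
apply: le_trans (hCi M _ _ _) _.
  apply: leq_trans MM; apply: leq_trans (leq_addr _ _).
  by rewrite (bigD1 i) //= leq_addr.
by rewrite ler_wpM2r ?invr_ge0 ?sqrtr_ge0.
Qed.

End UpperLocalBound.

Section LowerLocalBound.
Variables (R : realType) (F : probability (lattice 4) R) (a : nat -> nat).
Variables (disp : measure_display) (Omega : measurableType disp).
Variables (P : probability Omega R) (S : nat -> {RV P >-> lattice 4}).
Hypothesis F_indep : mutually_independent F (fun i : 'I_4 => coordinate R i).
Hypothesis S_walk : varying_dimension_walk 2 F a S.
Variable vv : 'I_4 -> R.
Hypothesis F_law : forall i, centered_law (coord_law F i) (vv i).
Implicit Types (i : 'I_4) (j k m r n : nat) (w : Omega) (E : set Omega).
Implicit Types (e : nat -> 'I_4 -> bool) (v : 'I_4 -> int).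

Local Notation adapted := (adapted S).
Local Notation step_poly := (step_poly F a).
Local Notation tpoly M i := (trunc_poly (coord_law F i) M).
Local Notation steps := (counted_steps a).
Local Notation tv := (total_var vv).
Local Notation hits := (hits S).

Let coef_prod_step_poly e M m r i x : 0 <= r%:Z * M%:Z + x ->
  exists2 c, (tpoly M i).[1] ^+ r <= c <= 1 &
  (\prod_(j < r) step_poly e M (m + j) i)`_(absz (2 * (r%:Z * M%:Z + x))) =
  if 0 <= (steps e m r i)%:Z * M%:Z + x
  then c * (tpoly M i ^+ steps e m r i)`_(absz (2 * ((steps e m r i)%:Z * M%:Z + x)))
  else 0.
Proof.
move=> rx; have [c hc ->] := prod_step_poly a F_law e M m r i.
exists c => //; have qr := counted_steps_le a e m r i.
move: (steps e m r i) qr rx => q qr rx.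
rewrite coefZ coefMXn.
have E1 : (2 * M * (r - q))%N%:Z = 2 * (r%:Z * M%:Z - q%:Z * M%:Z).
  by rewrite !PoszM -subzn //; ring.
have -> : (absz (2 * (r%:Z * M%:Z + x))%R < 2 * M * (r - q))%N = ~~ (0 <= q%:Z * M%:Z + x).
  move: (2 * M * (r - q))%N E1 rx => n; move: (r%:Z * M%:Z)%R (q%:Z * M%:Z)%R => y z; clear; lia.
case: (boolP (0 <= _)) => qx /=; rewrite ?mulr0 //; congr (c * nth _ _ _).
move: (2 * M * (r - q))%N E1 rx qx => n; move: (r%:Z * M%:Z)%R (q%:Z * M%:Z)%R => y z; clear; lia.
Qed.

(** [Lam] is a common multiple of the block lengths of the four coordinates. At
    multiples of it, the reachable displacements lie in the lattice of the [hh i],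
    and each point of this lattice is eventually reached at the expected rate. *)
Lemma pr_hits_ge : exists Lam (hh : 'I_4 -> nat) (c : R),
  [/\ (0 < Lam)%N, (forall i, 0 < hh i)%N, 0 < c,
   (forall e m r E v, adapted m E -> (forall i, Lam %| steps e m r i)%N ->
     0 < pr P (E `&` hits e m r v) -> forall i, (hh i %| v i)%Z) &
   (forall v, (forall i, (hh i %| v i)%Z) -> exists k0, forall e m r E,
     adapted m E -> (0 < r)%N ->
     (forall i, (Lam %| steps e m r i)%N && (k0 <= steps e m r i)%N \/
        steps e m r i = 0%N /\ v i = 0) ->
     pr P E * \prod_i (c / Num.sqrt (steps e m r i).+1%:R) <= pr P (E `&` hits e m r v))].
Proof.
have [LL hL] := choice (fun i => trunc_poly_exp_ge (F_law i)).
have [hh {}hL] := choice hL; have [cc {}hL] := choice hL.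
pose Lam := (\prod_i LL i)%N.
have L0 i : (0 < LL i)%N by have [[]] := hL i.
have Ldvd i : (LL i %| Lam)%N by rewrite /Lam (bigD1 i) //= dvdn_mulr.
have c0 i : 0 < cc i by have [] := hL i.
pose s := \sum_i (cc i)^-1 + 1.
have s1 : 1 <= s by rewrite /s lerDr sumr_ge0 // => i _; rewrite invr_ge0 ltW.
have s0 : 0 < s by apply: lt_le_trans s1.
pose c := s^-1 / 2.
have c_le1 : c <= 1 / 2.
  by rewrite /c ler_wpM2r // invf_le1.
have c_le i : c <= cc i / 2.
  rewrite /c ler_wpM2r // -[leRHS]invrK lef_pV2 ?posrE ?invr_gt0 //.
  rewrite /s (bigD1 i) //= -addrA lerDl addr_ge0 // sumr_ge0 // => j _.
  by rewrite invr_ge0 ltW.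
exists Lam, hh, c; split.
- by rewrite /Lam prodn_gt0.
- by move=> i; have [_] := hL i.
- by rewrite /c divr_gt0 // invr_gt0.
- move=> e m r E v aE Lq pos i; apply: contrapT => nhv.
  suff : pr P (E `&` hits e m r v) <= 0 by rewrite leNgt pos.
  have K0 : 0 <= r%:R * tv by rewrite mulr_ge0 // (total_var_ge0 F_law).
  apply: (@le_archi _ _ _ _ (Num.truncn tv).+1 K0) => M MM M1.
  have tM : tv <= M%:R.
    by apply: le_trans (ltW (Num.Theory.truncnS_gt _)) _; rewrite ler_nat.
  apply: le_trans (pr_hits_boxed F_indep S_walk F_law _ _ _ aE M1 tM) _; rewrite lerD2r.
  have [rv|/existsNP[i' /negP ri]] := pselect (forall i, 0 <= r%:Z * M%:Z + v i); last first.
    rewrite (_ : [set w | _] = set0) ?/pr ?measure0 // -subset0 => w /= [_ bw hw].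
    by have := code_boxed e i' bw; rewrite hw; move: ri; clear; move: (_ + _); lia.
  rewrite (pr_boxed_hit F_indep S_walk) // (bigD1 i) //=.
  have [c' _ ->] := coef_prod_step_poly e m i (rv i).
  rewrite (_ : (if _ then _ else _) = 0) ?mul0r ?mulr0 //.
  case: ifP => // qx; have [[_ hLi] h0 _ lat _] := hL i.
  have [k qk] := dvdnP (dvdn_trans (Ldvd i) (Lq i)).
  have [->|/eqP] := eqVneq ((tpoly M i ^+ steps e m r i)`_
    (absz (2 * ((steps e m r i)%:Z * M%:Z + v i)))) 0; first by rewrite mulr0.
  move=> /eqP; rewrite {1}qk mulnC => /lat d2; exfalso; apply: nhv.
  have [l Ll] := dvdnP hLi.
  have : ((2 * hh i)%N %| 2 * ((steps e m r i)%:Z * M%:Z + v i))%Z by rewrite dvdzE.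
  move=> /dvdzP[u hu]; apply/dvdzP; exists (u - k%:Z * l%:Z * M%:Z).
  have : (steps e m r i)%:Z * M%:Z + v i = u * (hh i)%:Z.
    by apply: (@mulfI _ 2) => //; rewrite hu PoszM; ring.
  by rewrite qk Ll !PoszM => hX; rewrite mulrBl -hX; ring.
move=> v hv.
have [k0 hk0] := choice (fun i => let: And5 _ _ _ _ low := hL i in low (v i) (hv i)).
exists (\sum_i LL i * k0 i).+1%N => e m r E aE r0 hq.
have K0 : 0 <= 0 :> R by [].
have exM i : exists M0, forall M, (M0 <= M)%N ->
    0 <= (steps e m r i)%:Z * M%:Z + v i /\
    2 * (c / Num.sqrt (steps e m r i).+1%:R) <=
    (tpoly M i ^+ steps e m r i)`_(absz (2 * ((steps e m r i)%:Z * M%:Z + v i))).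
  have [/andP[Lq kq]|[q0 v0]] := hq i; last first.
    exists 0%N => M _; rewrite q0 v0 mul0r addr0 mulr0 expr0 coef1 eqxx sqrtr1 divr1.
    by split=> //; rewrite [true%:R]mulr1n; move: c_le1; lra.
  have [k qk] := dvdnP (dvdn_trans (Ldvd i) Lq).
  have kk : (k0 i <= k)%N.
    rewrite -(leq_pmul2l (L0 i)) [leqRHS]mulnC -qk; apply: leq_trans (ltnW kq).
    by rewrite (bigD1 i) //= leq_addr.
  have q1 : (0 < steps e m r i)%N by apply: leq_trans kq.
  have k1 : (0 < k)%N by move: q1; rewrite qk; case: (k).
  have kq1 : (k <= (steps e m r i).+1)%N by rewrite qk ltnW // ltnS leq_pmulr.
  have [M0 hM0] := hk0 i k kk.
  exists (maxn M0 (absz (v i))) => M; rewrite geq_max => /andP[MM0 Mv].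
  have qv : 0 <= (steps e m r i)%:Z * M%:Z + v i.
    by have := leq_pmull M q1; rewrite -lez_nat PoszM; move: (_ * _) => y; move: Mv; clear; lia.
  split=> //.
  have low := hM0 M (absz (2 * ((steps e m r i)%:Z * M%:Z + v i))) MM0.
  rewrite [(LL i * k)%N]mulnC -qk in low.
  apply: le_trans (low _); last by rewrite PoszM gez0_abs // mulr_ge0.
  rewrite mulrA; apply: le_trans (_ : cc i / Num.sqrt (steps e m r i).+1%:R <= _).
    by rewrite ler_wpM2r ?invr_ge0 ?sqrtr_ge0 // mulrC -ler_pdivlMr.
  rewrite ler_wpM2l ?(ltW (c0 i)) // lef_pV2 ?posrE ?sqrtr_gt0 ?ltr0n //.
  by rewrite ler_wsqrtr // ler_nat.
have [M0 hM0] := choice exM.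
pose M := (\sum_i M0 i + \sum_i absz (v i) + (Num.truncn (tv + 2 * r%:R * tv)).+1)%N.
have M1 : (0 < M)%N by rewrite /M addnS.
have MR : tv + 2 * r%:R * tv <= M%:R.
  by apply: le_trans (ltW (Num.Theory.truncnS_gt _)) _; rewrite ler_nat leq_addl.
have tv0 := total_var_ge0 F_law.
have rt0 : 0 <= 2 * r%:R * tv by rewrite !mulr_ge0.
have M0M i : (M0 i <= M)%N.
  by rewrite /M -addnA; apply: leq_trans (leq_addr _ _); rewrite (bigD1 i) //= leq_addr.
have vM i : (absz (v i) <= M)%N.
  rewrite /M addnAC; apply: leq_trans (leq_addl _ _).
  by rewrite (bigD1 i) //= leq_addr.
have rv i : 0 <= r%:Z * M%:Z + v i.
  have := leq_pmull M r0; rewrite -lez_nat PoszM; have := vM i.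
  by move: (r%:Z * M%:Z) => y; clear; lia.
apply: le_trans (_ : pr P [set w | [/\ E w, boxed S M m r w &
    forall i, counted_sum S e m r i w = v i]] <= _); last first.
  apply: le_pr.
  - rewrite (_ : [set w | _] = (E `&` hits e m r v) `&` [set w | boxed S M m r w]).
      apply: measurableI; first exact: measurable_adapted (adapted_hits aE).
      exact: measurable_adapted (@adapted_boxed _ _ _ P S M m r).
    by apply/seteqP; split=> w /= => [[h1 h2 h3]|[[h1 h3] h2]].
  - exact: measurable_adapted (adapted_hits aE).
  - by move=> w /= [].
rewrite (pr_boxed_hit F_indep S_walk) // ler_wpM2l ?pr_ge0 //.
apply: ler_prod => i _; rewrite divr_ge0 ?sqrtr_ge0 //=; last by rewrite /c divr_ge0 ?invr_ge0 // ltW.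
have [c' /andP[c'0 _] ->] := coef_prod_step_poly e m i (rv i).
have [qv hq2] := hM0 i M (M0M i); rewrite qv.
have vvM : vv i <= M%:R.
  apply: le_trans MR; rewrite -[leLHS]addr0; apply: lerD => //.
  rewrite /total_var (bigD1 i) //= lerDl sumr_ge0 // => j _.
  exact: (law_var_ge0 (F_law j)).
have vtv : vv i <= tv.
  rewrite /total_var (bigD1 i) //= lerDl sumr_ge0 // => j _.
  exact: (law_var_ge0 (F_law j)).
have half : 1 / 2 <= c'.
  apply: le_trans c'0; apply: le_trans (tpoly1_exp_ge F_law r M1 vvM).
  have : r%:R * (vv i / M%:R) <= 1 / 2.
    rewrite mulrA ler_pdivrMr ?ltr0n //.
    have : r%:R * vv i <= r%:R * tv by rewrite ler_wpM2l.
    lra.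
  lra.
have t0 : 0 <= 2 * (c / Num.sqrt (steps e m r i).+1%:R).
  by rewrite mulr_ge0 // divr_ge0 ?sqrtr_ge0 // /c divr_ge0 ?invr_ge0 // ltW.
have half0 : 0 <= 1 / 2 :> R by [].
apply: le_trans (ler_pM half0 t0 half hq2).
by move: (c / Num.sqrt _) => z; lra.
Qed.

End LowerLocalBound.

Section SpecialCount.
Variable a : nat -> nat.
Hypothesis a_pos : forall n, (1 <= n)%N -> (0 < a n)%N.
Hypothesis a_incr : forall n, (1 <= n)%N -> (a n < a n.+1)%N.

Definition special k : bool := `[< special_times a k >].

Definition nspecial k : nat := (\sum_(j < k) special j.+1)%N.

Lemma nspecialS k : nspecial k.+1 = (nspecial k + special k.+1)%N.
Proof. by rewrite /nspecial big_ord_recr. Qed.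

Lemma times_le m n : (1 <= m)%N -> (m <= n)%N -> (a m <= a n)%N.
Proof.
move=> m1; elim: n => [|n IH]; first by rewrite leqn0 => /eqP m0; move: m1; rewrite m0.
rewrite leq_eqVlt => /orP[/eqP -> //|]; rewrite ltnS => mn.
by apply: leq_trans (IH mn) (ltnW _); apply: a_incr; exact: leq_trans m1 mn.
Qed.

Lemma times_lt m n : (1 <= m)%N -> (m < n)%N -> (a m < a n)%N.
Proof. by move=> m1 mn; apply: leq_trans (a_incr m1) _; exact: times_le. Qed.

Lemma le_times n : (1 <= n)%N -> (n <= a n)%N.
Proof.
elim: n => // -[_ _|n IH _]; first exact: a_pos.
by apply: leq_ltn_trans (IH isT) _; exact: a_incr.
Qed.

Lemma nspecial_geP n k : (1 <= n)%N -> (n <= nspecial k)%N = (a n <= k)%N.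
Proof.
elim: k n => [|k IH] n n1.
  by rewrite /nspecial big_ord0 !leqn0 !gtn_eqF // a_pos.
rewrite nspecialS /special; case: asboolP => [[n0 /= n01 an0]|nsp].
  have n0E : n0 = (nspecial k).+1.
    apply/eqP; rewrite eqn_leq; apply/andP; split; last first.
      by rewrite ltnNge IH // an0 ltnn.
    case: n0 n01 an0 => // -[//|n0] _ an0; rewrite ltnS IH // -ltnS -an0.
    exact: a_incr.
  rewrite addn1 -n0E -an0; apply/idP/idP; first exact: times_le.
  by apply: contraTT; rewrite -!ltnNge; exact: times_lt.
rewrite addn0 IH // [RHS]leq_eqVlt ltnS; case: eqP => // ank.
by case: nsp; exists n.
Qed.

Lemma nspecialE n k : (1 <= n)%N -> (a n <= k)%N -> (k < a n.+1)%N -> nspecial k = n.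
Proof.
move=> n1 h1 h2; apply/eqP; rewrite eqn_leq nspecial_geP // h1 andbT.
by rewrite -ltnS ltnNge nspecial_geP // -ltnNge.
Qed.

End SpecialCount.

Section WalkBounds.
Variables (R : realType) (F : probability (lattice 4) R) (a : nat -> nat).
Variables (disp : measure_display) (Omega : measurableType disp).
Variables (P : probability Omega R) (S : nat -> {RV P >-> lattice 4}).
Hypothesis F_indep : mutually_independent F (fun i : 'I_4 => coordinate R i).
Hypothesis S_walk : varying_dimension_walk 2 F a S.
Hypothesis F_law : forall i : 'I_4, exists u : R, centered_law (coord_law F i) u.
Implicit Types (i : 'I_4) (j k m r n : nat) (w : Omega) (E : set Omega).
Implicit Types (e : nat -> 'I_4 -> bool) (v : 'I_4 -> int).

Local Notation adapted := (adapted S).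
Local Notation steps := (counted_steps a).
Local Notation hits := (hits S).
Local Notation nspecial := (nspecial a).

Definition displaced m r v : set Omega :=
  [set w | forall i, coord i (S (m + r)%N w) - coord i (S m w) = v i].

Definition planar_return m r : set Omega :=
  [set w | forall i, (i < 2)%N -> coord i (S (m + r)%N w) = coord i (S m w)].

Let e_all : nat -> 'I_4 -> bool := fun _ _ => true.
Let e_plane : nat -> 'I_4 -> bool := fun _ i => (i < 2)%N.
Let e_mixed k : nat -> 'I_4 -> bool := fun j i => (i < 2)%N || (j < k)%N.

Lemma displacedE m r v : displaced m r v = hits e_all m r v.
Proof.
by apply/seteqP; split=> w h i; move: (h i); rewrite (walk_coord_diff S_walk) /counted_sum.
Qed.

Let steps_low e m r i : (forall j, e j i) -> (i < 2)%N -> steps e m r i = r.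
Proof.
move=> he i2; rewrite /counted_steps -[RHS]card_ord -sum1_card.
by apply: eq_bigr => j _; rewrite he /active i2.
Qed.

Let steps_high m r i : (2 <= i)%N -> steps e_all m r i = (nspecial (m + r) - nspecial m)%N.
Proof.
move=> i2; rewrite /nspecial big_split_ord /= addKn; apply: eq_bigr => j _.
by rewrite /active ltnNge i2.
Qed.

Let prod4 (f : 'I_4 -> R) (x y : R) : (forall i, (i < 2)%N -> f i = x) ->
  (forall i, (2 <= i)%N -> f i = y) -> \prod_i f i = x ^+ 2 * y ^+ 2.
Proof.
move=> fx fy; rewrite !big_ord_recl big_ord0.
rewrite (fx ord0) // (fx (lift ord0 ord0)) // !fy //; ring.
Qed.

Let sq_bound (C : R) n : (C / Num.sqrt n.+1%:R) ^+ 2 = C ^+ 2 / n.+1%:R.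
Proof. by rewrite exprMn exprVn sqr_sqrtr. Qed.

Lemma pr_displaced_le : exists C : R, 0 < C /\ forall m r E v, adapted m E ->
  pr P (E `&` displaced m r v) <= pr P E * (C / (r.+1%:R * (nspecial (m + r) - nspecial m).+1%:R)).
Proof.
have [vv hvv] := choice F_law.
have [C [C0 hC]] := pr_hits_le F_indep S_walk hvv.
exists (C ^+ 2 * C ^+ 2); split; first by rewrite mulr_gt0 ?exprn_gt0.
move=> m r E v aE; rewrite displacedE; apply: le_trans (hC e_all m r E v aE) _.
rewrite ler_wpM2l ?pr_ge0 //.
rewrite (@prod4 _ (C / Num.sqrt r.+1%:R) (C / Num.sqrt (nspecial (m + r) - nspecial m).+1%:R)).
- by rewrite !sq_bound invfM mulrACA.
- by move=> i i2; rewrite steps_low.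
- by move=> i i2; rewrite steps_high.
Qed.

(** With the plane read at the time [l] and the other coordinates at an earlier
    time [k], the latter only feel the special times up to [k]. *)
Lemma pr_mixed_le : exists C : R, 0 < C /\ forall k l, (k <= l)%N ->
  pr P [set w | forall i, coord i (S (if (i < 2)%N then l else k) w) = 0] <=
  C / (l.+1%:R * (nspecial k).+1%:R).
Proof.
have [vv hvv] := choice F_law.
have [C [C0 hC]] := pr_hits_le F_indep S_walk hvv.
exists (C ^+ 2 * C ^+ 2); split; first by rewrite mulr_gt0 ?exprn_gt0.
move=> k l kl.
have aT : adapted 0 setT by [].
have := hC (e_mixed k) 0%N l setT (fun=> 0) aT; rewrite setTI pr_setT mul1r.
rewrite (_ : hits _ _ _ _ = [set w | forall i, coord i (S (if (i < 2)%N then l else k) w) = 0]).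
  move=> /le_trans; apply.
  rewrite (@prod4 _ (C / Num.sqrt l.+1%:R) (C / Num.sqrt (nspecial k).+1%:R)).
  - by rewrite !sq_bound invfM mulrACA.
  - by move=> i i2; rewrite steps_low // => j; rewrite /e_mixed i2.
  - move=> i i2; rewrite (_ : steps _ _ _ _ = nspecial k) //.
    rewrite /counted_steps -(subnKC kl) big_split_ord /= [X in (_ + X)%N]big1 ?addn0 => [|j _].
      by apply: eq_bigr => j _; rewrite /e_mixed /active ltnNge i2 /= ltn_ord.
    by rewrite /e_mixed ltnNge i2 /= add0n ltnNge leq_addr.
have S0 w i : coord i (S 0%N w) = 0 by rewrite (walk_start S_walk) /coord mxE.
have cS n w i : coord i (S n w) = \sum_(j < n) coord i (incr S j w).
  by have := walk_coord_diff S_walk 0 n w i; rewrite add0n S0 subr0.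
have sumE w i : counted_sum S (e_mixed k) 0 l i w = coord i (S (if (i < 2)%N then l else k) w).
  rewrite cS /counted_sum /counted /e_mixed; case: ltnP => i2.
    by apply: eq_bigr => j _; rewrite add0n.
  rewrite -(subnKC kl) big_split_ord /= [X in _ + X]big1 ?addr0 => [|j _].
    by apply: eq_bigr => j _; rewrite !add0n ltn_ord.
  by rewrite add0n ltnNge leq_addr.
by apply/seteqP; split=> w h i; move: (h i); rewrite /= sumE.
Qed.

(** The divisibility in the first property is the hypothesis of the second one,
    for the displacement that leads back to the origin. *)
Lemma walk_lower_bounds : exists Lam (hh : 'I_4 -> nat) (c : R),
  [/\ (0 < Lam)%N, 0 < c,
   (forall m, (Lam %| m)%N -> (Lam %| nspecial m)%N -> forall v : lattice 4,
      0 < pr P [set w | S m w = v] -> forall i, (hh i %| coord i v)%Z),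
   (forall v, (forall i, (hh i %| v i)%Z) -> exists k0, forall m r E, adapted m E ->
      (Lam %| r)%N -> (k0 <= r)%N -> (Lam %| nspecial (m + r) - nspecial m)%N ->
      (k0 <= nspecial (m + r) - nspecial m)%N ->
      pr P E * (c / (r.+1%:R * (nspecial (m + r) - nspecial m).+1%:R)) <= pr P (E `&` displaced m r v)) &
   (exists k0, forall m r E, adapted m E -> (Lam %| r)%N -> (k0 <= r)%N ->
      pr P E * (c / r.+1%:R) <= pr P (E `&` planar_return m r))].
Proof.
have [vv hvv] := choice F_law.
have [Lam [hh [c [Lam0 hh0 c0 lat low]]]] := pr_hits_ge F_indep S_walk hvv.
exists Lam, hh, (Num.min (c ^+ 2) (c ^+ 2 * c ^+ 2)).
have cc1 : Num.min (c ^+ 2) (c ^+ 2 * c ^+ 2) <= c ^+ 2 by rewrite ge_min lexx.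
have cc2 : Num.min (c ^+ 2) (c ^+ 2 * c ^+ 2) <= c ^+ 2 * c ^+ 2 by rewrite ge_min lexx orbT.
split=> //.
- by rewrite lt_min !mulr_gt0 ?exprn_gt0.
- move=> m Lm Lc v pos; have aT : adapted 0 setT by [].
  apply: (lat e_all 0%N m setT (fun i => coord i v) aT).
    move=> i; case: (ltnP i 2) => i2; first by rewrite steps_low.
    by rewrite steps_high // add0n {2}/nspecial big_ord0 subn0.
  rewrite setTI -displacedE (_ : displaced _ _ _ = [set w | S m w = v]) //.
  apply/seteqP; split=> w; rewrite /displaced /= add0n => h.
    apply/rowP => i; have := h i; rewrite (walk_start S_walk).
    by rewrite /coord mxE subr0.
  by move=> i; rewrite h (walk_start S_walk) /coord mxE subr0.
- move=> v hv; have [k0 hk0] := low v hv.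
  exists k0.+1 => m r E aE Lr kr Lq kq; rewrite displacedE.
  apply: le_trans (hk0 e_all m r E aE _ _); last first.
  + move=> i; left; case: (ltnP i 2) => i2; first by rewrite steps_low // Lr ltnW.
    by rewrite steps_high // Lq ltnW.
  + exact: leq_ltn_trans kr.
  rewrite ler_wpM2l ?pr_ge0 //.
  rewrite (@prod4 _ (c / Num.sqrt r.+1%:R) (c / Num.sqrt (nspecial (m + r) - nspecial m).+1%:R)).
  + by rewrite !sq_bound invfM [leRHS]mulrACA ler_wpM2r // mulr_ge0 ?invr_ge0.
  + by move=> i i2; rewrite steps_low.
  + by move=> i i2; rewrite steps_high.
have h0 i : (hh i %| 0)%Z by exact: dvdz0.
have [k0 hk0] := low (fun=> 0) h0.
exists k0.+1 => m r E aE Lr kr.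
have steps0 i : (2 <= i)%N -> steps e_plane m r i = 0%N.
  by move=> i2; rewrite /counted_steps big1 // => j _; rewrite /e_plane ltnNge i2.
have -> : planar_return m r = hits e_plane m r (fun=> 0).
  apply/seteqP; split=> w h i.
    rewrite /counted_sum /counted /e_plane; case: ltnP => i2; last by rewrite big1.
    by rewrite -(walk_coord_diff S_walk) h // subrr.
  move=> i2; have := h i; rewrite /counted_sum /counted /e_plane i2.
  by rewrite -(walk_coord_diff S_walk) => /eqP; rewrite subr_eq0 => /eqP.
apply: le_trans (hk0 e_plane m r E aE _ _); last first.
+ move=> i; case: (ltnP i 2) => i2; last by right; rewrite steps0.
  by left; rewrite steps_low // Lr ltnW.
+ exact: leq_ltn_trans kr.
rewrite ler_wpM2l ?pr_ge0 //.
rewrite (@prod4 _ (c / Num.sqrt r.+1%:R) c).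
+ by rewrite sq_bound [leRHS]mulrAC ler_wpM2r // invr_ge0.
+ by move=> i i2; rewrite steps_low.
+ by move=> i i2; rewrite steps0 // sqrtr1 divr1.
Qed.

End WalkBounds.

(** * Sums and series *)

Section RealSums.
Variable R : realType.
Implicit Types (m n l N : nat) (f : nat -> R).

Lemma inv_le_ln_diff l : (0 < l)%N -> l.+1%:R^-1 <= ln l.+1%:R - ln l%:R :> R.
Proof.
move=> l0; have l0R : 0 < l%:R :> R by rewrite ltr0n.
have l1R : 0 < l.+1%:R :> R by rewrite ltr0n.
rewrite -[ln l.+1%:R]opprK -opprD addrC -ln_div ?posrE //.
rewrite lerNr; apply: le_trans (_ : ln (1 + (- l.+1%:R^-1)) <= _).
  rewrite ler_ln ?posrE ?divr_gt0 ?subr_gt0 ?invf_lt1 ?ltr1n ?ltnS //.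
  by rewrite ler_pdivrMr // mulrDl mul1r mulNr mulVf ?gt_eqF // -natr1; lra.
by apply: le_ln1Dx; rewrite ltrN2 invf_lt1 // ltr1n.
Qed.

Lemma ln_diff_le_inv l : (0 < l)%N -> ln l.+1%:R - ln l%:R <= l%:R^-1 :> R.
Proof.
move=> l0; have l0R : 0 < l%:R :> R by rewrite ltr0n.
rewrite -ln_div ?posrE ?ltr0n // (_ : _ / _ = 1 + l%:R^-1); last first.
  by rewrite -nat1r mulrDl mul1r divff ?gt_eqF // addrC.
by apply: le_ln1Dx; apply: lt_trans (_ : 0 < _); rewrite ?ltrN10 ?invr_gt0.
Qed.

Lemma telescope_nat f m n : (m <= n)%N ->
  \sum_(m <= l < n) (f l.+1 - f l) = f n - f m.
Proof.
move=> mn; rewrite -(subnKC mn); elim: (n - m)%N => [|k IH].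
  by rewrite addn0 big_geq ?subrr.
by rewrite addnS big_nat_recr ?leq_addr //= IH; ring.
Qed.

Lemma harmonic_le m n : (0 < m)%N -> (m <= n)%N ->
  \sum_(m <= l < n) l.+1%:R^-1 <= ln n%:R - ln m%:R :> R.
Proof.
move=> m0 mn; rewrite -(telescope_nat (fun l => ln l%:R) mn).
apply: ler_sum_nat => l /andP[ml _]; apply: inv_le_ln_diff.
exact: leq_trans m0 ml.
Qed.

Lemma harmonic_ge m n : (m <= n)%N ->
  ln n.+1%:R - ln m.+1%:R <= \sum_(m <= l < n) l.+1%:R^-1 :> R.
Proof.
move=> mn; rewrite -(telescope_nat (fun l => ln l.+1%:R) mn).
by apply: ler_sum_nat => l _; exact: ln_diff_le_inv.
Qed.

Lemma series_lt_pinfty f N0 B : (forall n, 0 <= f n) ->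
  (forall N, \sum_(N0 <= n < N) f n <= B) -> (\sum_(N0 <= n <oo) (f n)%:E < +oo)%E.
Proof.
move=> f0 hB; apply: le_lt_trans (_ : (_ <= B%:E)%E) _; last exact: ltry.
apply: lime_le; first by apply: is_cvg_nneseries => n _ _; rewrite lee_fin.
by apply: nearW => N; rewrite sumEFin lee_fin.
Qed.

Lemma series_lt_pinfty_bounded f N0 : (forall n, 0 <= f n) ->
  (\sum_(N0 <= n <oo) (f n)%:E < +oo)%E -> exists B, forall N, \sum_(N0 <= n < N) f n <= B.
Proof.
move=> f0 hlt; set s := (X in (X < _)%E) in hlt.
have s_fin : s \is a fin_num.
  rewrite ge0_fin_numE // /s; apply: nneseries_ge0 => n _ _; by rewrite lee_fin.
exists (fine s) => N; rewrite -lee_fin fineK // -sumEFin.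
by apply: nneseries_lim_ge => n _ _; rewrite lee_fin.
Qed.

Lemma series_pinfty_unbounded f N0 : (forall n, 0 <= f n) ->
  (\sum_(N0 <= n <oo) (f n)%:E = +oo)%E -> forall B, exists N, B <= \sum_(N0 <= n < N) f n.
Proof.
move=> f0 hinf B; apply: contrapT => h.
have : (\sum_(N0 <= n <oo) (f n)%:E < +oo)%E.
  apply: (@series_lt_pinfty f N0 B f0) => N; rewrite leNgt; apply/negP => lt.
  by apply: h; exists N; exact: ltW.
by rewrite hinf ltxx.
Qed.

(** Comparison with the telescoping differences of twice the inverse square root. *)
Lemma sum_inv_n_sqrt_n N : \sum_(1 <= n < N) (n%:R * Num.sqrt n%:R)^-1 <= 3 :> R.
Proof.
case: N => [|[|N]]; [by rewrite big_geq|by rewrite big_geq|].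
rewrite big_ltn // (@big_addn _ _ _ 1 _ 1) subn1 /=.
have step n : (0 < n)%N -> (n.+1%:R * Num.sqrt n.+1%:R)^-1 <=
    (- (2 / Num.sqrt n.+1%:R)) - (- (2 / Num.sqrt n%:R)) :> R.
  move=> n0; set s := Num.sqrt n.+1%:R; set t := Num.sqrt n%:R.
  have t0 : 0 < t by rewrite sqrtr_gt0 ltr0n.
  have s0 : 0 < s by rewrite sqrtr_gt0 ltr0n.
  have ts : t <= s by rewrite ler_wsqrtr // ler_nat.
  have s2 : s ^+ 2 = n.+1%:R by rewrite sqr_sqrtr.
  have t2 : t ^+ 2 = n%:R by rewrite sqr_sqrtr.
  have st : s ^+ 2 - t ^+ 2 = 1 by rewrite s2 t2 -nat1r addrK.
  rewrite -s2 opprK addrC -[leLHS]mul1r ler_pdivrMr ?mulr_gt0 ?exprn_gt0 //.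
  have -> : (2 / t - 2 / s) * (s ^+ 2 * s) = 2 * (s - t) * s ^+ 2 / t.
    by field; rewrite !gt_eqF.
  rewrite ler_pdivlMr // mul1r.
  have : (s - t) * (2 * s) >= 1 by nra.
  have : 0 <= s - t by rewrite subr_ge0.
  nra.
apply: le_trans (_ : 1 + \sum_(1 <= n < N.+1)
    (- (2 / Num.sqrt n.+1%:R) - - (2 / Num.sqrt n%:R)) <= _).
  apply: lerD; first by rewrite mul1r sqrtr1 invr1.
  apply: ler_sum_nat => n /andP[n1 _]; rewrite addn1; exact: step.
rewrite (telescope_nat (fun n => - (2 / Num.sqrt n%:R))) //.
rewrite sqrtr1 divr1 opprK; have : 0 <= 2 / Num.sqrt N.+1%:R :> R by rewrite divr_ge0 ?sqrtr_ge0.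
lra.
Qed.

(** Either [x] is at most the inverse square root of [n], or [1 / n] is at most
    [x ^ 2]. *)
Lemma min_split (x : R) n : 0 <= x -> (0 < n)%N ->
  x / n%:R <= x ^+ 3 + (n%:R * Num.sqrt n%:R)^-1.
Proof.
move=> x0 n0; set s := Num.sqrt n%:R.
have s0 : 0 < s by rewrite sqrtr_gt0 ltr0n.
have s2 : s ^+ 2 = n%:R by rewrite sqr_sqrtr.
rewrite -s2; have [xs|xs] := leP x s^-1.
  apply: le_trans (_ : 0 + (s ^+ 2 * s)^-1 <= _); last by rewrite lerD2r exprn_ge0.
  by rewrite add0r (invfM (s ^+ 2)) [leRHS]mulrC ler_wpM2r // invr_ge0 exprn_ge0 // ltW.
apply: le_trans (_ : x ^+ 3 + 0 <= _); last by rewrite lerD2l invr_ge0 mulr_ge0 ?exprn_ge0 // ltW.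
rewrite addr0 (exprS x 2) -exprVn ler_wpM2l // lerXn2r ?nnegrE ?invr_ge0 ?(ltW s0) ?(ltW xs) //.
Qed.

End RealSums.

Lemma ler_sum_subset (R : realType) (I : eqType) (s t : seq I) (f : I -> R) :
  (forall i, 0 <= f i) -> uniq s -> uniq t -> {subset s <= t} ->
  \sum_(i <- s) f i <= \sum_(i <- t) f i.
Proof.
move=> f0 us ut st; rewrite [leRHS](bigID (mem s)) /= -[X in _ <= X + _]big_filter.
have hp : perm_eq [seq i <- t | i \in s] s.
  apply: uniq_perm => // [|i]; first exact: filter_uniq.
  by rewrite mem_filter; apply: andb_idr; exact: st.
by rewrite (perm_big _ hp) lerDl sumr_ge0.
Qed.

Lemma sum_symmetric (R : realType) (s : seq nat) (T : nat -> nat -> R) :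
  (forall x y, T x y = T y x) ->
  \sum_(x <- s) \sum_(y <- s) T x y =
  \sum_(x <- s) \sum_(y <- s | y == x) T x y + 2 * \sum_(x <- s) \sum_(y <- s | (x < y)%N) T x y.
Proof.
move=> sym.
have E x : \sum_(y <- s) T x y = \sum_(y <- s | y == x) T x y +
    (\sum_(y <- s | (x < y)%N) T x y + \sum_(y <- s | (y < x)%N) T x y).
  rewrite (bigID (fun y => y == x)) /=; congr (_ + _).
  rewrite (bigID (fun y => (x < y)%N)) /=; congr (_ + _); apply: eq_bigl => y; case: ltngtP => //.
under eq_bigr do rewrite E.
rewrite !big_split /=; congr (_ + _).
have -> : \sum_(x <- s) \sum_(y <- s | (y < x)%N) T x y = \sum_(x <- s) \sum_(y <- s | (x < y)%N) T x y.
  rewrite (exchange_big_dep predT) //=; apply: eq_bigr => x _; by apply: eq_bigr => y _.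
by ring.
Qed.

Lemma sum_symmetric_le (R : realType) (s : seq nat) (T : nat -> nat -> R) :
  (forall x y, T x y = T y x) -> (forall x y, 0 <= T x y) ->
  \sum_(x <- s) \sum_(y <- s) T x y <= 2 * \sum_(x <- s) \sum_(y <- s | (x <= y)%N) T x y.
Proof.
move=> sym T0; rewrite sum_symmetric //.
have -> : \sum_(x <- s) \sum_(y <- s | (x <= y)%N) T x y =
    \sum_(x <- s) \sum_(y <- s | y == x) T x y + \sum_(x <- s) \sum_(y <- s | (x < y)%N) T x y.
  rewrite -big_split; apply: eq_bigr => x _ /=.
  rewrite (bigID (fun y => y == x)) /=; congr (_ + _); apply: eq_bigl => y; case: ltngtP => //.
rewrite mulrDr lerD2r ler_peMl ?ler1n // sumr_ge0 // => x _; exact: sumr_ge0.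
Qed.

(** * Transience *)

Section FrozenZeros.
Variables (R : realType) (F : probability (lattice 4) R) (a : nat -> nat).
Variables (disp : measure_display) (Omega : measurableType disp).
Variables (P : probability Omega R) (S : nat -> {RV P >-> lattice 4}).
Hypothesis S_walk : varying_dimension_walk 2 F a S.
Implicit Types (i : 'I_4) (j k l m r n t : nat) (w : Omega) (E : set Omega).

Local Notation adapted := (adapted S).

(** Return of the plane coordinates at time [k], of the others at time [a n];
    for [k] in the [n]-th interval this is a return of the walk, almost surely. *)
Definition frozen_zero n k : set Omega :=
  [set w | forall i, coord i (S (if (i < 2)%N then k else a n) w) = 0].

Definition interval_return n : set Omega :=
  [set w | exists2 k, (a n <= k < a n.+1)%N & frozen_zero n k w].

Definition first_zero n k : set Omega := frozen_zero n k `&`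
  [set w | forall j, (a n <= j < k)%N -> ~ frozen_zero n j w].

Lemma adapted_frozen_zero n k m : (a n <= m)%N -> (k <= m)%N -> adapted m (frozen_zero n k).
Proof.
move=> nm km w w' h zw i.
have := zw i; case: ifP => _ z.
  exact: (@adapted_walk _ _ _ _ _ _ _ S_walk m k (fun v => coord i v = 0) km w w' h z).
exact: (@adapted_walk _ _ _ _ _ _ _ S_walk m (a n) (fun v => coord i v = 0) nm w w' h z).
Qed.

Lemma measurable_frozen_zero n k : measurable (frozen_zero n k).
Proof.
exact: (measurable_adapted (adapted_frozen_zero (leq_maxl (a n) k) (leq_maxr _ _))).
Qed.

Lemma adapted_first_zero n k m : (a n <= m)%N -> (k <= m)%N -> adapted m (first_zero n k).
Proof.
move=> nm km w w' h [z1 z2]; split; first exact: (adapted_frozen_zero nm km) h z1.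
move=> j /[dup] jk /andP[_ jk'] z; apply: (z2 j jk).
exact: (adapted_frozen_zero nm (leq_trans (ltnW jk') km)) (esym h) z.
Qed.

Lemma measurable_first_zero n k : measurable (first_zero n k).
Proof.
exact: (measurable_adapted (adapted_first_zero (leq_maxl (a n) k) (leq_maxr _ _))).
Qed.

Lemma measurable_interval_return n : measurable (interval_return n).
Proof.
have -> : interval_return n = \bigcup_(k in [set k | (a n <= k < a n.+1)%N]) frozen_zero n k.
  by apply/seteqP; split=> w [k hk z]; exists k.
by apply: bigcup_measurable => k _; exact: measurable_frozen_zero.
Qed.

Lemma interval_return_first n w : interval_return n w ->
  exists2 k, k \in index_iota (a n) (a n.+1) & first_zero n k w.
Proof.
move=> [k0 hk0 z0].
pose Q k := (a n <= k < a n.+1)%N && `[< frozen_zero n k w >].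
have exQ : exists k, Q k by exists k0; rewrite /Q hk0; apply/asboolP.
have [k /andP[kI /asboolP zk] kmin] := ex_minnP exQ.
exists k; first by rewrite mem_index_iota.
split=> // j /andP[nj jk] zj.
have kb : (k < a n.+1)%N by case/andP: kI.
have : (k <= j)%N.
  by apply: kmin; rewrite /Q nj (ltn_trans jk kb); apply/asboolP.
by rewrite leqNgt jk.
Qed.

Lemma first_zero_inj n k k' w : (a n <= k)%N -> (a n <= k')%N ->
  first_zero n k w -> first_zero n k' w -> k = k'.
Proof.
move=> nk nk' [z1 h1] [z2 h2]; apply/eqP; rewrite eqn_leq; apply/andP; split.
  by rewrite leqNgt; apply/negP => lt; apply: (h1 k') => //; rewrite nk'.
by rewrite leqNgt; apply/negP => lt; apply: (h2 k) => //; rewrite nk.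
Qed.

Lemma planar_return_frozen n k r w : frozen_zero n k w -> planar_return S k r w ->
  frozen_zero n (k + r) w.
Proof. by move=> z p i; have := z i; case: ifP => // i2; rewrite p. Qed.

Lemma measurable_planar_return m r : measurable (planar_return S m r).
Proof.
have ap : adapted (m + r) (planar_return S m r).
  move=> w w' h p i i2; have := p i i2.
  have St (l : nat) : (l <= m + r)%N -> S l w' = S l w.
    move=> lm; exact: (@adapted_walk _ _ _ _ _ _ _ S_walk (m + r) l (fun v => v = S l w) lm w w' h erefl).
  by rewrite !St // leq_addr.
exact: measurable_adapted ap.
Qed.

(** After the first return in an interval the plane walk starts afresh, and
    each of its later returns is a frozen zero. *)
Lemma first_return_renewal n k0 Lam T (c : R) : (1 <= n)%N -> (0 < Lam)%N -> 0 <= c ->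
  (forall m r E, adapted m E -> (Lam %| r)%N -> (k0 <= r)%N ->
     pr P E * (c / r.+1%:R) <= pr P (E `&` planar_return S m r)) ->
  pr P (interval_return n) * \sum_(k0 <= t < T) c / (Lam * t).+1%:R <=
  \sum_(a n <= l < a n.+1 + Lam * T) pr P (frozen_zero n l).
Proof.
move=> n1 L0 c0 low.
pose I := index_iota (a n) (a n.+1).
have first_sum : pr P (interval_return n) <= \sum_(k <- I) pr P (first_zero n k).
  apply: pr_union_le; [exact: measurable_interval_return|exact: measurable_first_zero|].
  exact: interval_return_first.
have g0 : 0 <= \sum_(k0 <= t < T) c / (Lam * t).+1%:R.
  by apply: sumr_ge0 => t _; rewrite divr_ge0.
apply: le_trans (ler_wpM2r g0 first_sum) _.
pose Q (x : nat * nat) := first_zero n x.1 `&` planar_return S x.1 (Lam * x.2).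
have step : (\sum_(k <- I) pr P (first_zero n k)) * \sum_(k0 <= t < T) c / (Lam * t).+1%:R <=
    \sum_(x <- [seq (k, t) | k <- I, t <- index_iota k0 T]) pr P (Q x).
  rewrite big_allpairs mulr_suml big_seq [leRHS]big_seq; apply: ler_sum => k.
  rewrite mem_index_iota => /andP[nk _].
  rewrite mulr_sumr big_seq [leRHS]big_seq; apply: ler_sum => t.
  rewrite mem_index_iota => /andP[kt _].
  apply: low; [exact: adapted_first_zero|exact: dvdn_mulr|].
  by apply: leq_trans kt _; rewrite leq_pmull.
apply: le_trans step _.
have mQ x : measurable (Q x).
  by apply: measurableI; [exact: measurable_first_zero|exact: measurable_planar_return].
have := @pr_indic_le _ _ _ P _ _ [seq (k, t) | k <- I, t <- index_iota k0 T]
  (index_iota (a n) (a n.+1 + Lam * T)) (fun=> 1) (fun=> 1) Q (frozen_zero n) mQ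
  (measurable_frozen_zero n).
under eq_bigr do rewrite mul1r; under [X in _ <= X]eq_bigr do rewrite mul1r.
apply => w; under eq_bigr do rewrite mul1r; under [leRHS]eq_bigr do rewrite mul1r.
have rhs0 : 0 <= \sum_(a n <= l < a n.+1 + Lam * T) \1_(frozen_zero n l) w :> R.
  by apply: sumr_ge0 => l _; rewrite indicE.
have [[k kI fk]|nk] := pselect (exists2 k, k \in I & first_zero n k w); last first.
  rewrite big_seq big1 // => -[k t] /allpairsP[[k' t'] /= [kI _ [-> _]]].
  by rewrite indicE memNset // => -[fk _]; apply: nk; exists k'.
have nk : (a n <= k)%N by move: kI; rewrite mem_index_iota => /andP[].
have kb : (k < a n.+1)%N by move: kI; rewrite mem_index_iota => /andP[].
rewrite big_allpairs (bigD1_seq k) //=; last exact: iota_uniq.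
rewrite [X in _ + X]big_seq_cond [X in _ + X]big1 ?addr0; last first.
  move=> k' /andP[kI' kk']; apply: big1 => t _; rewrite indicE memNset // => -[fk' _].
  case/eqP: kk'; apply: first_zero_inj fk' fk => //.
  by move: kI'; rewrite mem_index_iota => /andP[].
apply: le_trans (_ : \sum_(l <- [seq (k + Lam * t)%N | t <- index_iota k0 T])
    \1_(frozen_zero n l) w <= _).
  rewrite big_map; apply: ler_sum => t _; rewrite !indicE.
  case: (boolP (w \in Q (k, t))) => [/set_mem[[zk _] pk]|_]; last by rewrite ler0n.
  by rewrite mem_set //; exact: planar_return_frozen zk pk.
apply: ler_sum_subset.
- by move=> l; rewrite indicE.
- rewrite map_inj_uniq ?iota_uniq // => t t' /addnI/eqP.
  by rewrite eqn_pmul2l // => /eqP.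
- exact: iota_uniq.
move=> l /mapP[t]; rewrite mem_index_iota => /andP[_ tT] ->.
rewrite mem_index_iota (leq_trans nk (leq_addr _ _)) /=.
by rewrite -addSn leq_add // leq_mul2l (ltnW tT) orbT.
Qed.

End FrozenZeros.

Section TimeLogs.
Variables (R : realType) (a : nat -> nat).
Hypothesis a_pos : forall n, (1 <= n)%N -> (0 < a n)%N.
Hypothesis a_incr : forall n, (1 <= n)%N -> (a n < a n.+1)%N.
Implicit Types n : nat.

Definition log_time n : R := ln (a n)%:R.

Lemma phiE n : (1 <= n)%N -> phi R a n = (log_time n.+1 - log_time n) / log_time n.+1.
Proof.
move=> n1; rewrite /phi ln_div ?posrE ?ltr0n ?a_pos //.
Qed.

Lemma log_time_lt n : (1 <= n)%N -> log_time n < log_time n.+1.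
Proof. by move=> n1; rewrite /log_time ltr_ln ?posrE ?ltr0n ?ltr_nat ?a_pos ?a_incr. Qed.

Lemma log_time_ge0 n : (1 <= n)%N -> 0 <= log_time n.
Proof. by move=> n1; rewrite ln_ge0 // ler1n a_pos. Qed.

Lemma log_time_gt0 n : (2 <= n)%N -> 0 < log_time n.
Proof.
by case: n => // -[//|n] _; apply: le_lt_trans (log_time_lt _); rewrite ?log_time_ge0.
Qed.

Lemma phi_ge0 n : (1 <= n)%N -> 0 <= phi R a n.
Proof.
move=> n1; rewrite phiE // divr_ge0 ?subr_ge0 ?log_time_ge0 //.
by rewrite ltW // log_time_lt.
Qed.

Lemma phi_le1 n : (1 <= n)%N -> phi R a n <= 1.
Proof.
move=> n1; rewrite phiE // ler_pdivrMr ?log_time_gt0 // mul1r lerBlDr lerDl.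
exact: log_time_ge0.
Qed.

End TimeLogs.

Section IntervalReturns.
Variables (R : realType) (F : probability (lattice 4) R) (a : nat -> nat).
Variables (disp : measure_display) (Omega : measurableType disp).
Variables (P : probability Omega R) (S : nat -> {RV P >-> lattice 4}).
Hypothesis F_indep : mutually_independent F (fun i : 'I_4 => coordinate R i).
Hypothesis S_walk : varying_dimension_walk 2 F a S.
Hypothesis F_law : forall i : 'I_4, exists u : R, centered_law (coord_law F i) u.
Hypothesis a_pos : forall n, (1 <= n)%N -> (0 < a n)%N.
Hypothesis a_incr : forall n, (1 <= n)%N -> (a n < a n.+1)%N.
Implicit Types (i : 'I_4) (j k l m r n t : nat) (w : Omega) (E : set Omega).

Local Notation log_time := (log_time R a).
Local Notation phi := (phi R a).
Local Notation interval_return := (interval_return a S).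

(** The error left by the comparison of the two bounds for one interval. *)
Definition short_gap n : R := Num.min (log_time n.+1)^-1 (log_time n.+1 - log_time n).

Lemma pr_frozen_zero_le : exists C : R, 0 < C /\ forall n k, (1 <= n)%N -> (a n <= k)%N ->
  pr P (frozen_zero a S n k) <= C / (k.+1%:R * n%:R).
Proof.
have [C [C0 hC]] := pr_mixed_le F_indep S_walk F_law.
exists C; split=> // n k n1 nk; apply: le_trans (hC _ _ nk) _.
rewrite ler_wpM2l ?(ltW C0) // lef_pV2 ?posrE ?mulr_gt0 ?ltr0n // ler_wpM2l // ler_nat.
by rewrite (nspecialE a_pos a_incr n1) // a_incr.
Qed.

(** Let [D] be the logarithmic length of the interval. The union bound is of
    order [D / n], which suffices when [D] is below [1 / log_time n.+1]. Otherwise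
    the renewal bound, with room up to a fixed multiple of [a n.+1] for the later
    returns, is of order [(D + kappa) / (n * log_time n.+1)]. *)
Lemma pr_interval_return_le : exists (K : R) n0, 0 <= K /\ forall n, (n0 <= n)%N ->
  pr P (interval_return n) <= K * (n%:R^-1 * phi n + short_gap n / n%:R).
Proof.
have [C [C0 hC]] := pr_frozen_zero_le.
have [Lam [hh [c [Lam0 c0 _ _ [k0 low]]]]] := walk_lower_bounds F_indep S_walk F_law.
have renew := first_return_renewal S_walk.
pose kappa : R := ln (Lam.+1)%:R.
have kappa0 : 0 <= kappa by rewrite ln_ge0 // ler1n.
pose K1 : R := 2 * Lam%:R * C / c.
have L0R : 0 < Lam%:R :> R by rewrite ltr0n.
have K10 : 0 < K1 by rewrite divr_gt0 // !mulr_gt0.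
exists (K1 * (kappa + 1) + C), (maxn 2 (k0.+1 ^ 2)%N); split.
  by rewrite addr_ge0 ?(ltW C0) // mulr_ge0 ?addr_ge0 // ltW.
move=> n; rewrite geq_max => /andP[n2 nk].
have n1 : (1 <= n)%N by apply: ltnW.
have nR : 0 < n%:R :> R by rewrite ltr0n.
set b := a n.+1; set x := a n.
have nb : (n <= b)%N by rewrite ltnW // le_times.
have x0 : (0 < x)%N by apply: a_pos.
have xb : (x < b)%N by apply: a_incr.
have b0 : (0 < b)%N by apply: a_pos.
have lb : 0 < log_time n.+1 by apply: log_time_gt0 => //; rewrite ltnS ltnW.
have D0 : 0 < log_time n.+1 - log_time n by rewrite subr_gt0 log_time_lt.
set D := log_time n.+1 - log_time n in D0.
set p := pr P (interval_return n).
have p_union : p <= C / n%:R * D.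
  apply: le_trans (_ : \sum_(x <= k < b) pr P (frozen_zero a S n k) <= _).
    apply: pr_union_le => [||w [k hk z]].
    - exact: (measurable_interval_return S_walk n).
    - exact: (measurable_frozen_zero S_walk n).
    - by exists k => //; rewrite mem_index_iota.
  apply: le_trans (_ : \sum_(x <= k < b) C / n%:R * k.+1%:R^-1 <= _).
    apply: ler_sum_nat => k /andP[xk _]; apply: le_trans (hC n k n1 xk) _.
    by rewrite invfM mulrCA mulrC -mulrA.
  rewrite -mulr_sumr ler_wpM2l ?divr_ge0 ?(ltW C0) //.
  exact: harmonic_le x0 (ltnW xb).
have p_renew : p * log_time n.+1 <= K1 / n%:R * (kappa + D).
  have := renew n k0 Lam b c n1 Lam0 (ltW c0) low; rewrite -/p => h.
  have G : c / (2 * Lam%:R) * log_time n.+1 <= \sum_(k0 <= t < b) c / (Lam * t).+1%:R.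
    apply: le_trans (_ : c / Lam%:R * \sum_(k0 <= t < b) t.+1%:R^-1 <= _); last first.
      rewrite mulr_sumr; apply: ler_sum_nat => t _.
      rewrite -mulrA -invfM ler_wpM2l ?(ltW c0) // lef_pV2 ?posrE ?mulr_gt0 ?ltr0n //.
      by rewrite -natrM ler_nat mulnS -addn1 addnC leq_add.
    have k0b : (k0 <= b)%N.
      by apply: leq_trans nb; apply: leq_trans nk; clear; nia.
    have := harmonic_ge R k0b.
    have lnb : ln b%:R <= ln b.+1%:R :> R by rewrite ler_ln ?posrE ?ltr0n // ler_nat.
    have lnk : 2 * ln k0.+1%:R <= ln b%:R :> R.
      rewrite mulrC mulr_natr -lnXn ?ltr0n // -natrX ler_ln ?posrE ?ltr0n ?expn_gt0 //.
      by rewrite ler_nat (leq_trans nk nb).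
    set s := \sum_(_ <= _ < _) _ => hs.
    have -> : c / (2 * Lam%:R) * log_time n.+1 = c / Lam%:R * (ln b%:R / 2).
      by rewrite /log_time -/b; field; rewrite gt_eqF.
    by rewrite ler_wpM2l ?divr_ge0 ?(ltW c0) //; lra.
  have U : \sum_(x <= l < b + Lam * b) pr P (frozen_zero a S n l) <= C / n%:R * (kappa + D).
    apply: le_trans (_ : \sum_(x <= l < b + Lam * b) C / n%:R * l.+1%:R^-1 <= _).
      apply: ler_sum_nat => k /andP[xk _]; apply: le_trans (hC n k n1 xk) _.
      by rewrite invfM mulrCA mulrC -mulrA.
    rewrite -mulr_sumr ler_wpM2l ?divr_ge0 ?(ltW C0) //.
    have xb' : (x <= b + Lam * b)%N by apply: leq_trans (ltnW xb) _; rewrite leq_addr.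
    apply: le_trans (harmonic_le R x0 xb') _.
    by rewrite -mulSn natrM lnM ?posrE ?ltr0n // /D /log_time -/b -/x addrA.
  have {}h := le_trans h U.
  have pG := ler_wpM2l (pr_ge0 P (interval_return n)) G.
  have {}h := le_trans pG h.
  have c2 : 0 < c / (2 * Lam%:R) by rewrite divr_gt0 // mulr_gt0.
  rewrite -(ler_pM2l c2) mulrCA; apply: le_trans h _.
  by rewrite le_eqVlt; apply/orP; left; apply/eqP; rewrite /K1; field; rewrite !gt_eqF.
have phi_n : phi n = D / log_time n.+1 by rewrite phiE.
have p0 : 0 <= p by apply: pr_ge0.
have phi0 : 0 <= phi n by apply: phi_ge0.
rewrite phi_n; case: (leP D (log_time n.+1)^-1) => hD.
  rewrite /short_gap -/D; move: hD => /min_idPr ->.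
  apply: le_trans p_union _.
  have h1 : 0 <= K1 * (kappa + 1) by rewrite mulr_ge0 ?addr_ge0 // ltW.
  have h2 : 0 <= n%:R^-1 * (D / log_time n.+1) by rewrite mulr_ge0 ?invr_ge0 // divr_ge0 ?ltW.
  have h3 : 0 <= D / n%:R by rewrite divr_ge0 ?ltW.
  have -> : C / n%:R * D = C * (D / n%:R) by ring.
  have h4 := mulr_ge0 h1 h3; have h5 := mulr_ge0 h1 h2; have h6 := mulr_ge0 (ltW C0) h2.
  by move: (D / n%:R) (n%:R^-1 * _) h2 h3 h4 h5 h6 => u v; lra.
rewrite /short_gap -/D min_l ?(ltW hD) //.
have {}p_renew : p <= K1 * (kappa * ((log_time n.+1)^-1 / n%:R) + n%:R^-1 * (D / log_time n.+1)).
  rewrite -ler_pdivlMr // in p_renew; apply: le_trans p_renew _.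
  by rewrite le_eqVlt; apply/orP; left; apply/eqP; ring.
apply: le_trans p_renew _.
have h1 : 0 <= n%:R^-1 * (D / log_time n.+1) by rewrite mulr_ge0 ?invr_ge0 // divr_ge0 ?ltW.
have h2 : 0 <= (log_time n.+1)^-1 / n%:R by rewrite divr_ge0 ?invr_ge0 ?ltW.
move: (_ * (D / _)) (_ / n%:R) h1 h2 => u v u0 v0.
have h3 := mulr_ge0 (ltW K10) u0; have h4 := mulr_ge0 (ltW K10) v0.
have h5 := mulr_ge0 kappa0 h3; have h6 := mulr_ge0 (ltW C0) u0; have h7 := mulr_ge0 (ltW C0) v0.
lra.
Qed.

End IntervalReturns.

Section Transience.
Variables (R : realType) (F : probability (lattice 4) R) (a : nat -> nat).
Variables (disp : measure_display) (Omega : measurableType disp).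
Variables (P : probability Omega R) (S : nat -> {RV P >-> lattice 4}).
Hypothesis F_indep : mutually_independent F (fun i : 'I_4 => coordinate R i).
Hypothesis S_walk : varying_dimension_walk 2 F a S.
Hypothesis F_law : forall i : 'I_4, exists u : R, centered_law (coord_law F i) u.
Hypothesis a_pos : forall n, (1 <= n)%N -> (0 < a n)%N.
Hypothesis a_incr : forall n, (1 <= n)%N -> (a n < a n.+1)%N.
Implicit Types (i : 'I_4) (j k l m r n t : nat) (w : Omega) (E : set Omega).

Local Notation nspecial := (nspecial a).
Local Notation log_time := (log_time R a).
Local Notation phi := (phi R a).
Local Notation interval_return := (interval_return a S).
Local Notation short_gap := (short_gap R a).

(** The error [short_gap n / n] is summable whatever the times: [min_split]
    bounds it by [short_gap n ^+ 3] and a convergent series, and the cube is at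
    most the increment of [- 1 / log_time], because of the three factors two
    are at most [1 / log_time n.+1] and one is at most the gap. *)
Lemma short_gap_cube n : (2 <= n)%N ->
  0 <= short_gap n /\ short_gap n ^+ 3 <= (log_time n)^-1 - (log_time n.+1)^-1.
Proof.
move=> n2; have n1 := ltnW n2.
have x0 : 0 < log_time n by apply: log_time_gt0.
have y0 : 0 < log_time n.+1 by apply: log_time_gt0 => //; rewrite ltnW.
have xy : log_time n < log_time n.+1 by apply: log_time_lt.
rewrite /short_gap; move: (log_time n) (log_time n.+1) x0 y0 xy => x y x0 y0 xy.
have iy0 : 0 <= y^-1 by rewrite invr_ge0 ltW.
have d0 : 0 <= y - x by rewrite subr_ge0 ltW.
set s := Num.min _ _.
have s0 : 0 <= s by rewrite /s le_min iy0.
have s1 : s <= y^-1 by rewrite /s ge_min lexx.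
have s2 : s <= y - x by rewrite /s ge_min lexx orbT.
split=> //.
apply: le_trans (_ : y^-1 * y^-1 * (y - x) <= _).
  by rewrite exprSr expr2 ler_pM ?mulr_ge0 // ler_pM.
have -> : x^-1 - y^-1 = y^-1 * x^-1 * (y - x) by field; rewrite !gt_eqF.
rewrite ler_wpM2r // ler_wpM2l // lef_pV2 ?posrE // ltW //.
Qed.

Lemma sum_interval_return_bounded B :
  (forall N, \sum_(1 <= n < N) n%:R^-1 * phi n <= B) ->
  exists n1 B', forall N, \sum_(0 <= n < N) pr P (interval_return (n1 + n)) <= B'.
Proof.
move=> hB; have [K [n0 [K0 hK]]] := pr_interval_return_le F_indep S_walk F_law a_pos a_incr.
pose n1 := maxn 2 n0; have n12 : (2 <= n1)%N by rewrite leq_maxl.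
have n11 : (1 <= n1)%N by rewrite ltnW.
exists n1, (K * (B + ((log_time n1)^-1 + 3))) => N.
have -> : \sum_(0 <= n < N) pr P (interval_return (n1 + n)) =
    \sum_(n1 <= n < n1 + N) pr P (interval_return n).
  rewrite -{2}[n1]add0n big_addn addKn; apply: eq_bigr => n _; by rewrite addnC.
pose q n : R := (n%:R * Num.sqrt n%:R)^-1.
apply: le_trans (_ : K * \sum_(n1 <= n < n1 + N)
   (n%:R^-1 * phi n + (((log_time n)^-1 - (log_time n.+1)^-1) + q n)) <= _).
  rewrite mulr_sumr; apply: ler_sum_nat => n /andP[n1n _].
  have nn0 : (n0 <= n)%N by apply: leq_trans n1n; rewrite leq_maxr.
  have n2 : (2 <= n)%N by apply: leq_trans n1n.
  apply: le_trans (hK n nn0) _; rewrite ler_wpM2l // lerD2l.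
  have [s0 s3] := short_gap_cube n2.
  by apply: le_trans (min_split s0 (ltnW n2)) _; rewrite lerD2r.
rewrite ler_wpM2l // big_split /= lerD //.
  apply: le_trans (hB (n1 + N)%N); rewrite [leRHS](@big_cat_nat _ _ _ n1) ?leq_addr //=.
  rewrite lerDr big_seq; apply: sumr_ge0 => n; rewrite mem_index_iota => /andP[n0' _].
  by rewrite mulr_ge0 ?invr_ge0 // phi_ge0.
rewrite big_split /=; apply: lerD.
  have := telescope_nat (fun n => - (log_time n)^-1) (leq_addr N n1).
  under [X in X = _ -> _]eq_bigr do rewrite opprK addrC.
  move=> ->; rewrite opprK gerDr oppr_le0 invr_ge0 log_time_ge0 //.
  by rewrite addn_gt0 n11.
apply: le_trans (sum_inv_n_sqrt_n R (n1 + N)); rewrite [leRHS](@big_cat_nat _ _ _ n1) ?leq_addr //=.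
by rewrite lerDr sumr_ge0 // => n _; rewrite invr_ge0 mulr_ge0 // sqrtr_ge0.
Qed.

(** Ordinary steps stay in the plane almost surely only, since their law alone
    is prescribed; this is the exceptional event. *)
Definition irregular j : set Omega := ~` [set w | forall i,
  (if active a j.+1 i then setT else [set 0]) (coord i (incr S j w))].

Lemma irregular_negligible j : P.-negligible (irregular j).
Proof.
have mB : measurable [set w | forall i,
    (if active a j.+1 i then setT else [set 0]) (coord i (incr S j w))].
  exact: (measurable_incr S j [set v | forall i, (if active a j.+1 i then setT else [set 0]) (coord i v)]).
exists (irregular j); split=> //; first exact: measurableC.
have := pr_incr_coords F_indep S_walk j (fun i => if active a j.+1 i then setT else [set 0]).
rewrite big1 => [pr1|i _]; last first.
  case: (active a j.+1 i); last by rewrite asboolT.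
  by rewrite (_ : [set _ | _] = setT) ?pr_setT //; apply/seteqP; split.
rewrite /irregular probability_setC // prE // pr1 -EFinB subrr //.
Qed.

Lemma regular_frozen w k n : (forall j, ~ irregular j w) -> (1 <= n)%N ->
  (a n <= k < a n.+1)%N -> S k w = 0 -> frozen_zero a S n k w.
Proof.
move=> reg n1 /andP[nk kn] Sk i; case: ifP => i2; first by rewrite Sk /coord mxE.
have Sk0 : coord i (S k w) = 0 by rewrite Sk /coord mxE.
have := walk_coord_diff S_walk (a n) (k - a n) w i; rewrite subnKC // Sk0 sub0r.
rewrite big1 => [/eqP|j _]; first by rewrite oppr_eq0 => /eqP.
have := reg (a n + j)%N; rewrite /irregular /= => /contrapT /(_ i).
rewrite ifF // /active i2 /=; apply/asboolP => -[n' /= n'1 e].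
have lt1 : (a n < a n')%N by rewrite e ltnS leq_addr.
have lt2 : (a n' < a n.+1)%N.
  by rewrite e; apply: leq_ltn_trans kn; have := ltn_ord j; clear -nk; lia.
have nn' : (n < n')%N.
  by rewrite ltnNge; apply/negP => /(times_le a_incr n'1); rewrite leqNgt lt1.
by have := times_le a_incr (isT : (1 <= n.+1)%N) nn'; rewrite leqNgt lt2.
Qed.

Theorem walk_transient :
  (\sum_(1 <= n <oo) (n%:R^-1 * phi n)%:E < +oo)%E -> transient S.
Proof.
move=> hlt.
have f0 n : 0 <= n%:R^-1 * phi n.
  by case: n => [|n]; rewrite ?invr0 ?mul0r // mulr_ge0 ?invr_ge0 ?phi_ge0.
have [B hB] := series_lt_pinfty_bounded f0 hlt.
have [n1 [B' hB']] := sum_interval_return_bounded hB.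
pose A n := interval_return (n1 + n).
have mA n : measurable (A n) by exact: (measurable_interval_return S_walk).
have A0 : P (lim_sup_set A) = 0.
  apply: lim_sup_set_cvg0 => //.
  have PA n : P (A n) = (pr P (A n))%:E by apply: prE.
  rewrite (eq_eseriesr (g := fun n => (pr P (A n))%:E)) => [|n _]; last exact: PA.
  exact: (series_lt_pinfty (f := fun n => pr P (A n)) (N0 := 0%N) (fun=> pr_ge0 _ _) hB').
suff neg : P.-negligible (~` [set w | finite_set [set k | S k w = 0]]) by exact: neg.
apply: (@negligibleS _ _ _ _ (lim_sup_set A `|` \bigcup_j irregular j)); last first.
  apply: negligibleU; last by apply: negligible_bigcup => j; exact: irregular_negligible.
  apply/negligibleP => //; apply: bigcap_measurable => // n _.
  by apply: bigcup_measurable => m _; exact: mA.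
move=> w /= inf; apply: contrapT => /not_orP[nA nI].
have reg j : ~ irregular j w by move=> h; apply: nI; exists j.
have [N hN] : exists N, forall n, (N <= n)%N -> ~ A n w.
  apply: contrapT => h; apply: nA => n _ /=.
  apply: contrapT => h2; apply: h; exists n => m nm Am.
  by apply: h2; exists m.
apply: inf; apply: sub_finite_set (finite_II (a (n1 + N).+1)) => k /= Sk.
rewrite ltnNge; apply/negP => ak.
have c1 : (1 <= (n1 + N).+1)%N by [].
have cge : ((n1 + N).+1 <= nspecial k)%N by rewrite nspecial_geP.
have cn1 : (1 <= nspecial k)%N by apply: leq_trans cge.
have kI : (a (nspecial k) <= k < a (nspecial k).+1)%N.
  by rewrite -(nspecial_geP a_pos a_incr) // leqnn ltnNge -(nspecial_geP a_pos a_incr) // ltnn.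
have Z := regular_frozen reg cn1 kI Sk.
apply: (hN (nspecial k - n1)%N); first by clear -cge; lia.
rewrite /A subnKC; first by exists k.
by clear -cge; lia.
Qed.

End Transience.

(** * Nonincreasing ratios *)

Section MonotonePhi.
Variables (R : realType) (a : nat -> nat).
Hypothesis a_pos : forall n, (1 <= n)%N -> (0 < a n)%N.
Hypothesis a_incr : forall n, (1 <= n)%N -> (a n < a n.+1)%N.
Local Notation log_time := (log_time R a).
Local Notation phi := (phi R a).
Hypothesis phi_mono : forall m n, (1 <= m)%N -> (m <= n)%N -> phi n <= phi m.
Hypothesis phi_div : (\sum_(1 <= n <oo) (n%:R^-1 * phi n)%:E = +oo)%E.
Implicit Types m n k t q N T : nat.

Definition gap n : R := log_time n.+1 - log_time n.

Lemma gapE n : (1 <= n)%N -> gap n = phi n * log_time n.+1.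
Proof.
by move=> n1; rewrite phiE // divfK // gt_eqF // log_time_gt0.
Qed.

Lemma log_time_ge_ln2 n : (1 <= n)%N -> ln 2 <= log_time n.+1.
Proof.
move=> n1; rewrite /log_time ler_ln ?posrE ?ltr0n ?a_pos // ler_nat.
by apply: leq_trans (le_times a_pos a_incr _).
Qed.

(** By monotonicity each of the first [m] gaps is at least [phi n] times
    [ln 2]. *)
Lemma log_time_linear n m : (1 <= n)%N -> (m <= n)%N ->
  m%:R * phi n * ln 2 <= log_time m.+1.
Proof.
move=> n1; elim: m => [|m IH] mn; first by rewrite !mul0r log_time_ge0.
have m1 : (1 <= m.+1)%N by [].
rewrite -[leRHS](subrK (log_time m.+1)) -/(gap m.+1) gapE // -nat1r !mulrDl mul1r.
apply: lerD; last exact: IH (ltnW mn).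
have ln20 : 0 <= ln 2 :> R by rewrite ln_ge0 // ler1n.
by apply: ler_pM => //; rewrite ?phi_ge0 ?phi_mono ?log_time_ge_ln2 //.
Qed.

(** The linear growth of [log_time], put back into the gaps [phi * log_time]. *)
Lemma log_time_quadratic n m : (1 <= n)%N -> (m <= n)%N ->
  m%:R ^+ 2 * phi n ^+ 2 * (ln 2 / 2) <= log_time m.+1.
Proof.
move=> n1; elim: m => [|m IH] mn; first by rewrite expr2 !mul0r log_time_ge0.
have m1 : (1 <= m.+1)%N by [].
rewrite -[leRHS](subrK (log_time m.+1)) -/(gap m.+1) gapE //.
apply: le_trans (lerD (_ : m.+1%:R * phi n ^+ 2 * ln 2 <= _) (IH (ltnW mn))).
  have ln20 : 0 <= ln 2 :> R by rewrite ln_ge0 // ler1n.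
  have : 0 <= phi n ^+ 2 by rewrite sqr_ge0.
  have m0 : 0 <= m%:R :> R by [].
  rewrite -nat1r; move: (phi n ^+ 2) => z z0.
  have h1 := mulr_ge0 (mulr_ge0 m0 z0) ln20; have h2 := mulr_ge0 z0 ln20.
  by rewrite expr2; lra.
have -> : m.+1%:R * phi n ^+ 2 * ln 2 = phi n * (m.+1%:R * phi n * ln 2) by ring.
have ln20 : 0 <= ln 2 :> R by rewrite ln_ge0 // ler1n.
have p0 := phi_ge0 R a_pos a_incr n1.
apply: ler_pM; [exact: p0|exact: (mulr_ge0 (mulr_ge0 (ler0n _ _) p0) ln20)|exact: phi_mono|exact: log_time_linear].
Qed.

(** The indices that carry the divergence; the others contribute at most the
    convergent sum of [n ^ (-3/2)], and at these the gaps are huge. *)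
Definition good n : bool := (1 <= n)%N && (1 <= n%:R * phi n ^+ 2).

(** The quadratic bound makes the gap at [n] at least of order
    [n ^ 2 * phi n ^ 3], which is at least the square root of [n] at good indices. *)
Lemma good_gap (K : R) : exists n0, forall n, (n0 <= n)%N -> good n ->
  [/\ K <= gap n, K <= gap n.-1 & K <= log_time n].
Proof.
have ln2 : 0 < ln 2 :> R by rewrite ln_gt0 // ltr1n.
pose K' : R := Num.max K 0 * 8 / ln 2.
have K'0 : 0 <= K' by rewrite divr_ge0 ?mulr_ge0 ?le_max ?lexx ?orbT // ltW.
exists (maxn 2 (Num.truncn (K' ^+ 2)).+1) => n; rewrite geq_max => /andP[n2 nK].
have n1 := ltnW n2; rewrite /good n1 /= => g.
have p0 := phi_ge0 R a_pos a_incr n1.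
have p1 := phi_le1 R a_pos a_incr n1.
pose X := n%:R ^+ 2 * phi n ^+ 3.
have X0 : 0 <= X by rewrite mulr_ge0 ?exprn_ge0.
have KX : K' <= X.
  rewrite -(@ler_pXn2r _ 2) ?nnegrE //.
  apply: le_trans (_ : n%:R <= _).
    apply: le_trans (ltW (Num.Theory.truncnS_gt _)) _; by rewrite ler_nat.
  have -> : X ^+ 2 = n%:R * (n%:R * phi n ^+ 2) ^+ 3 by rewrite /X; ring.
  by rewrite -[leLHS]mulr1 ler_wpM2l // exprn_ege1.
have key : X * (ln 2 / 8) >= K.
  apply: le_trans (_ : K' * (ln 2 / 8) <= _); last by rewrite ler_wpM2r // divr_ge0 // ltW.
  rewrite /K' mulrA divfK ?gt_eqF // mulfK // le_max lexx //.
have n1R : n%:R <= 2 * (n.-1)%:R :> R.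
  by rewrite -natrM ler_nat; clear -n2; lia.
have quad : X * (ln 2 / 8) <= phi n * log_time n.
  have n'1 : (n.-1 <= n)%N by rewrite leq_pred.
  have := log_time_quadratic n1 n'1; rewrite prednK // => h.
  apply: le_trans (ler_wpM2l p0 h).
  have -> : X * (ln 2 / 8) = phi n * (n%:R ^+ 2 * phi n ^+ 2 * (ln 2 / 8)) by rewrite /X; ring.
  rewrite ler_wpM2l //.
  have : n%:R ^+ 2 <= (2 * n.-1%:R) ^+ 2 :> R by rewrite lerXn2r ?nnegrE ?mulr_ge0.
  move=> h2; have := ler_wpM2r (_ : 0 <= phi n ^+ 2 * (ln 2 / 8)) h2.
  have -> : 0 <= phi n ^+ 2 * (ln 2 / 8) by rewrite mulr_ge0 ?sqr_ge0 // divr_ge0 // ltW.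
  by move=> /(_ isT); rewrite !mulrA; lra.
have ll : log_time n <= log_time n.+1 by rewrite ltW // log_time_lt.
have l0 := log_time_ge0 R a_pos n1.
split; apply: le_trans key (le_trans quad _).
- by rewrite gapE // ler_wpM2l.
- have n'1 : (1 <= n.-1)%N by clear -n2; lia.
  by rewrite gapE // prednK // ler_wpM2r // phi_mono // leq_pred.
- by rewrite -[leRHS]mul1r ler_wpM2r.
Qed.

Definition weight n : R := n%:R^-1 * phi n.

Lemma weight_ge0 n : 0 <= weight n.
Proof.
by case: n => [|n]; rewrite /weight ?invr0 ?mul0r // mulr_ge0 ?invr_ge0 ?phi_ge0 //.
Qed.

Lemma weight_mono m n : (1 <= m)%N -> (m <= n)%N -> weight n <= weight m.
Proof.
move=> m1 mn; have n1 := leq_trans m1 mn.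
apply: ler_pM => //; rewrite ?invr_ge0 ?phi_ge0 ?phi_mono //.
by rewrite lef_pV2 ?posrE ?ltr0n // ler_nat.
Qed.

Definition full N : R := \sum_(1 <= j < N) weight j.

Lemma full_le M N : (M <= N)%N -> full M <= full N.
Proof.
move=> MN; rewrite /full; case: (leqP 1 M) => M1; last first.
  by rewrite [leLHS]big_geq ?(ltnW M1) // sumr_ge0 // => j _; exact: weight_ge0.
rewrite [leRHS](@big_cat_nat _ _ _ M) //= lerDl sumr_ge0 // => j _; exact: weight_ge0.
Qed.

(** Multiples of [q] are used so that the number of special times is a multiple
    of the period of the walk. *)
Definition thin q t0 T : R := \sum_(t0 <= t < T | good (q * t)) weight (q * t).

(** Each block of [q] consecutive indices is dominated by its first one, and the
    bad indices are negligible. *)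
Lemma full_le_thin q t0 T : (0 < q)%N -> (1 <= t0)%N -> (t0 <= T)%N ->
  full (q * T) <= full (q * t0) + q%:R * (thin q t0 T + 3).
Proof.
move=> q0 t01 tT.
have blocks : full (q * T) <= full (q * t0) + q%:R * \sum_(t0 <= t < T) weight (q * t).
  rewrite -(subnKC tT); elim: (T - t0)%N => [|d IH].
    by rewrite addn0 [X in _ * X]big_geq // mulr0 addr0.
  have E : (q * (t0 + d.+1) = q * (t0 + d) + q)%N by rewrite addnS mulnS addnC.
  have n1 : (1 <= q * (t0 + d))%N by rewrite muln_gt0 q0 addn_gt0 t01.
  rewrite E addnS big_nat_recr ?leq_addr //= mulrDr addrA.
  rewrite /full (@big_cat_nat _ _ _ (q * (t0 + d))) ?leq_addr //=.
  apply: lerD; first exact: IH.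
  apply: le_trans (_ : \sum_(q * (t0 + d) <= j < q * (t0 + d) + q) weight (q * (t0 + d)) <= _).
    by apply: ler_sum_nat => j /andP[jl _]; apply: weight_mono.
  by rewrite sumr_const_nat addKn -[leLHS]mulr_natl.
apply: le_trans blocks _; rewrite lerD2l ler_wpM2l //.
rewrite (bigID (fun t => good (q * t))) /= lerD //.
apply: le_trans (_ : \sum_(t0 <= t < T) (t%:R * Num.sqrt t%:R)^-1 <= _).
  rewrite [leRHS](bigID (fun t => ~~ good (q * t))) /= -[leLHS]addr0; apply: lerD; last first.
    by rewrite sumr_ge0 // => t _; rewrite invr_ge0 mulr_ge0 ?sqrtr_ge0.
  rewrite big_nat_cond [leRHS]big_nat_cond; apply: ler_sum => t /andP[/andP[tt _] bad].
  have t1 : (1 <= t)%N by apply: leq_trans tt.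
  have n1 : (1 <= q * t)%N by rewrite muln_gt0 q0.
  have tn : (t <= q * t)%N by rewrite leq_pmull.
  have p0 := phi_ge0 R a_pos a_incr n1.
  move: bad; rewrite /good n1 /= -ltNge => bad.
  have s0 : 0 < Num.sqrt (q * t)%:R :> R by rewrite sqrtr_gt0 ltr0n.
  have small : phi (q * t) <= (Num.sqrt (q * t)%:R)^-1.
    rewrite -[leRHS]mul1r ler_pdivlMr // -(@ler_pXn2r _ 2) ?nnegrE ?(mulr_ge0 p0 (ltW s0)) //.
    by rewrite exprMn sqr_sqrtr // expr1n mulrC ltW.
  apply: le_trans (_ : ((q * t)%:R * Num.sqrt (q * t)%:R)^-1 <= _).
    have -> : ((q * t)%:R * Num.sqrt (q * t)%:R)^-1 = (q * t)%:R^-1 * (Num.sqrt (q * t)%:R)^-1 :> R by rewrite invfM.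
    apply: (ler_wpM2l _ small); by rewrite invr_ge0.
  have st : Num.sqrt t%:R <= Num.sqrt (q * t)%:R :> R by rewrite ler_wsqrtr // ler_nat.
  have st0 : 0 < Num.sqrt t%:R :> R by rewrite sqrtr_gt0 ltr0n.
  rewrite lef_pV2 ?posrE ?mulr_gt0 ?ltr0n // ler_pM ?sqrtr_ge0 // ler_nat //.
apply: le_trans (sum_inv_n_sqrt_n R T); rewrite [leRHS](@big_cat_nat _ _ _ t0) //=.
by rewrite lerDr sumr_ge0 // => t _; rewrite invr_ge0 mulr_ge0 ?sqrtr_ge0.
Qed.

Lemma thin_large q t0 (B : R) : (0 < q)%N -> (1 <= t0)%N ->
  exists T, [/\ (t0 <= T)%N, B <= thin q t0 T & full (q * T) <= q.+1%:R * thin q t0 T].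
Proof.
move=> q0 t01; pose D := full (q * t0) + q%:R * 3.
pose B' := Num.max B D.
have [N hN] := series_pinfty_unbounded weight_ge0 phi_div (D + q%:R * B').
have NT : (N <= q * maxn t0 N)%N.
  by apply: leq_trans (leq_maxr t0 N) _; rewrite leq_pmull.
have tT := leq_maxl t0 N.
have := full_le_thin q0 t01 tT; have := le_trans hN (full_le NT).
set f := full (q * maxn t0 N); set th := thin _ _ _ => h1 h2.
have qR : 0 < q%:R :> R by rewrite ltr0n.
have B'th : B' <= th.
  by rewrite -(ler_pM2l qR); move: h1 h2; rewrite /D mulrDr; lra.
have Bth : B <= th by apply: le_trans B'th; rewrite le_max lexx.
have Dth : D <= th by apply: le_trans B'th; rewrite le_max lexx orbT.
exists (maxn t0 N); split=> //; rewrite -/f -/th -nat1r mulrDl mul1r.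
by move: h2 Dth; rewrite /D mulrDr; lra.
Qed.

Lemma good_multiple q t0 : (0 < q)%N -> exists2 t, (t0 <= t)%N & good (q * t).
Proof.
move=> q0; have [T [_ h _]] := thin_large 1 q0 (isT : (1 <= t0.+1)%N).
apply: contrapT => hno; move: h; rewrite /thin big_nat_cond big1 ?ler10 // => t.
move=> /andP[/andP[tt _] gt]; case: hno; exists t => //; exact: ltnW.
Qed.

(** For a nonincreasing sequence, [phi n'] is at most [phi (n' - n)]: this is
    what makes the interaction of two intervals summable over the later one. *)
Lemma interaction_sum q t T : (0 < q)%N ->
  \sum_(t.+1 <= t' < T) phi (q * t') / (q * t' - q * t)%:R <= full (q * T).
Proof.
move=> q0.
apply: le_trans (_ : \sum_(t.+1 <= t' < T) weight (t' - t) <= _).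
  apply: ler_sum_nat => t' /andP[tt' _].
  have d1 : (1 <= t' - t)%N by rewrite subn_gt0.
  have dq : (t' - t <= q * t' - q * t)%N by rewrite -mulnBr leq_pmull.
  apply: le_trans (weight_mono d1 dq); rewrite /weight mulrC ler_wpM2l ?invr_ge0 //.
  by apply: phi_mono; [exact: leq_trans dq|rewrite leq_subr].
apply: le_trans (_ : full (T - t) <= _); last first.
  by apply: full_le; apply: leq_trans (leq_subr _ _) _; rewrite leq_pmull.
by rewrite /full -add1n big_addn; under eq_bigr do rewrite addnK.
Qed.

End MonotonePhi.

(** * Second moments *)

Section SecondMoment.
Variables (R : realType) (disp : measure_display) (Omega : measurableType disp).
Variable P : probability Omega R.

(** If [V] is a weighted count of events inside [U] then pointwise
    [2 x V - x ^ 2 V ^ 2 <= 1], and [V] vanishes off [U]; the bound is the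
    expectation of that inequality, and a tuned [x] turns it into the
    Paley-Zygmund bound. *)
Lemma second_moment_le (J : eqType) (s : seq J) (c : J -> R) (A : J -> set Omega) U (x : R) :
  (forall j, measurable (A j)) -> measurable U -> (forall j, j \in s -> A j `<=` U) ->
  2 * x * \sum_(j <- s) c j * pr P (A j) <=
  pr P U + x ^+ 2 * \sum_(j <- s) \sum_(j' <- s) c j * c j' * pr P (A j `&` A j').
Proof.
move=> mA mU AU.
pose t : seq (option (J * J)) := None :: [seq Some (j, j') | j <- s, j' <- s].
pose e (o : option (J * J)) : R := if o is Some p then x ^+ 2 * (c p.1 * c p.2) else 1.
pose B (o : option (J * J)) := if o is Some p then A p.1 `&` A p.2 else U.
have mB o : measurable (B o) by case: o => //= p; apply: measurableI.
have sumB (f : set Omega -> R) : \sum_(o <- t) e o * f (B o) =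
    f U + x ^+ 2 * \sum_(j <- s) \sum_(j' <- s) c j * c j' * f (A j `&` A j').
  rewrite big_cons /= mul1r; congr (_ + _).
  rewrite big_allpairs_dep mulr_sumr; apply: eq_bigr => j _.
  by rewrite mulr_sumr; apply: eq_bigr => j' _; rewrite mulrA.
rewrite -(sumB (pr P)) mulr_sumr; under eq_bigr do rewrite mulrA.
apply: pr_indic_le => // w.
rewrite (sumB (fun X => \1_X w)).
pose V := \sum_(j <- s) c j * \1_(A j) w : R.
have -> : \sum_(i <- s) 2 * x * c i * \1_(A i) w = 2 * x * V.
  by rewrite mulr_sumr; apply: eq_bigr => j _; rewrite mulrA.
have -> : \sum_(j <- s) \sum_(j' <- s) c j * c j' * \1_(A j `&` A j') w = V * V.
  rewrite /V big_distrl; apply: eq_bigr => j _; rewrite big_distrr; apply: eq_bigr => j' _ /=.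
  by rewrite indicI /=; ring.
rewrite indicE; case: (boolP (w \in U)) => wU /=; first by have := sqr_ge0 (1 - x * V); lra.
have -> : V = 0; last by rewrite !mulr0 add0r.
rewrite /V big_seq big1 // => j js; rewrite indicE memNset ?mulr0 // => Aw.
by move/negP: wU; apply; rewrite inE; apply: AU js _ Aw.
Qed.

(** Here [x = al / (be * W)] in the preceding bound. *)
Lemma pr_second_moment (J : eqType) (s : seq J) (c : J -> R) (A : J -> set Omega) U (p W al be : R) :
  (forall j, measurable (A j)) -> measurable U -> (forall j, j \in s -> A j `<=` U) ->
  0 < W -> 0 < be -> 0 <= p ->  0 <= al ->
  al * p * W <= \sum_(j <- s) c j * pr P (A j) ->
  \sum_(j <- s) \sum_(j' <- s) c j * c j' * pr P (A j `&` A j') <= be * p * W ^+ 2 ->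
  al ^+ 2 / be * p <= pr P U.
Proof.
move=> mA mU AU W0 be0 p0 al0 h1 h2.
pose x := al / (be * W).
have x0 : 0 <= x by rewrite divr_ge0 // mulr_ge0 // ltW.
have := second_moment_le c x mA mU AU.
have {}h1 := ler_wpM2l (mulr_ge0 (ler0n R 2) x0) h1.
have {}h2 := ler_wpM2l (sqr_ge0 x) h2.
move=> h; have {h}h := le_trans h1 (le_trans h (lerD (lexx _) h2)).
have e1 : 2 * x * (al * p * W) = 2 * (al ^+ 2 / be * p) by rewrite /x; field; rewrite !gt_eqF.
have e2 : x ^+ 2 * (be * p * W ^+ 2) = al ^+ 2 / be * p by rewrite /x; field; rewrite !gt_eqF.
by move: h; rewrite e1 e2; lra.
Qed.

End SecondMoment.

Section ZerosAfter.
Variables (R : realType) (F : probability (lattice 4) R) (a : nat -> nat).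
Variables (disp : measure_display) (Omega : measurableType disp).
Variables (P : probability Omega R) (S : nat -> {RV P >-> lattice 4}).
Hypothesis F_indep : mutually_independent F (fun i : 'I_4 => coordinate R i).
Hypothesis S_walk : varying_dimension_walk 2 F a S.
Hypothesis F_law : forall i : 'I_4, exists u : R, centered_law (coord_law F i) u.
Implicit Types (i : 'I_4) (j k l m r n t : nat) (w : Omega) (E : set Omega).

Local Notation nspecial := (nspecial a).
Local Notation adapted := (adapted S).

Definition zero k : set Omega := [set w | S k w = 0].

Definition starts_at E m (x : lattice 4) : Prop := forall w, E w -> S m w = x.

Lemma adapted_zero k m : (k <= m)%N -> adapted m (zero k).
Proof. exact: (adapted_walk S_walk (Q := fun x => x = 0)). Qed.

Lemma measurable_zero k : measurable (zero k).
Proof. exact: (measurable_adapted (adapted_zero (leqnn k))). Qed.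

Lemma lattice_coordP (x y : lattice 4) : (forall i, coord i x = coord i y) -> x = y.
Proof. by move=> h; apply/rowP => i; exact: h. Qed.

Lemma zero_displaced E m r x : starts_at E m x ->
  E `&` zero (m + r) = E `&` displaced S m r (fun i => - coord i x).
Proof.
move=> st; apply/seteqP; split=> w [Ew h]; split=> //.
  by move=> i; rewrite h (st _ Ew) /coord mxE sub0r.
apply: lattice_coordP => i; have := h i; rewrite (st _ Ew) => /eqP.
by rewrite subr_eq addNr => /eqP ->; rewrite /coord mxE.
Qed.

Lemma pr_zero_le : exists C : R, 0 < C /\ forall E m k x, adapted m E -> starts_at E m x ->
  (m <= k)%N -> pr P (E `&` zero k) <= pr P E * (C / ((k - m).+1%:R * (nspecial k - nspecial m).+1%:R)).
Proof.
have [C [C0 hC]] := pr_displaced_le F_indep S_walk F_law.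
exists C; split=> // E m k x aE st mk.
have := hC m (k - m)%N E (fun i => - coord i x) aE.
by rewrite -(zero_displaced _ st) subnKC.
Qed.

Lemma inv_succ_sub_le (k m : nat) : (2 * m <= k)%N -> ((k - m).+1%:R)^-1 <= 2 * k.+1%:R^-1 :> R.
Proof.
move=> mk; rewrite -[leLHS]mul1r ler_pdivrMr ?ltr0n // mulrAC ler_pdivlMr ?ltr0n // mul1r.
rewrite -natrM ler_nat; clear -mk; lia.
Qed.

(** Starting late enough, [k - m] and the number of special times since [m] are
    comparable to [k] and to the number of special times up to [k], so the
    position at time [m] has no influence on the constant. *)
Lemma pr_two_zeros_le : exists C : R, 0 < C /\ forall E m k k' x,
  adapted m E -> starts_at E m x -> (m <= k)%N -> (2 * m <= k)%N -> (2 * nspecial m <= nspecial k)%N ->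
  (k <= k')%N ->
  pr P ((E `&` zero k) `&` (E `&` zero k')) <=
    pr P E * (C / (k.+1%:R * (nspecial k).+1%:R * ((k' - k).+1%:R * (nspecial k' - nspecial k).+1%:R))).
Proof.
have [C [C0 hC]] := pr_zero_le.
exists (4 * C ^+ 2); split=> [|E m k k' x aE st mk mk2 ck kk'].
  by rewrite mulr_gt0 // exprn_gt0.
have aEk : adapted k (E `&` zero k).
  by apply: adaptedI; [exact: adapted_le mk aE|exact: adapted_zero].
have stk : starts_at (E `&` zero k) k 0 by move=> w [].
have -> : (E `&` zero k) `&` (E `&` zero k') = (E `&` zero k) `&` zero k'.
  by apply/seteqP; split=> w => [[[? ?] [? ?]]|[[? ?] ?]].
apply: le_trans (hC _ _ _ _ aEk stk kk') _.
have h1 := hC _ _ _ _ aE st mk.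
have h2 : pr P (E `&` zero k) <= pr P E * (4 * C / (k.+1%:R * (nspecial k).+1%:R)).
  apply: le_trans h1 _; rewrite ler_wpM2l ?pr_ge0 //.
  have l1 := inv_succ_sub_le mk2; have l2 := inv_succ_sub_le ck.
  rewrite invfM; apply: le_trans (ler_wpM2l (ltW C0) (ler_pM _ _ l1 l2)) _.
  1,2: by rewrite invr_ge0.
  by rewrite le_eqVlt; apply/orP; left; apply/eqP; rewrite invfM; ring.
apply: le_trans (ler_wpM2r _ h2) _; first by rewrite divr_ge0 ?(ltW C0) // mulr_ge0.
rewrite le_eqVlt; apply/orP; left; apply/eqP; field.
rewrite ?nat1r ?natr1 !pnatr_eq0 //.
Qed.

End ZerosAfter.

Section Slots.
Variables (R : realType) (a : nat -> nat) (Lam : nat).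
Hypothesis a_pos : forall n, (1 <= n)%N -> (0 < a n)%N.
Hypothesis a_incr : forall n, (1 <= n)%N -> (a n < a n.+1)%N.
Hypothesis Lam0 : (0 < Lam)%N.
Implicit Types k l m n : nat.

Local Notation log_time := (log_time R a).
Local Notation gap := (gap R a).

Definition slots n : seq nat := [seq k <- index_iota (a n) (a n.+1) | (Lam %| k)%N].

Lemma mem_slots n k : (k \in slots n) = (Lam %| k)%N && (a n <= k < a n.+1)%N.
Proof. by rewrite mem_filter mem_index_iota. Qed.

Lemma sum_slots_le n : (1 <= n)%N -> \sum_(k <- slots n) k.+1%:R^-1 <= gap n.
Proof.
move=> n1; apply: le_trans (harmonic_le R (a_pos n1) (ltnW (a_incr n1))).
rewrite big_filter [leRHS](bigID (fun k => (Lam %| k)%N)) /= lerDl sumr_ge0 // => k _.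
Qed.

(** Rounding both ends of the interval to multiples of [Lam] costs [ln 3] at most
    in logarithmic length. *)
Lemma sum_slots_ge n : (1 <= n)%N -> (Lam <= a n)%N -> 6 <= gap n ->
  gap n / (2 * Lam%:R) <= \sum_(k <- slots n) k.+1%:R^-1.
Proof.
move=> n1 La g6.
have L0 : 0 < Lam%:R :> R by rewrite ltr0n.
pose u0 := (a n %/ Lam).+1; pose u1 := (a n.+1 %/ Lam)%N.
have x0 := a_pos n1; have y0 := a_pos (isT : (1 <= n.+1)%N).
have lny : log_time n.+1 <= ln u1.+1%:R + ln Lam%:R.
  rewrite -lnM ?posrE ?ltr0n // -natrM /log_time ler_ln ?posrE ?ltr0n ?muln_gt0 // ler_nat.
  by rewrite ltnW // ltn_ceil.
have ln3 : ln 3 <= 3 :> R by rewrite ltW // ln_sublinear.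
have lnx : ln u0.+1%:R + ln Lam%:R <= ln 3 + log_time n.
  rewrite -!lnM ?posrE ?ltr0n // -!natrM /log_time ler_ln ?posrE ?ltr0n ?muln_gt0 // ler_nat.
  have := leq_trunc_div (a n) Lam; rewrite /u0; clear -La; nia.
have half : gap n / 2 <= ln u1.+1%:R - ln u0.+1%:R.
  by move: g6 lny lnx ln3; rewrite /gap; lra.
have u01 : (u0 <= u1)%N.
  apply: ltnW; rewrite -ltnS -(ltr_nat R) -(@ltr_ln R) ?posrE ?ltr0n //.
  by rewrite -subr_gt0; apply: lt_le_trans half; move: g6; move: (gap n) => g; lra.
apply: le_trans (_ : Lam%:R^-1 * \sum_(u0 <= u < u1) u.+1%:R^-1 <= _).
  have -> : gap n / (2 * Lam%:R) = Lam%:R^-1 * (gap n / 2) by field; rewrite gt_eqF.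
  by rewrite ler_wpM2l ?invr_ge0 // (le_trans half) // harmonic_ge.
apply: le_trans (_ : \sum_(k <- [seq (Lam * u)%N | u <- index_iota u0 u1]) k.+1%:R^-1 <= _).
  rewrite big_map mulr_sumr; apply: ler_sum => u _.
  rewrite -invfM lef_pV2 ?posrE ?mulr_gt0 ?ltr0n // -natrM ler_nat.
  by rewrite mulnS -add1n leq_add2r.
apply: ler_sum_subset => [k|||k].
- by rewrite invr_ge0.
- rewrite map_inj_uniq ?iota_uniq // => u v /eqP; rewrite eqn_pmul2l // => /eqP //.
- exact/filter_uniq/iota_uniq.
move=> /mapP[u]; rewrite mem_index_iota => /andP[uu0 uu1] ->.
rewrite mem_slots dvdn_mulr //=.
have h1 : (a n <= Lam * u)%N.
  rewrite ltnW //; apply: leq_trans (ltn_ceil (a n) Lam0) _.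
  by rewrite mulnC leq_mul2l uu0 orbT.
have h2 : (Lam * u < a n.+1)%N.
  apply: leq_trans (leq_trunc_div (a n.+1) Lam).
  by rewrite mulnC ltn_pmul2r.
by rewrite h1.
Qed.

(** Two zeros in one interval: the later one sees the recurrence of the planar
    walk, whence the factor [log_time]. *)
Lemma slots_pair_diag n : (1 <= n)%N -> 1 <= log_time n.+1 ->
  \sum_(k <- slots n) \sum_(k' <- slots n | (k <= k')%N) (k.+1%:R * (k' - k).+1%:R)^-1 <=
  2 * gap n * log_time n.+1.
Proof.
move=> n1 l1.
apply: le_trans (_ : \sum_(k <- slots n) k.+1%:R^-1 * (2 * log_time n.+1) <= _); last first.
  rewrite -mulr_suml [2 * gap n]mulrC -mulrA ler_wpM2r ?sum_slots_le //.
  by rewrite mulr_ge0 // (le_trans _ l1).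
rewrite big_seq [leRHS]big_seq; apply: ler_sum => k; rewrite mem_slots => /and3P[_ nk kn].
under eq_bigr do rewrite invfM.
rewrite -mulr_sumr ler_wpM2l ?invr_ge0 //.
apply: le_trans (_ : \sum_(0 <= d < a n.+1) d.+1%:R^-1 <= _).
  apply: le_trans (_ : \sum_(k <= k' < a n.+1) (k' - k).+1%:R^-1 <= _).
    rewrite big_filter_cond [leRHS](big_nat_widenl _ _ _ _ _ nk) /=.
    rewrite [leRHS](bigID (fun k' => (Lam %| k')%N)) /=.
    rewrite (eq_bigl (fun i => (k <= i)%N && (Lam %| i)%N)) => [|k']; last by rewrite andbC.
    by rewrite lerDl sumr_ge0.
  rewrite -{1}[k]add0n big_addn; under eq_bigr do rewrite addnK.
  rewrite [leRHS](@big_cat_nat _ _ _ (a n.+1 - k)) ?leq_subr //= lerDl sumr_ge0 // => d _.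
have b0 := a_pos (isT : (1 <= n.+1)%N).
rewrite (big_ltn b0) invr1; have := harmonic_le R (ltn0Sn 0) b0.
rewrite ln1 subr0 => h; apply: le_trans (lerD (lexx _) h) _.
by rewrite /log_time in l1 *; lra.
Qed.

(** Zeros in different intervals: the gap before the later interval keeps the
    two times apart by at least half of the later one. *)
Lemma slots_pair_off n n' : (1 <= n)%N -> (n.+1 < n')%N -> 2 <= gap n'.-1 ->
  \sum_(k <- slots n) \sum_(k' <- slots n') (k.+1%:R * (k' - k).+1%:R)^-1 <=
  2 * gap n * gap n'.
Proof.
move=> n1 nn' g.
have n'1 : (1 <= n'.-1)%N by clear -nn'; lia.
have en' : n'.-1.+1 = n' by clear -nn'; lia.
have dbl : (2 * a n'.-1 <= a n')%N.
  rewrite -(ler_nat R) -(ler_ln _ _) ?posrE ?ltr0n ?muln_gt0 ?a_pos //; last by rewrite -en'.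
  rewrite natrM lnM ?posrE ?ltr0n ?a_pos //.
  have ln2 : ln 2 <= 2 :> R by rewrite ltW // ln_sublinear.
  by move: g; rewrite /gap en' /log_time; lra.
apply: le_trans (_ : \sum_(k <- slots n) \sum_(k' <- slots n') k.+1%:R^-1 * (2 * k'.+1%:R^-1) <= _).
  rewrite big_seq [leRHS]big_seq; apply: ler_sum => k; rewrite mem_slots => /and3P[_ nk kn].
  rewrite big_seq [leRHS]big_seq; apply: ler_sum => k'; rewrite mem_slots => /and3P[_ nk' kn'].
  rewrite invfM ler_wpM2l ?invr_ge0 //.
  have kk' : (2 * k <= k')%N.
    apply: leq_trans nk'; apply: leq_trans dbl; rewrite leq_mul2l /=.
    apply: leq_trans (ltnW kn) _; by apply: (times_le a_incr) => //; clear -nn'; lia.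
  rewrite -[leLHS]mul1r ler_pdivrMr ?ltr0n // mulrAC ler_pdivlMr ?ltr0n // mul1r.
  rewrite -natrM ler_nat; clear -kk'; lia.
under eq_bigr do rewrite -mulr_sumr -mulr_sumr.
rewrite -mulr_suml [2 * gap n]mulrC -mulrA.
apply: ler_pM; rewrite ?sum_slots_le //.
- by rewrite sumr_ge0 // => k _; rewrite invr_ge0.
- by rewrite mulr_ge0 // sumr_ge0 // => k _; rewrite invr_ge0.
by rewrite ler_wpM2l // sum_slots_le // ltnW // (leq_trans _ nn').
Qed.

End Slots.

Section PairTerms.
Variables (R : realType) (a : nat -> nat).
Variables (disp : measure_display) (Omega : measurableType disp).
Variables (P : probability Omega R) (S : nat -> {RV P >-> lattice 4}).
Hypothesis a_pos : forall n, (1 <= n)%N -> (0 < a n)%N.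
Hypothesis a_incr : forall n, (1 <= n)%N -> (a n < a n.+1)%N.
Implicit Types (j k l m n t : nat).
Variables (E : set Omega) (m : nat) (C : R) (Lam : nat).
Hypothesis C0 : 0 < C.

Local Notation nspecial := (nspecial a).
Local Notation log_time := (log_time R a).
Local Notation gap := (gap R a).
Local Notation phi := (phi R a).
Local Notation weight := (weight R a).
Local Notation slots := (slots a Lam).
Local Notation zero := (zero S).

Hypothesis two_zeros : forall k k', (2 * m <= k)%N -> (2 * nspecial m <= nspecial k)%N -> (k <= k')%N ->
  pr P ((E `&` zero k) `&` (E `&` zero k')) <=
    pr P E * (C / (k.+1%:R * (nspecial k).+1%:R * ((k' - k).+1%:R * (nspecial k' - nspecial k).+1%:R))).

Definition pair_term n n' : R := \sum_(k <- slots n) \sum_(k' <- slots n')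
  (log_time n.+1)^-1 * (log_time n'.+1)^-1 * pr P ((E `&` zero k) `&` (E `&` zero k')).

Lemma pair_term_sym n n' : pair_term n n' = pair_term n' n.
Proof.
rewrite /pair_term exchange_big /=; apply: eq_bigr => k _; apply: eq_bigr => k' _.
by rewrite setIC; congr (_ * _); rewrite mulrC.
Qed.

Lemma slot_pair_le n n' k k' : (1 <= n)%N -> (n <= n')%N -> (2 * m <= a n)%N -> (2 * nspecial m <= n)%N ->
  k \in slots n -> k' \in slots n' -> (k <= k')%N ->
  (log_time n.+1)^-1 * (log_time n'.+1)^-1 * pr P ((E `&` zero k) `&` (E `&` zero k')) <=
  (log_time n.+1)^-1 * (log_time n'.+1)^-1 * (pr P E * C / (n.+1%:R * (n' - n).+1%:R)) *
    (k.+1%:R * (k' - k).+1%:R)^-1.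
Proof.
move=> n1 nn' m2 cm2; rewrite !mem_slots => /and3P[_ nk kn] /and3P[_ nk' kn'] kk'.
have n'1 := leq_trans n1 nn'.
have ck := nspecialE a_pos a_incr n1 nk kn; have ck' := nspecialE a_pos a_incr n'1 nk' kn'.
rewrite -[leRHS]mulrA; apply: ler_wpM2l.
  by rewrite mulr_ge0 // invr_ge0 log_time_ge0.
apply: le_trans (two_zeros _ _ kk') _; rewrite ?ck ?ck' ?(leq_trans m2) //.
by rewrite le_eqVlt; apply/orP; left; apply/eqP; field; rewrite ?nat1r ?natr1 !pnatr_eq0.
Qed.

Lemma pair_term_diag n : (1 <= n)%N -> (2 * m <= a n)%N -> (2 * nspecial m <= n)%N ->
  1 <= log_time n.+1 -> pair_term n n <= pr P E * (4 * C) * weight n.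
Proof.
move=> n1 m2 cm2 l1; have lg0 : 0 < log_time n.+1 by apply: lt_le_trans l1.
apply: le_trans (sum_symmetric_le _ _ _) _.
- by move=> k k'; rewrite setIC.
- by move=> k k'; rewrite mulr_ge0 ?pr_ge0 // mulr_ge0 // invr_ge0 log_time_ge0.
pose B := (log_time n.+1)^-1 * (log_time n.+1)^-1 * (pr P E * C / (n.+1%:R * (n - n).+1%:R)).
have B0 : 0 <= B.
  rewrite mulr_ge0 // ?mulr_ge0 ?invr_ge0 ?pr_ge0 //; by rewrite ltW.
apply: le_trans (_ : 2 * (B * (2 * gap n * log_time n.+1)) <= _).
  rewrite ler_wpM2l //; apply: le_trans (ler_wpM2l B0 (slots_pair_diag Lam a_pos a_incr n1 l1)).
  rewrite mulr_sumr big_seq [leRHS]big_seq; apply: ler_sum => k ks.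
  rewrite mulr_sumr big_seq_cond [leRHS]big_seq_cond; apply: ler_sum => k' /andP[ks' kk'].
  exact: slot_pair_le.
rewrite /B subnn gapE //.
have -> : 2 * ((log_time n.+1)^-1 * (log_time n.+1)^-1 * (pr P E * C / (n.+1%:R * 1%:R)) *
   (2 * (phi n * log_time n.+1) * log_time n.+1)) = pr P E * (4 * C) * (n.+1%:R^-1 * phi n).
  by move: (phi n) => f; field; rewrite (gt_eqF lg0) ?nat1r pnatr_eq0.
rewrite ler_wpM2l ?mulr_ge0 ?pr_ge0 ?(ltW C0) // ler_wpM2r ?phi_ge0 //.
by rewrite lef_pV2 ?posrE ?ltr0n // ler_nat.
Qed.

Lemma pair_term_off n n' : (1 <= n)%N -> (n.+1 < n')%N -> (2 * m <= a n)%N -> (2 * nspecial m <= n)%N ->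
  2 <= gap n'.-1 ->
  pair_term n n' <= pr P E * (2 * C) * weight n * (phi n' / (n' - n)%:R).
Proof.
move=> n1 nn' m2 cm2 g2; have nn : (n < n')%N by rewrite ltnW.
have n'1 := ltn_trans n1 nn.
have lg0 : 0 < log_time n.+1 by apply: log_time_gt0.
have lg0' : 0 < log_time n'.+1 by apply: log_time_gt0.
pose B := (log_time n.+1)^-1 * (log_time n'.+1)^-1 * (pr P E * C / (n.+1%:R * (n' - n).+1%:R)).
have B0 : 0 <= B.
  rewrite mulr_ge0 // ?mulr_ge0 ?invr_ge0 ?pr_ge0 //; by rewrite ltW.
apply: le_trans (_ : B * (2 * gap n * gap n') <= _).
  apply: le_trans (ler_wpM2l B0 (slots_pair_off Lam a_pos a_incr n1 nn' g2)).
  rewrite /pair_term mulr_sumr big_seq [leRHS]big_seq; apply: ler_sum => k ks.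
  rewrite mulr_sumr big_seq [leRHS]big_seq; apply: ler_sum => k' ks'.
  apply: slot_pair_le => //; first exact: ltnW.
  move: ks ks'; rewrite !mem_slots => /and3P[_ _ kn] /and3P[_ nk' _].
  by apply: leq_trans nk'; apply: leq_trans (ltnW kn) _; exact: (times_le a_incr).
rewrite /B !gapE //.
have -> : (log_time n.+1)^-1 * (log_time n'.+1)^-1 * (pr P E * C / (n.+1%:R * (n' - n).+1%:R)) *
   (2 * (phi n * log_time n.+1) * (phi n' * log_time n'.+1)) =
   pr P E * (2 * C) * (n.+1%:R^-1 * phi n) * (phi n' / (n' - n).+1%:R).
  by move: (phi n) (phi n') => f f'; field; rewrite (gt_eqF lg0) (gt_eqF lg0') ?nat1r !pnatr_eq0.
have p0 := phi_ge0 R a_pos a_incr n1; have p0' := phi_ge0 R a_pos a_incr n'1.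
have dn : (0 < n' - n)%N by rewrite subn_gt0.
have PC0 : 0 <= pr P E * (2 * C) by rewrite !mulr_ge0 ?pr_ge0 ?(ltW C0).
apply: ler_pM.
- by apply: mulr_ge0 => //; apply: mulr_ge0 => //; rewrite invr_ge0.
- by apply: mulr_ge0 => //; rewrite invr_ge0.
- rewrite ler_wpM2l // ler_wpM2r //.
  by rewrite lef_pV2 ?posrE ?ltr0n // ler_nat.
by rewrite ler_wpM2l // lef_pV2 ?posrE ?ltr0n // ler_nat.
Qed.

End PairTerms.

Section ConditionalSecondMoment.
Variables (R : realType) (F : probability (lattice 4) R) (a : nat -> nat).
Variables (disp : measure_display) (Omega : measurableType disp).
Variables (P : probability Omega R) (S : nat -> {RV P >-> lattice 4}).
Hypothesis F_indep : mutually_independent F (fun i : 'I_4 => coordinate R i).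
Hypothesis S_walk : varying_dimension_walk 2 F a S.
Hypothesis F_law : forall i : 'I_4, exists u : R, centered_law (coord_law F i) u.
Hypothesis a_pos : forall n, (1 <= n)%N -> (0 < a n)%N.
Hypothesis a_incr : forall n, (1 <= n)%N -> (a n < a n.+1)%N.
Hypothesis phi_mono : forall m n, (1 <= m)%N -> (m <= n)%N -> phi R a n <= phi R a m.
Hypothesis phi_div : (\sum_(1 <= n <oo) (n%:R^-1 * phi R a n)%:E = +oo)%E.
Implicit Types (i : 'I_4) (j k l m r n t : nat) (w : Omega) (E : set Omega).

Local Notation nspecial := (nspecial a).
Local Notation adapted := (adapted S).
Local Notation log_time := (log_time R a).
Local Notation gap := (gap R a).
Local Notation phi := (phi R a).
Local Notation weight := (weight R a).
Local Notation good := (good R a).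
Local Notation thin := (thin R a).
Local Notation full := (full R a).
Local Notation zero := (zero S).

Definition returns m : set Omega := [set w | exists2 k, (m < k)%N & S k w = 0].

Lemma measurable_returns m : measurable (returns m).
Proof.
have -> : returns m = \bigcup_(k in [set k | (m < k)%N]) zero k.
  by apply/seteqP; split=> w [k mk z]; exists k.
by apply: bigcup_measurable => k _; exact: (measurable_zero S_walk).
Qed.

(** The lower bound for a zero at each slot; the weight turns the logarithmic
    length of the interval into [phi n]. *)
Lemma first_moment_term Lam (c : R) m n E k0 x : (0 < Lam)%N -> 0 < c ->
  (forall r, (Lam %| r)%N -> (k0 <= r)%N -> (Lam %| nspecial (m + r) - nspecial m)%N ->
     (k0 <= nspecial (m + r) - nspecial m)%N ->
     pr P E * (c / (r.+1%:R * (nspecial (m + r) - nspecial m).+1%:R)) <= pr P (E `&` displaced S m r (fun i => - coord i x))) ->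
  starts_at S E m x ->
  (Lam %| m)%N -> (Lam %| nspecial m)%N -> (Lam %| n)%N ->
  (1 <= n)%N -> (m + k0 <= n)%N -> (nspecial m + k0 <= n)%N -> (Lam <= a n)%N -> 6 <= gap n ->
  pr P E * (c / (4 * Lam%:R)) * weight n <=
  \sum_(k <- slots a Lam n) (log_time n.+1)^-1 * pr P (E `&` zero k).
Proof.
move=> L0 c0 low st Lm Lcm Ln n1 mn cmn La g6.
have lg0 : 0 < log_time n.+1 by apply: log_time_gt0.
have L0R : 0 < Lam%:R :> R by rewrite ltr0n.
have na := le_times a_pos a_incr n1.
apply: le_trans (_ : \sum_(k <- slots a Lam n)
    (log_time n.+1)^-1 * (pr P E * (c / n.+1%:R)) * k.+1%:R^-1 <= _); last first.
  rewrite big_seq [leRHS]big_seq; apply: ler_sum => k; rewrite mem_slots => /and3P[Lk nk kn].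
  have mk : (m + k0 <= k)%N by apply: leq_trans nk; apply: leq_trans na.
  have mk' : (m <= k)%N by apply: leq_trans mk; rewrite leq_addr.
  have ck := nspecialE a_pos a_incr n1 nk kn.
  rewrite -mulrA ler_wpM2l ?invr_ge0 ?(ltW lg0) //.
  have := low (k - m)%N; rewrite subnKC // ck.
  rewrite -(zero_displaced _ st) subnKC // => h; apply: le_trans (h _ _ _ _).
  - rewrite -mulrA ler_wpM2l ?pr_ge0 // -mulrA ler_wpM2l ?(ltW c0) //.
    rewrite -invfM lef_pV2 ?posrE ?mulr_gt0 ?ltr0n // mulrC ler_pM // ler_nat ltnS leq_subr //.
  - by rewrite dvdn_sub.
  - by clear -mk; lia.
  - by rewrite dvdn_sub.
  - by clear -cmn; lia.
rewrite -mulr_sumr.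
have B0 : 0 <= (log_time n.+1)^-1 * (pr P E * (c / n.+1%:R)).
  by rewrite mulr_ge0 ?invr_ge0 ?(ltW lg0) // mulr_ge0 ?pr_ge0 // divr_ge0 // ltW.
apply: le_trans (ler_wpM2l B0 (sum_slots_ge a_pos L0 n1 La g6)).
rewrite gapE //.
have -> : (log_time n.+1)^-1 * (pr P E * (c / n.+1%:R)) * (phi n * log_time n.+1 / (2 * Lam%:R)) =
    pr P E * (c / (2 * Lam%:R)) * phi n * n.+1%:R^-1.
  by move: (phi n) => f; field; rewrite (gt_eqF lg0) (gt_eqF L0R) ?nat1r pnatr_eq0.
have -> : pr P E * (c / (4 * Lam%:R)) * weight n =
    pr P E * (c / (2 * Lam%:R)) * phi n * (2 * n%:R)^-1.
  rewrite /weight; move: (phi n) => f; field; rewrite (gt_eqF L0R) pnatr_eq0 -lt0n n1 //.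
rewrite ler_wpM2l //.
  by rewrite mulr_ge0 ?phi_ge0 // mulr_ge0 ?pr_ge0 // divr_ge0 ?mulr_ge0 // ltW.
by rewrite lef_pV2 ?posrE ?mulr_gt0 ?ltr0n // -natrM ler_nat; clear -n1; lia.
Qed.

(** The second moment over the indices [q * t], thinned so that the weighted
    mean [W] and the total [full (q * T)] are comparable. *)
Lemma second_moment_sum (C : R) Lam m E q t0 T :
  0 < C -> (2 <= q)%N -> (1 <= t0)%N ->
  (forall k k', (2 * m <= k)%N -> (2 * nspecial m <= nspecial k)%N -> (k <= k')%N ->
     pr P ((E `&` zero k) `&` (E `&` zero k')) <=
     pr P E * (C / (k.+1%:R * (nspecial k).+1%:R * ((k' - k).+1%:R * (nspecial k' - nspecial k).+1%:R)))) ->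
  (forall t, (t0 <= t)%N -> good (q * t) ->
     [/\ (2 * m <= a (q * t))%N, (2 * nspecial m <= q * t)%N, 2 <= gap (q * t).-1 & 1 <= log_time (q * t).+1]) ->
  1 <= thin q t0 T -> full (q * T) <= q.+1%:R * thin q t0 T ->
  \sum_(t <- index_iota t0 T | good (q * t)) \sum_(t' <- index_iota t0 T | good (q * t'))
    pair_term a S E Lam (q * t) (q * t') <=
  (4 * C * q.+2%:R) * pr P E * thin q t0 T ^+ 2.
Proof.
move=> C0 q2 t01 two gt W1 fW; set W := thin q t0 T in W1 fW *.
have q0 : (0 < q)%N by apply: ltnW.
pose s := [seq t <- index_iota t0 T | good (q * t)].
have us : uniq s by apply: filter_uniq; exact: iota_uniq.
have Ws : W = \sum_(t <- s) weight (q * t) by rewrite big_filter.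
have ts t : t \in s -> [/\ (t0 <= t)%N, good (q * t) & (1 <= q * t)%N].
  rewrite mem_filter mem_index_iota => /and3P[g tt _]; split=> //.
  by rewrite muln_gt0 q0 (leq_trans t01).
rewrite -big_filter -/s; under eq_bigr do rewrite -big_filter -/s.
rewrite (sum_symmetric s (fun t t' => pair_term_sym a S E Lam (q * t) (q * t'))).
have PC0 : 0 <= pr P E * C by rewrite mulr_ge0 ?pr_ge0 ?(ltW C0).
have diag : \sum_(t <- s) \sum_(t' <- s | t' == t) pair_term a S E Lam (q * t) (q * t') <=
    pr P E * (4 * C) * W.
  rewrite Ws mulr_sumr big_seq [leRHS]big_seq; apply: ler_sum => t /[dup] st /ts [tt g n1].
  rewrite -big_filter (_ : [seq t' <- s | t' == t] = [:: t]) ?big_seq1; last exact: filter_pred1_uniq.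
  have [m2 cm2 _ l1] := gt t tt g.
  exact: (pair_term_diag a_pos a_incr Lam C0 two).
have off : \sum_(t <- s) \sum_(t' <- s | (t < t')%N) pair_term a S E Lam (q * t) (q * t') <=
    pr P E * (2 * C) * W * (q.+1%:R * W).
  apply: le_trans (_ : \sum_(t <- s) pr P E * (2 * C) * weight (q * t) * full (q * T) <= _); last first.
    rewrite -mulr_suml -mulr_sumr -Ws; apply: ler_wpM2l => //.
    by rewrite mulr_ge0 ?(le_trans _ W1) // mulrCA mulr_ge0.
  rewrite big_seq [leRHS]big_seq; apply: ler_sum => t /[dup] st /ts [tt g n1].
  have [m2 cm2 _ _] := gt t tt g.
  have w0 : 0 <= pr P E * (2 * C) * weight (q * t).
    by apply: mulr_ge0; [rewrite mulrCA mulr_ge0|exact: weight_ge0].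
  apply: le_trans (ler_wpM2l w0 (interaction_sum a_pos a_incr phi_mono t T q0)).
  rewrite mulr_sumr.
  apply: le_trans (_ : \sum_(t' <- s | (t < t')%N)
     pr P E * (2 * C) * weight (q * t) * (phi (q * t') / (q * t' - q * t)%:R) <= _).
    rewrite big_seq_cond [leRHS]big_seq_cond; apply: ler_sum => t' /andP[/ts[tt' g' n1'] lt].
    have [_ _ g2 _] := gt t' tt' g'.
    apply: (pair_term_off a_pos a_incr Lam C0 two) => //.
    have : (q * t.+1 <= q * t')%N by rewrite leq_mul2l lt orbT.
    by rewrite mulnS; clear -q2; lia.
  rewrite big_filter_cond [leRHS](big_nat_widenl _ t0) ?(leq_trans tt) //.
  rewrite [leRHS](bigID (fun t' => good (q * t'))) /=.
  rewrite [leLHS](eq_bigl _ _ (fun t' => andbC _ _)).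
  rewrite lerDl sumr_ge0 // => t' /andP[lt _]; apply: mulr_ge0 => //.
  apply: mulr_ge0; rewrite ?invr_ge0 //; apply: phi_ge0 => //.
  by rewrite muln_gt0 q0 (leq_trans _ lt).
apply: le_trans (lerD diag (ler_wpM2l (ler0n R 2) off)) _.
have -> : 4 * C * q.+2%:R * pr P E * W ^+ 2 = pr P E * C * (4 * W ^+ 2 + 4 * W ^+ 2 * q.+1%:R).
  by rewrite -[q.+2]add1n natrD; ring.
have -> : pr P E * (4 * C) * W + 2 * (pr P E * (2 * C) * W * (q.+1%:R * W)) =
   pr P E * C * (4 * W + 4 * W ^+ 2 * q.+1%:R) by ring.
by rewrite ler_wpM2l // lerD2r ler_wpM2l // expr2 ler_peMl // (le_trans _ W1).
Qed.

(** A walk that sits anywhere at a suitable time [m] returns to the origin with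
    probability bounded below: the bound may not depend on where it sits, since
    that is what conditioning on the whole past requires. *)
Lemma later_zero : exists Lam (del : R), [/\ (0 < Lam)%N, 0 < del &
  forall m E x, (Lam %| m)%N -> (Lam %| nspecial m)%N -> adapted m E -> starts_at S E m x ->
    del * pr P E <= pr P (E `&` returns m)].
Proof.
have [C [C0 hC]] := pr_two_zeros_le F_indep S_walk F_law.
have [Lam [hh [c [L0 c0 lat low _]]]] := walk_lower_bounds F_indep S_walk F_law.
have L0R : 0 < Lam%:R :> R by rewrite ltr0n.
pose q := (2 * Lam)%N; pose al := c / (4 * Lam%:R) : R; pose be := 4 * C * q.+2%:R : R.
have q0 : (0 < q)%N by rewrite muln_gt0.
have q2 : (2 <= q)%N by rewrite /q; clear -L0; lia.
have al0 : 0 < al by rewrite divr_gt0 // mulr_gt0.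
have be0 : 0 < be by rewrite !mulr_gt0.
exists Lam, (al ^+ 2 / be); split=> // [|m E x Lm Lcm aE st].
  by rewrite divr_gt0 // exprn_gt0.
have mE := measurable_adapted aE.
have mU : measurable (E `&` returns m) by apply: measurableI => //; exact: measurable_returns.
have [pE|pE] := leP (pr P E) 0.
  have -> : pr P E = 0 by apply/eqP; rewrite eq_le pE pr_ge0.
  by rewrite mulr0 pr_ge0.
have hx : 0 < pr P [set w | S m w = x].
  apply: lt_le_trans pE _; apply: le_pr => //.
  exact: (measurable_adapted (adapted_walk S_walk (Q := fun y => y = x) (leqnn m))).
have hv i : (hh i %| - coord i x)%Z by rewrite rpredN; exact: lat hx i.
have [k0 {}low] := low (fun i => - coord i x) hv.
have [n0 hn0] := good_gap a_pos a_incr phi_mono (6 : R).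
pose t0 := (n0 + 2 * nspecial m + k0 + 2 * m + Lam + 1)%N.
have t01 : (1 <= t0)%N by rewrite /t0 addn1.
have facts t : (t0 <= t)%N -> good (q * t) -> [/\ (t0 <= q * t)%N, (t0 <= a (q * t))%N,
    6 <= gap (q * t), 6 <= gap (q * t).-1 & 6 <= log_time (q * t)].
  move=> tt g; have tq : (t0 <= q * t)%N by apply: leq_trans tt _; rewrite leq_pmull.
  have n1 := leq_trans t01 tq.
  have [|g1 g2 g3] := hn0 (q * t)%N _ g.
    by apply: leq_trans tq; rewrite /t0 -!addnA leq_addr.
  by split=> //; apply: leq_trans tq _; exact: le_times.
have [T [tT W1 fW]] := thin_large a_pos a_incr phi_mono phi_div (1 : R) q0 t01.
pose W := thin q t0 T; have W0 : 0 < W by apply: lt_le_trans W1.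
pose J := [seq ((q * t)%N, k) | t <- [seq t <- index_iota t0 T | good (q * t)],
                                k <- slots a Lam (q * t)].
have sumJ (f : nat * nat -> R) : \sum_(j <- J) f j =
    \sum_(t <- index_iota t0 T | good (q * t)) \sum_(k <- slots a Lam (q * t)) f ((q * t)%N, k).
  by rewrite big_allpairs_dep big_filter.
apply: (pr_second_moment (s := J) (c := fun p => (log_time p.1.+1)^-1)
  (A := fun p => E `&` zero p.2) (p := pr P E) (W := W) (al := al) (be := be)) => //.
- by move=> j; apply: measurableI => //; exact: (measurable_zero S_walk).
- move=> j /allpairsPdep[t [k [st' sk ->]]] w [Ew z]; split=> //; exists k => //=.
  move: st' sk; rewrite mem_filter mem_index_iota mem_slots => /and3P[g tt _] /and3P[_ nk _].
  have [_ ta _ _ _] := facts t tt g; apply: leq_trans nk; apply: leq_trans ta.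
  by rewrite /t0; clear; lia.
- exact: pr_ge0.
- exact: ltW.
- rewrite sumJ /W /thin mulr_sumr big_nat_cond [leRHS]big_nat_cond.
  apply: ler_sum => t /andP[/andP[tt _] g].
  have [tq ta g1 _ _] := facts t tt g; rewrite [al * _]mulrC.
  have n1 := leq_trans t01 tq.
  apply: (first_moment_term L0 c0 _ st) => //.
  + by move=> r; apply: low.
  + by rewrite /q mulnAC dvdn_mull.
  + by apply: leq_trans tq; rewrite /t0; clear; lia.
  + by apply: leq_trans tq; rewrite /t0; clear; lia.
  + by apply: leq_trans ta; rewrite /t0; clear; lia.
rewrite sumJ; under eq_bigr do under eq_bigr do rewrite sumJ.
under eq_bigr do rewrite exchange_big /=.
apply: (@second_moment_sum C Lam m E q t0 T) => // [k k' m2 cm2 kk'|t tt g].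
  apply: (hC E m k k' x) => //; by apply: leq_trans m2; rewrite leq_pmull.
have [tq ta g1 g2 g3] := facts t tt g; have n1 := leq_trans t01 tq.
split.
- by apply: leq_trans ta; rewrite /t0; clear; lia.
- by apply: leq_trans tq; rewrite /t0; clear; lia.
- by apply: le_trans g2; rewrite ler_nat.
apply: le_trans (ltW (log_time_lt R a_pos a_incr n1)); apply: le_trans g3; rewrite ler1n //.
Qed.

End ConditionalSecondMoment.

(** * Recurrence *)

Section Recurrence.
Variables (R : realType) (F : probability (lattice 4) R) (a : nat -> nat).
Variables (disp : measure_display) (Omega : measurableType disp).
Variables (P : probability Omega R) (S : nat -> {RV P >-> lattice 4}).
Hypothesis F_indep : mutually_independent F (fun i : 'I_4 => coordinate R i).
Hypothesis S_walk : varying_dimension_walk 2 F a S.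
Hypothesis F_law : forall i : 'I_4, exists u : R, centered_law (coord_law F i) u.
Hypothesis a_pos : forall n, (1 <= n)%N -> (0 < a n)%N.
Hypothesis a_incr : forall n, (1 <= n)%N -> (a n < a n.+1)%N.
Hypothesis phi_mono : forall m n, (1 <= m)%N -> (m <= n)%N -> phi R a n <= phi R a m.
Hypothesis phi_div : (\sum_(1 <= n <oo) (n%:R^-1 * phi R a n)%:E = +oo)%E.
Implicit Types (k m n t : nat) (w : Omega) (B : set Omega).

Local Notation nspecial := (nspecial a).
Local Notation adapted := (adapted S).
Local Notation returns := (returns S).

Definition absent m n : set Omega := [set w | forall k, (m < k)%N -> (k <= n)%N -> S k w <> 0].

Lemma adapted_absent m n : adapted n (absent m n).
Proof.
move=> w w' h ab k mk kn; have := ab k mk kn.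
exact: (adapted_walk S_walk (Q := fun x => x <> 0) kn h).
Qed.

Lemma measurable_absent m n : measurable (absent m n).
Proof. exact: (measurable_adapted (@adapted_absent m n)). Qed.

Lemma measurable_never m : measurable (~` returns m).
Proof. by apply: measurableC; exact: (measurable_returns S_walk). Qed.

Lemma neverE m : ~` returns m = \bigcap_n absent m n.
Proof.
apply/seteqP; split=> w /= h; first by move=> n _ k mk _ z; apply: h; exists k.
by move=> [k mk z]; exact: (h k I k mk (leqnn k) z).
Qed.

Lemma pr_absent_near m (e : R) : 0 < e -> exists N, forall n, (N <= n)%N ->
  pr P (absent m n) < pr P (~` returns m) + e.
Proof.
move=> e0; have mB := @measurable_never m.
have mA n := measurable_absent m n.
have dec : nonincreasing_seq (absent m).
  apply/nonincreasing_seqP => n; apply/subsetPset => w h k mk kn.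
  by apply: h => //; exact: leqW.
rewrite neverE in mB *.
have A0 : (P (absent m 0) < +oo)%E by rewrite prE // ltry.
have h := nonincreasing_cvg_mu A0 mA mB dec.
have {}h : pr P (absent m n) @[n --> \oo] --> pr P (\bigcap_n absent m n).
  by apply: fine_cvg; rewrite -prE //; exact: h.
have lt : pr P (\bigcap_n absent m n) < pr P (\bigcap_n absent m n) + e by rewrite ltrDl.
by have [N _ hN] := cvgr_lt _ h _ lt; exists N => n Nn; exact: hN.
Qed.

(** Conditionally on the whole past the walk returns with probability at least
    [del]; summing over pasts, so it does given any past event. *)
Lemma pr_no_return_le : exists Lam (del : R), [/\ (0 < Lam)%N, 0 < del, del <= 1 &
  forall m B, (Lam %| m)%N -> (Lam %| nspecial m)%N -> adapted m B ->
    pr P (B `&` ~` returns m) <= pr P B * (1 - del)].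
Proof.
have [Lam [del [L0 d0 hdel]]] :=
  later_zero F_indep S_walk F_law a_pos a_incr phi_mono phi_div.
exists Lam, (Num.min del 1); split=> //; first by rewrite lt_min d0 ltr01.
  by rewrite ge_min lexx orbT.
move=> m B Lm Lcm aB; have b0 : 0 <= 1 - Num.min del 1 by rewrite subr_ge0 ge_min lexx orbT.
have := pr_fibers_le (measurable_history S m)
  (Q := fun h => exists2 w', history S m w' = h & B w') (measurable_never m) b0.
rewrite -(adaptedE aB); apply => l _.
set E := [set w | _].
have aE : adapted m E by move=> w w' e; rewrite /E /= e.
have mE := measurable_adapted aE.
have mR := measurable_returns S_walk m.
have [x st] : exists x, starts_at S E m x.
  have [[w0 h0]|h0] := pselect (exists w, E w); last by exists 0 => w Ew; case: h0; exists w.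
  exists (S m w0) => w Ew.
  apply: (adapted_walk S_walk (Q := fun y => y = S m w0) (leqnn m) (w := w0)) => //.
  by rewrite h0 Ew.
have h := hdel m E x Lm Lcm aE st.
have : pr P (E `&` ~` returns m) + pr P (E `&` returns m) <= pr P E.
  have := @pr_indic_le _ _ _ P bool unit [:: true; false] [:: tt] (fun=> 1) (fun=> 1)
    (fun b => if b then E `&` ~` returns m else E `&` returns m) (fun=> E).
  rewrite !big_cons !big_nil /= !mul1r !addr0; apply=> // [[]|w].
  - by apply: measurableI => //; exact: measurableC.
  - exact: measurableI.
  rewrite !big_cons !big_nil /= !mul1r !addr0 !indicE !in_setI in_setC.
  by case: (w \in E); case: (w \in returns m); rewrite /= ?addr0 ?add0r.
have p0 := pr_ge0 P E.
have : pr P E * Num.min del 1 <= del * pr P E.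
  by rewrite mulrC ler_wpM2r // ge_min lexx.
by rewrite mulrBr mulr1; lra.
Qed.

(** Intervals between special times are eventually long enough to contain a
    multiple of [Lam]. *)
Lemma aligned_time Lam N : (0 < Lam)%N ->
  exists m, [/\ (N <= m)%N, (Lam %| m)%N & (Lam %| nspecial m)%N].
Proof.
move=> L0; have [n0 hn0] := good_gap a_pos a_incr phi_mono (6 : R).
have [t tt g] := good_multiple a_pos a_incr phi_mono phi_div (N + n0 + Lam).+1 L0.
set n := (Lam * t)%N in g; have tn : (t <= n)%N by rewrite leq_pmull.
have n1 : (1 <= n)%N by apply: leq_trans tn; apply: leq_trans tt.
have nn0 : (n0 <= n)%N by clear -tn tt; lia.
have [g6 _ _] := hn0 n nn0 g.
have na := le_times a_pos a_incr n1.
have La : (Lam <= a n)%N by clear -tn tt na; lia.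
have := sum_slots_ge a_pos L0 n1 La g6.
case E : (slots a Lam n) => [|k s].
  rewrite big_nil => h; have : 0 < gap R a n / (2 * Lam%:R).
    by rewrite divr_gt0 ?mulr_gt0 ?ltr0n //; apply: lt_le_trans g6.
  by rewrite ltNge h.
move=> _; have : k \in slots a Lam n by rewrite E mem_head.
rewrite mem_slots => /and3P[Lk nk kn]; exists k; split=> //.
  by clear -tn tt na nk; lia.
by rewrite (nspecialE a_pos a_incr n1 nk kn) dvdn_mulr.
Qed.

(** The walk has no zero after [m] only if it has none in a finite stretch, whose
    probability is as close as wanted, and none after that stretch either, which
    costs a factor [1 - del]. *)
Lemma pr_never m : pr P (~` returns m) = 0.
Proof.
have [Lam [del [L0 d0 d1 hdel]]] := pr_no_return_le.
set u := pr P _; have u0 : 0 <= u by apply: pr_ge0.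
apply/eqP; rewrite eq_le u0 andbT leNgt; apply/negP => up.
have [N hN] := pr_absent_near m (mulr_gt0 d0 up).
have [n [nN Ln Lcn]] := aligned_time (maxn N m) L0.
move: nN; rewrite geq_max => /andP[nN mn].
have h1 := hN n nN; have h2 := hdel n _ Ln Lcn (@adapted_absent m n).
have h3 : u <= pr P (absent m n `&` ~` returns n).
  apply: le_pr; [exact: measurable_never|apply: measurableI; [exact: measurable_absent|exact: measurable_never]|].
  move=> w nr; split=> [k mk kn z|[k nk z]]; apply: nr; exists k => //.
  exact: leq_ltn_trans nk.
have h4 : pr P (absent m n) * (1 - del) <= (u + del * u) * (1 - del).
  by rewrite ler_wpM2r ?subr_ge0 // ltW.
have := mulr_gt0 d0 (mulr_gt0 d0 up).
by move: (le_trans h3 (le_trans h2 h4)); lra.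
Qed.

Theorem walk_recurrent : recurrent S.
Proof.
suff neg : P.-negligible (~` [set w | infinite_set [set k | S k w = 0]]) by exact: neg.
apply: (@negligibleS _ _ _ _ (\bigcup_m ~` returns m)); last first.
  apply: negligible_bigcup => m; apply/negligibleP; first exact: measurable_never.
  have e : P (~` returns m) = 0 by rewrite prE ?pr_never //; exact: measurable_never.
  exact: e.
move=> w /= /contrapT fin; apply: contrapT => h.
have ret m : returns m w by apply: contrapT => nr; apply: h; exists m.
have [M hM] : exists M, forall k, S k w = 0 -> (k < M)%N.
  have /finite_seqP[l hl] := fin.
  exists (\max_(k <- l) k).+1 => k Sk; rewrite ltnS.
  have kl : k \in l by have : [set k | S k w = 0] k by []; rewrite hl.
  exact: (@leq_bigmax_seq _ l xpredT id k kl).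
have [k Mk Sk] := ret M; have := hM k Sk.
by rewrite ltnNge ltnW.
Qed.

End Recurrence.

Theorem theorem2p5 (R : realType) (F : probability (lattice 4) R)
    (F_dim : truly_dimensional F)
    (F_integrable : forall i : 'I_4,
      F.-integrable [set: lattice 4] (EFin \o coordinate R i))
    (F_mean : forall i : 'I_4, ('E_F[coordinate R i] = 0)%E)
    (F_var : forall i : 'I_4, ('V_F[coordinate R i] < +oo)%E)
    (F_indep : mutually_independent F (fun i : 'I_4 => coordinate R i))
    (a : nat -> nat)
    (a_pos : forall n, (1 <= n)%N -> (0 < a n)%N)
    (a_incr : forall n, (1 <= n)%N -> (a n < a n.+1)%N)
    (disp : measure_display) (Omega : measurableType disp)
    (P : probability Omega R) (S : nat -> {RV P >-> lattice 4})
    (S_walk : varying_dimension_walk 2 F a S) :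
  ((\sum_(1 <= n <oo) (n%:R^-1 * phi R a n)%:E < +oo)%E -> transient S) /\
  ((\sum_(1 <= n <oo) (n%:R^-1 * phi R a n)%:E = +oo)%E ->
   (forall m n, (1 <= m)%N -> (m <= n)%N -> phi R a n <= phi R a m) ->
   recurrent S).
Proof.
have F_law (i : 'I_4) : exists u : R, centered_law (coord_law F i) u.
  apply: coord_law_centered (F_integrable i) (F_mean i) (F_var i) _.
  exact: truly_dimensional_coord F_dim.
split=> [conv|div mono].
  exact: (walk_transient F_indep S_walk F_law a_pos a_incr conv).
exact: (walk_recurrent F_indep S_walk F_law a_pos a_incr mono div).
Qed.
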